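(* Let $\mathcal{X},\mathcal{Y},\mathcal{Z}$ be classes of objects in a weakly idempotent complete (WIC) Frobenius category $\mathcal{A}$. Then $(\mathcal{X},\mathcal{Y},\mathcal{Z})$ is a localizing cotorsion triple in $\mathcal{A}$ if and only if $(\mathcal{X}/\!\sim,\mathcal{Y}/\!\sim,\mathcal{Z}/\!\sim)$ is a torsion triple in the stable category $\mathcal{A}/\!\sim$. In this case there are equivalences of triangulated categories $$\mathcal{X}/\!\sim\ \cong\ \mathcal{A}/\mathcal{Y}\ \cong\ \mathcal{Z}/\!\sim.$$ Moreover, let $\mathcal{W}$ be the class of projective-injective objects of $\mathcal{A}$. (1) Taking the injective cotorsion pairs $\mathcal{M}_1=(\mathcal{W},\mathcal{A})$, $\mathcal{M}_2=(\mathcal{X},\mathcal{Y})$, $\mathcal{M}_3=(\mathcal{Y},\mathcal{Z})$ in the injective recollement theorem yields a recollement $$\mathcal{Y}/\!\sim\ \xrightarrow{\ I\ }\ \mathcal{A}/\!\sim\ \xrightarrow{\ Q\ }\ \mathcal{A}/\mathcal{Y},$$ where $I$ is the inclusion, with left adjoint $\mathrm{E}(\mathcal{X},\mathcal{Y})$ and right adjoint $\mathrm{C}(\mathcal{Y},\mathcal{Z})$, and $Q$ is the quotient functor $Q([f])=\gamma_{\mathcal{Y}}(f)$, with left adjoint $\lambda=\mathrm{C}(\mathcal{X},\mathcal{Y})$ and right adjoint $\rho=\mathrm{E}(\mathcal{Y},\mathcal{Z})$. The essential image of $\lambda$ is $\mathcal{X}/\!\sim$, the essential image of $\rho$ is $\mathcal{Z}/\!\sim$,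 and they provide an equivalence $\lambda:\mathcal{Z}/\!\sim\ \longleftrightarrow\ \mathcal{X}/\!\sim\ :\rho$. (2) Taking the projective cotorsion pairs $\mathcal{M}_1=(\mathcal{A},\mathcal{W})$, $\mathcal{M}_2=(\mathcal{Y},\mathcal{Z})$, $\mathcal{M}_3=(\mathcal{X},\mathcal{Y})$ in the projective recollement theorem yields exactly the same recollement diagram as in (1).
   Context: Exact categories are in the sense of Quillen, with distinguished admissible short exact sequences $A\rightarrowtail B\twoheadrightarrow C$. A Frobenius category is an exact category with enough projectives and enough injectives in which projective and injective objects coincide (the projective-injective objects). It is a WIC Frobenius category if its underlying additive category is weakly idempotent complete (every split monomorphism has a cokernel). Its stable category $\mathcal{A}/\!\sim$ has the same objects with morphisms modulo $f\sim g$ iff $g-f$ factors through a projective-injective object; it is triangulated. For a class $\mathcal{S}$ of objects, $\mathcal{S}/\!\sim$ is the corresponding full subcategory of $\mathcal{A}/\!\sim$. A pair of classes $(\mathcal{U},\mathcal{V})$ is a cotorsion pair if $\mathcal{U}=\{A:\mathrm{Ext}^1(A,V)=0\ \forall V\in\mathcal{V}\}$ and $\mathcal{V}=\{A:\mathrm{Ext}^1(U,A)=0\ \forall U\in\mathcal{U}\}$. It is complete if for each object $A$ there are admissible short exact sequences $V\rightarrowtail U\twoheadrightarrow A$ and $A\rightarrowtail V'\twoheadrightarrow U'$ with $U,U'\in\mathcal{U}$ and $V,V'\in\mathcal{V}$; then $\mathrm{C}(\mathcal{U},\mathcal{V})$ denotes the functor induced by $A\mapsto U$ and $\mathrm{E}(\mathcal{U},\mathcal{V})$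 the functor induced by $A\mapsto V'$. A class is thick if it is closed under retracts and satisfies two-out-of-three on admissible short exact sequences. An injective cotorsion pair is a complete cotorsion pair $(\mathcal{U},\mathcal{V})$ with $\mathcal{U}$ thick and $\mathcal{U}\cap\mathcal{V}$ the class of injectives; a projective cotorsion pair is a complete cotorsion pair with $\mathcal{V}$ thick and $\mathcal{U}\cap\mathcal{V}$ the class of projectives. In a WIC Frobenius category a complete cotorsion pair is called localizing if $\mathcal{U}$ is thick (equivalently $\mathcal{V}$ is thick); such a pair is both injective and projective. $(\mathcal{X},\mathcal{Y},\mathcal{Z})$ is a localizing cotorsion triple if $(\mathcal{X},\mathcal{Y})$ and $(\mathcal{Y},\mathcal{Z})$ are localizing cotorsion pairs. In a triangulated category $\mathcal{T}$, a torsion pair is a pair $(\mathcal{X}',\mathcal{Y}')$ of full subcategories closed under isomorphisms with $\mathrm{Hom}(\mathcal{X}',\mathcal{Y}')=0$, $\Sigma\mathcal{X}'\subseteq\mathcal{X}'$, $\Sigma^{-1}\mathcal{Y}'\subseteq\mathcal{Y}'$, and for each $T$ an exact triangle $X\to T\to Y\to\Sigma X$ with $X\in\mathcal{X}'$, $Y\in\mathcal{Y}'$. A torsion triple is a triple of thick subcategories (triangulated, closed under isomorphisms and direct summands) $(\mathcal{X}',\mathcal{Y}',\mathcal{Z}')$ with $(\mathcal{X}',\mathcal{Y}')$ and $(\mathcal{Y}',\mathcal{Z}')$ torsion pairs. $\gamma_{\mathcal{Y}}:\mathcal{A}\to\mathcal{A}/\mathcal{Y}$ is the localization of $\mathcal{A}$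 at the maps that factor as an admissible monomorphism with cokernel in $\mathcal{Y}$ followed by an admissible epimorphism with kernel in $\mathcal{Y}$ (the homotopy category of the exact model structures with $\mathcal{Y}$ as trivial objects), with its triangulated structure. A recollement $\mathcal{T}'\xrightarrow{I}\mathcal{T}\xrightarrow{Q}\mathcal{T}''$ consists of exact functors $I,Q$ of triangulated categories, each having a left and a right adjoint, such that $I$ and the adjoints of $Q$ are fully faithful and the essential image of $I$ equals the kernel of $Q$. Injective recollement theorem: if $\mathcal{M}_i=(\mathcal{W}_i,\mathcal{F}_i)$, $i=1,2,3$, are injective cotorsion pairs in a WIC exact category with enough injectives, $\mathcal{F}_2,\mathcal{F}_3\subseteq\mathcal{F}_1$ and $\mathcal{W}_3\cap\mathcal{F}_1=\mathcal{F}_2$, then there is a recollement $\mathcal{F}_2/\!\sim\to\mathcal{F}_1/\!\sim\to\mathcal{A}/\mathcal{W}_3$ (inclusion $I$ and quotient $Q$) with left and right adjoints of $I$ being $\mathrm{E}(\mathcal{M}_2)$, $\mathrm{C}(\mathcal{M}_3)$ and of $Q$ being $\mathrm{C}(\mathcal{M}_2)\circ\mathrm{E}(\mathcal{M}_1)$, $\mathrm{E}(\mathcal{M}_3)$. Projective recollement theorem: if $\mathcal{M}_i=(\mathcal{C}_i,\mathcal{W}_i)$ are projective cotorsion pairs in a WIC exact category with enough projectives, $\mathcal{C}_2,\mathcal{C}_3\subseteq\mathcal{C}_1$ and $\mathcal{W}_3\cap\mathcal{C}_1=\mathcal{C}_2$, then there is a recollement $\mathcal{C}_2/\!\sim\to\mathcal{C}_1/\!\sim\to\mathcal{A}/\mathcal{W}_3$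 with left and right adjoints of $I$ being $\mathrm{E}(\mathcal{M}_3)$, $\mathrm{C}(\mathcal{M}_2)$ and of $Q$ being $\mathrm{C}(\mathcal{M}_3)$, $\mathrm{E}(\mathcal{M}_2)\circ\mathrm{C}(\mathcal{M}_1)$. *)

(* Defs.v *)
From Stdlib Require Import Setoid Morphisms Relation_Definitions.

Set Implicit Arguments.
Unset Strict Implicit.
Unset Printing Implicit Defensive.

Declare Scope cat_scope.
Delimit Scope cat_scope with cat.
Local Open Scope cat_scope.

(* Categories carry an equivalence relation on each hom-type, playing the role
   of equality of morphisms; quotients of hom-sets (stable categories,
   localizations) are then formed by changing this relation. *)

Record Category := {
  Ob :> Type;
  Hom : Ob -> Ob -> Type;
  heq : forall A B, relation (Hom A B);
  idm : forall A, Hom A A;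
  comp : forall A B C, Hom B C -> Hom A B -> Hom A C;
  heq_equiv : forall A B, Equivalence (@heq A B);
  comp_heq : forall A B C (g g' : Hom B C) (f f' : Hom A B),
      heq g g' -> heq f f' -> heq (comp g f) (comp g' f');
  comp_assoc : forall A B C D (h : Hom C D) (g : Hom B C) (f : Hom A B),
      heq (comp h (comp g f)) (comp (comp h g) f);
  comp_idl : forall A B (f : Hom A B), heq (comp (idm B) f) f;
  comp_idr : forall A B (f : Hom A B), heq (comp f (idm A)) f
}.
Arguments idm {c} A.
Arguments heq {c A B} _ _.

Notation "f ≈ g" := (heq f g) (at level 70, no associativity) : cat_scope.
Notation "g ∘ f" := (comp g f) (at level 40, left associativity) : cat_scope.

#[global] Instance heq_Equivalence (C : Category) (A B : C) :
  Equivalence (@heq C A B) := @heq_equiv C A B.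
#[global] Instance comp_Proper (C : Category) (A B D : C) :
  Proper (@heq C B D ==> @heq C A B ==> @heq C A D) (@comp C A B D).
Proof. intros g g' Hg f f' Hf; now apply comp_heq. Qed.

Section CategoryNotions.
Variable C : Category.

Definition is_iso (A B : C) (f : Hom A B) : Prop :=
  exists g : Hom B A, g ∘ f ≈ idm A /\ f ∘ g ≈ idm B.

Definition isomorphic (A B : C) : Prop := exists f : Hom A B, is_iso f.

Definition iso_closed (P : C -> Prop) : Prop :=
  forall A B : C, isomorphic A B -> P A -> P B.

Definition is_terminal (T : C) : Prop :=
  forall A, exists f : Hom A T, forall g, g ≈ f.

Definition is_initial (T : C) : Prop :=
  forall A, exists f : Hom T A, forall g, g ≈ f.

Definition is_zero (T : C) : Prop := is_initial T /\ is_terminal T.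

Definition is_product (A B P : C) (p : Hom P A) (q : Hom P B) : Prop :=
  forall (T : C) (a : Hom T A) (b : Hom T B),
    exists u : Hom T P, (p ∘ u ≈ a /\ q ∘ u ≈ b) /\
      forall v : Hom T P, p ∘ v ≈ a -> q ∘ v ≈ b -> v ≈ u.

(*    A --i--> B
      |f       |g
      v        v
      A' -j--> B'   *)
Definition is_pushout (A B A' B' : C) (i : Hom A B) (f : Hom A A')
    (g : Hom B B') (j : Hom A' B') : Prop :=
  g ∘ i ≈ j ∘ f /\
  forall (T : C) (b : Hom B T) (a : Hom A' T), b ∘ i ≈ a ∘ f ->
    exists u : Hom B' T, (u ∘ g ≈ b /\ u ∘ j ≈ a) /\
      forall v : Hom B' T, v ∘ g ≈ b -> v ∘ j ≈ a -> v ≈ u.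

(*    B' -q--> C'
      |g       |f
      v        v
      B --p--> C    *)
Definition is_pullback (B C0 B' C' : C) (p : Hom B C0) (f : Hom C' C0)
    (g : Hom B' B) (q : Hom B' C') : Prop :=
  p ∘ g ≈ f ∘ q /\
  forall (T : C) (b : Hom T B) (c : Hom T C'), p ∘ b ≈ f ∘ c ->
    exists u : Hom T B', (g ∘ u ≈ b /\ q ∘ u ≈ c) /\
      forall v : Hom T B', g ∘ v ≈ b -> q ∘ v ≈ c -> v ≈ u.

(* [A] is a direct summand of [B]; in an additive category binary products
   are biproducts. *)
Definition direct_summand (A B : C) : Prop :=
  exists (A' : C) (p : Hom B A) (q : Hom B A'), is_product p q.

Definition retract (A B : C) : Prop :=
  exists (s : Hom A B) (r : Hom B A), r ∘ s ≈ idm A.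

(* In an additive category a hom-group is zero iff it has only one element. *)
Definition hom_zero (A B : C) : Prop := forall f g : Hom A B, f ≈ g.

End CategoryNotions.

Record Functor (C D : Category) := {
  fob :> C -> D;
  fmap : forall A B : C, Hom A B -> Hom (fob A) (fob B);
  fmap_heq : forall (A B : C) (f g : Hom A B), f ≈ g -> fmap f ≈ fmap g;
  fmap_id : forall A : C, fmap (idm A) ≈ idm (fob A);
  fmap_comp : forall (A B E : C) (g : Hom B E) (f : Hom A B),
      fmap (g ∘ f) ≈ fmap g ∘ fmap f
}.
Arguments fmap {C D} _ {A B} _.

Definition fid (C : Category) : Functor C C.
Proof.
  refine (@Build_Functor C C (fun A => A) (fun A B f => f) _ _ _);
    intros; try assumption; reflexivity.
Defined.

Definition fcomp (C D E : Category) (G : Functor D E) (F : Functor C D) :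
  Functor C E.
Proof.
  refine (@Build_Functor C E (fun A => G (F A)) (fun A B f => fmap G (fmap F f)) _ _ _).
  - intros A B f g H; now do 2 apply fmap_heq.
  - intros A; eapply Equivalence_Transitive; [exact (fmap_heq G (fmap_id F A))|apply fmap_id].
  - intros A B K g f; eapply Equivalence_Transitive; [exact (fmap_heq G (fmap_comp F g f))|apply fmap_comp].
Defined.
Notation "G ∘F F" := (fcomp G F) (at level 40, left associativity) : cat_scope.

Definition natural (C D : Category) (F G : Functor C D)
    (t : forall A : C, Hom (F A) (G A)) : Prop :=
  forall (A B : C) (f : Hom A B), t B ∘ fmap F f ≈ fmap G f ∘ t A.

Record NatIso (C D : Category) (F G : Functor C D) := {
  ni_map :> forall A : C, Hom (F A) (G A);
  ni_natural : natural ni_map;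
  ni_iso : forall A : C, is_iso (ni_map A)
}.

Definition nat_isomorphic (C D : Category) (F G : Functor C D) : Prop :=
  inhabited (NatIso F G).

Definition faithful (C D : Category) (F : Functor C D) : Prop :=
  forall (A B : C) (f g : Hom A B), fmap F f ≈ fmap F g -> f ≈ g.

Definition full (C D : Category) (F : Functor C D) : Prop :=
  forall (A B : C) (g : Hom (F A) (F B)), exists f : Hom A B, fmap F f ≈ g.

Definition fully_faithful (C D : Category) (F : Functor C D) : Prop :=
  full F /\ faithful F.

Definition essential_image (C D : Category) (F : Functor C D) (B : D) : Prop :=
  exists A : C, isomorphic (F A) B.

Definition quasi_inverse (C D : Category) (F : Functor C D) (G : Functor D C) : Prop :=
  nat_isomorphic (G ∘F F) (fid C) /\ nat_isomorphic (F ∘F G) (fid D).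

(* [L] is left adjoint to [R]: unit, counit and the triangle identities. *)
Definition adjoint (C D : Category) (L : Functor C D) (R : Functor D C) : Prop :=
  exists (eta : forall A : C, Hom A (R (L A)))
         (eps : forall B : D, Hom (L (R B)) B),
    natural (F := fid C) (G := R ∘F L) eta /\
    natural (F := L ∘F R) (G := fid D) eps /\
    (forall A : C, eps (L A) ∘ fmap L (eta A) ≈ idm (L A)) /\
    (forall B : D, fmap R (eps B) ∘ eta (R B) ≈ idm (R B)).

(* An additive functor between additive categories is the same thing as a
   functor preserving finite products. *)
Definition additive_functor (C D : Category) (F : Functor C D) : Prop :=
  (forall T : C, is_terminal T -> is_terminal (F T)) /\
  (forall (A B P : C) (p : Hom P A) (q : Hom P B),
      is_product p q -> is_product (fmap F p) (fmap F q)).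

Definition fullsub (C : Category) (P : C -> Prop) : Category.
Proof.
  refine (@Build_Category {A : C | P A}
            (fun A B => Hom (proj1_sig A) (proj1_sig B))
            (fun A B f g => f ≈ g)
            (fun A => idm (proj1_sig A))
            (fun A B D g f => g ∘ f) _ _ _ _ _).
  - intros A B D g g' f f'; apply comp_heq.
  - intros A B D F h g f; apply comp_assoc.
  - intros A B f; apply comp_idl.
  - intros A B f; apply comp_idr.
Defined.

Definition incl (C : Category) (P : C -> Prop) : Functor (fullsub P) C.
Proof.
  refine (@Build_Functor (fullsub P) C (fun A => proj1_sig A) (fun A B f => f) _ _ _);
    intros; try assumption; reflexivity.
Defined.

Definition corestrict (C D : Category) (P : D -> Prop) (F : Functor C D)
    (hF : forall A : C, P (F A)) : Functor C (fullsub P).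
Proof.
  refine (@Build_Functor C (fullsub P) (fun A => exist _ (F A) (hF A))
            (fun A B f => fmap F f) _ _ _); intros; cbn.
  - now apply fmap_heq.
  - apply fmap_id.
  - apply fmap_comp.
Defined.

(* ------------------------------------------------------------------ *)
(* Triangulated categories.  The notions below only involve the shift and the
   class of distinguished triangles, so this is all that is recorded; they are
   applied to the stable category of a Frobenius category, its thick
   subcategories and the localizations A/Y, where these data are the classical
   ones and the axioms TR1-TR4 are theorems. *)

Record TriCat := {
  tcat :> Category;
  shift : Functor tcat tcat;
  triangle : forall A B C : tcat, Hom A B -> Hom B C -> Hom C (shift A) -> Prop
}.

Section TriangulatedNotions.
Variable T : TriCat.

Record torsion_pair (X Y : T -> Prop) : Prop := {
  tp_iso_l : iso_closed X;
  tp_iso_r : iso_closed Y;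
  tp_hom : forall A B, X A -> Y B -> hom_zero A B;
  tp_shift_l : forall A, X A -> X (shift T A);
  (* the shift being an autoequivalence and [Y] closed under isomorphisms,
     this says that [Y] is closed under the inverse shift *)
  tp_shift_r : forall A, Y (shift T A) -> Y A;
  tp_triangle : forall A : T, exists (U V : T) (f : Hom U A) (g : Hom A V)
      (h : Hom V (shift T U)), X U /\ Y V /\ triangle f g h
}.

Record thick (X : T -> Prop) : Prop := {
  thick_iso : iso_closed X;
  thick_zero : forall A, is_zero A -> X A;
  thick_shift : forall A, X A -> X (shift T A);
  thick_unshift : forall A, X (shift T A) -> X A;
  thick_cone : forall (A B C : T) (f : Hom A B) (g : Hom B C) (h : Hom C (shift T A)),
      triangle f g h -> X A -> X B -> X C;
  thick_summand : forall A B, direct_summand A B -> X B -> X A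
}.

Record torsion_triple (X Y Z : T -> Prop) : Prop := {
  tt_thick_l : thick X;
  tt_thick_m : thick Y;
  tt_thick_r : thick Z;
  tt_left : torsion_pair X Y;
  tt_right : torsion_pair Y Z
}.

Definition sub_tri (P : T -> Prop) (hP : thick P) : TriCat :=
  {| tcat := fullsub P;
     shift := corestrict (P := P) (F := shift T ∘F incl P)
                (fun A => thick_shift hP (proj2_sig A));
     triangle := fun A B C f g h => triangle (t := T) f g h |}.

End TriangulatedNotions.

Definition exact_functor (T T' : TriCat) (F : Functor T T') : Prop :=
  additive_functor F /\
  exists phi : NatIso (F ∘F shift T) (shift T' ∘F F),
    forall (A B C : T) (f : Hom A B) (g : Hom B C) (h : Hom C (shift T A)),
      triangle f g h ->
      triangle (t := T') (fmap F f) (fmap F g) (phi A ∘ fmap F h).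

Definition triangulated_equivalence (T T' : TriCat)
    (F : Functor T T') (G : Functor T' T) : Prop :=
  exact_functor F /\ exact_functor G /\ quasi_inverse F G.

Definition triangle_equivalent (T T' : TriCat) : Prop :=
  exists (F : Functor T T') (G : Functor T' T), triangulated_equivalence F G.

(* The four adjoints in a recollement diagram: left and right adjoints
   [inc_l], [inc_r] of [I : T' -> T] and [quo_l], [quo_r] of [Q : T -> T'']. *)
Record Adjoints (T' T T'' : Category) := {
  inc_l : Functor T T';
  inc_r : Functor T T';
  quo_l : Functor T'' T;
  quo_r : Functor T'' T
}.

Record recollement (T' T T'' : TriCat) (I : Functor T' T) (Q : Functor T T'')
    (d : Adjoints T' T T'') : Prop := {
  rec_exact_inc : exact_functor I;
  rec_exact_quo : exact_functor Q;
  rec_inc_l : adjoint (inc_l d) I;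
  rec_inc_r : adjoint I (inc_r d);
  rec_quo_l : adjoint (quo_l d) Q;
  rec_quo_r : adjoint Q (quo_r d);
  rec_ff_inc : fully_faithful I;
  rec_ff_l : fully_faithful (quo_l d);
  rec_ff_r : fully_faithful (quo_r d);
  rec_kernel : forall A : T, essential_image I A <-> is_zero (Q A)
}.

Definition same_adjoints (T' T T'' : Category) (d d' : Adjoints T' T T'') : Prop :=
  nat_isomorphic (inc_l d) (inc_l d') /\ nat_isomorphic (inc_r d) (inc_r d') /\
  nat_isomorphic (quo_l d) (quo_l d') /\ nat_isomorphic (quo_r d) (quo_r d').

(* ------------------------------------------------------------------ *)

Record AdditiveCategory := {
  acat :> Category;
  hzero : forall A B : acat, Hom A B;
  hadd : forall A B : acat, Hom A B -> Hom A B -> Hom A B;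
  hopp : forall A B : acat, Hom A B -> Hom A B;
  hadd_heq : forall (A B : acat) (f f' g g' : Hom A B),
      f ≈ f' -> g ≈ g' -> hadd f g ≈ hadd f' g';
  hopp_heq : forall (A B : acat) (f f' : Hom A B), f ≈ f' -> hopp f ≈ hopp f';
  hadd_assoc : forall (A B : acat) (f g h : Hom A B),
      hadd f (hadd g h) ≈ hadd (hadd f g) h;
  hadd_comm : forall (A B : acat) (f g : Hom A B), hadd f g ≈ hadd g f;
  hadd_zero : forall (A B : acat) (f : Hom A B), hadd f (hzero A B) ≈ f;
  hadd_opp : forall (A B : acat) (f : Hom A B), hadd f (hopp f) ≈ hzero A B;
  comp_hadd_l : forall (A B C : acat) (g g' : Hom B C) (f : Hom A B),
      hadd g g' ∘ f ≈ hadd (g ∘ f) (g' ∘ f);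
  comp_hadd_r : forall (A B C : acat) (g : Hom B C) (f f' : Hom A B),
      g ∘ hadd f f' ≈ hadd (g ∘ f) (g ∘ f');
  zero_exists : exists O : acat, is_zero O;
  biproduct_exists : forall A B : acat,
      exists (S : acat) (i : Hom A S) (j : Hom B S) (p : Hom S A) (q : Hom S B),
        p ∘ i ≈ idm A /\ q ∘ j ≈ idm B /\ p ∘ j ≈ hzero B A /\
        q ∘ i ≈ hzero A B /\ hadd (i ∘ p) (j ∘ q) ≈ idm S
}.
Arguments hzero {a} A B.

Notation "f + g" := (hadd f g) : cat_scope.
Notation "- f" := (hopp f) : cat_scope.
Notation "f - g" := (hadd f (hopp g)) : cat_scope.

#[global] Instance hadd_Proper (C : AdditiveCategory) (A B : C) :
  Proper (@heq C A B ==> @heq C A B ==> @heq C A B) (@hadd C A B).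
Proof. intros f f' H g g' H'; now apply hadd_heq. Qed.
#[global] Instance hopp_Proper (C : AdditiveCategory) (A B : C) :
  Proper (@heq C A B ==> @heq C A B) (@hopp C A B).
Proof. intros f f' H; now apply hopp_heq. Qed.

Section AdditiveNotions.
Variable C : AdditiveCategory.

Definition is_kernel (A B D : C) (k : Hom A B) (f : Hom B D) : Prop :=
  f ∘ k ≈ hzero A D /\
  forall (T : C) (t : Hom T B), f ∘ t ≈ hzero T D ->
    exists u : Hom T A, k ∘ u ≈ t /\ forall v : Hom T A, k ∘ v ≈ t -> v ≈ u.

Definition is_cokernel (A B D : C) (f : Hom A B) (c : Hom B D) : Prop :=
  c ∘ f ≈ hzero A D /\
  forall (T : C) (t : Hom B T), t ∘ f ≈ hzero A T ->
    exists u : Hom D T, u ∘ c ≈ t /\ forall v : Hom D T, v ∘ c ≈ t -> v ≈ u.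

Definition weakly_idempotent_complete : Prop :=
  forall (A B : C) (s : Hom A B), (exists r : Hom B A, r ∘ s ≈ idm A) ->
    exists (D : C) (c : Hom B D), is_cokernel s c.

End AdditiveNotions.

Definition short_sequences (C : Category) : Type :=
  forall A B D : C, Hom A B -> Hom B D -> Prop.

Definition adm_mono (C : Category) (E : short_sequences C) (A B : C) (i : Hom A B) : Prop :=
  exists (D : C) (p : Hom B D), E A B D i p.
Definition adm_epi (C : Category) (E : short_sequences C) (B D : C) (p : Hom B D) : Prop :=
  exists (A : C) (i : Hom A B), E A B D i p.

(* Quillen's axioms, in Keller's and Buehler's minimal form. *)
Record ExactCategory := {
  ecat :> AdditiveCategory;
  ses : short_sequences ecat;
  ses_heq : forall (A B C : ecat) (i i' : Hom A B) (p p' : Hom B C),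
      i ≈ i' -> p ≈ p' -> ses i p -> ses i' p';
  ses_kernel : forall (A B C : ecat) (i : Hom A B) (p : Hom B C), ses i p -> is_kernel i p;
  ses_cokernel : forall (A B C : ecat) (i : Hom A B) (p : Hom B C), ses i p -> is_cokernel i p;
  ses_iso : forall (A B C A' B' C' : ecat) (i : Hom A B) (p : Hom B C)
      (i' : Hom A' B') (p' : Hom B' C') (a : Hom A A') (b : Hom B B') (c : Hom C C'),
      is_iso a -> is_iso b -> is_iso c -> b ∘ i ≈ i' ∘ a -> c ∘ p ≈ p' ∘ b ->
      ses i p -> ses i' p';
  id_adm_mono : forall A : ecat, adm_mono ses (idm A);
  id_adm_epi : forall A : ecat, adm_epi ses (idm A);
  comp_adm_mono : forall (A B C : ecat) (i : Hom A B) (j : Hom B C),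
      adm_mono ses i -> adm_mono ses j -> adm_mono ses (j ∘ i);
  comp_adm_epi : forall (A B C : ecat) (p : Hom A B) (q : Hom B C),
      adm_epi ses p -> adm_epi ses q -> adm_epi ses (q ∘ p);
  pushout_adm_mono : forall (A B A' : ecat) (i : Hom A B) (f : Hom A A'),
      adm_mono ses i -> exists (B' : ecat) (g : Hom B B') (j : Hom A' B'),
        is_pushout i f g j /\ adm_mono ses j;
  pullback_adm_epi : forall (B C C' : ecat) (p : Hom B C) (f : Hom C' C),
      adm_epi ses p -> exists (B' : ecat) (g : Hom B' B) (q : Hom B' C'),
        is_pullback p f g q /\ adm_epi ses q
}.

Section ExactNotions.
Variable E : ExactCategory.

Definition projective (P : E) : Prop :=
  forall (B C : E) (p : Hom B C), adm_epi (@ses E) p ->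
    forall f : Hom P C, exists g : Hom P B, p ∘ g ≈ f.

Definition injective (J : E) : Prop :=
  forall (A B : E) (i : Hom A B), adm_mono (@ses E) i ->
    forall f : Hom A J, exists g : Hom B J, g ∘ i ≈ f.

Definition enough_projectives : Prop :=
  forall A : E, exists (P : E) (p : Hom P A), projective P /\ adm_epi (@ses E) p.

Definition enough_injectives : Prop :=
  forall A : E, exists (J : E) (i : Hom A J), injective J /\ adm_mono (@ses E) i.

Definition frobenius : Prop :=
  enough_projectives /\ enough_injectives /\ forall P : E, projective P <-> injective P.

Definition projinj (P : E) : Prop := projective P /\ injective P.

(* Ext^1(A, V) = 0: every extension of [A] by [V] is split. *)
Definition Ext1_zero (A V : E) : Prop :=
  forall (B : E) (i : Hom V B) (p : Hom B A), ses i p ->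
    exists s : Hom A B, p ∘ s ≈ idm A.

Definition cotorsion_pair (U V : E -> Prop) : Prop :=
  (forall A, U A <-> forall B, V B -> Ext1_zero A B) /\
  (forall B, V B <-> forall A, U A -> Ext1_zero A B).

Definition complete_cotorsion_pair (U V : E -> Prop) : Prop :=
  cotorsion_pair U V /\
  forall A : E,
    (exists (B C : E) (i : Hom B C) (p : Hom C A), ses i p /\ V B /\ U C) /\
    (exists (B C : E) (i : Hom A B) (p : Hom B C), ses i p /\ V B /\ U C).

Definition thick_class (P : E -> Prop) : Prop :=
  (forall A B : E, retract A B -> P B -> P A) /\
  (forall (A B C : E) (i : Hom A B) (p : Hom B C), ses i p ->
     (P A -> P B -> P C) /\ (P A -> P C -> P B) /\ (P B -> P C -> P A)).

Definition injective_cotorsion_pair (U V : E -> Prop) : Prop :=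
  complete_cotorsion_pair U V /\ thick_class U /\
  forall A, (U A /\ V A) <-> injective A.

Definition projective_cotorsion_pair (U V : E -> Prop) : Prop :=
  complete_cotorsion_pair U V /\ thick_class V /\
  forall A, (U A /\ V A) <-> projective A.

Definition localizing_cotorsion_pair (U V : E -> Prop) : Prop :=
  complete_cotorsion_pair U V /\ thick_class U.

Definition localizing_cotorsion_triple (X Y Z : E -> Prop) : Prop :=
  localizing_cotorsion_pair X Y /\ localizing_cotorsion_pair Y Z.

(* Hypotheses of the injective recollement theorem for the pairs (W_i, F_i). *)
Definition injective_recollement_hypotheses (W1 F1 W2 F2 W3 F3 : E -> Prop) : Prop :=
  injective_cotorsion_pair W1 F1 /\ injective_cotorsion_pair W2 F2 /\
  injective_cotorsion_pair W3 F3 /\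
  (forall A, F2 A -> F1 A) /\ (forall A, F3 A -> F1 A) /\
  (forall A, (W3 A /\ F1 A) <-> F2 A).

(* Hypotheses of the projective recollement theorem for the pairs (C_i, W_i). *)
Definition projective_recollement_hypotheses (C1 W1 C2 W2 C3 W3 : E -> Prop) : Prop :=
  projective_cotorsion_pair C1 W1 /\ projective_cotorsion_pair C2 W2 /\
  projective_cotorsion_pair C3 W3 /\
  (forall A, C2 A -> C1 A) /\ (forall A, C3 A -> C1 A) /\
  (forall A, (W3 A /\ C1 A) <-> C2 A).

Definition stable_eq (A B : E) (f g : Hom A B) : Prop :=
  exists (P : E) (h : Hom A P) (k : Hom P B), projinj P /\ g - f ≈ k ∘ h.

End ExactNotions.

(* ------------------------------------------------------------------ *)
Section AdditiveLemmas.
Variable C : AdditiveCategory.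
Implicit Types A B D : C.

Lemma hadd_cancel_r A B (f g h : Hom A B) : f + h ≈ g + h -> f ≈ g.
Proof.
  intro H.
  rewrite <- (hadd_zero f), <- (hadd_zero g), <- (hadd_opp h), !hadd_assoc, H.
  reflexivity.
Qed.

Lemma zero_hadd A B (f : Hom A B) : hzero A B + f ≈ f.
Proof. rewrite hadd_comm; apply hadd_zero. Qed.

Lemma comp_zero_r A B D (g : Hom B D) : g ∘ hzero A B ≈ hzero A D.
Proof.
  apply hadd_cancel_r with (h := g ∘ hzero A B).
  rewrite <- comp_hadd_r, hadd_zero, zero_hadd; reflexivity.
Qed.

Lemma comp_zero_l A B D (f : Hom A B) : hzero B D ∘ f ≈ hzero A D.
Proof.
  apply hadd_cancel_r with (h := hzero B D ∘ f).
  rewrite <- comp_hadd_l, hadd_zero, zero_hadd; reflexivity.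
Qed.

Lemma hopp_unique A B (f g : Hom A B) : f + g ≈ hzero A B -> g ≈ - f.
Proof.
  intro H; apply hadd_cancel_r with (h := f).
  rewrite hadd_comm, H, hadd_comm, hadd_opp; reflexivity.
Qed.

Lemma comp_opp_r A B D (g : Hom B D) (f : Hom A B) : g ∘ (- f) ≈ - (g ∘ f).
Proof. apply hopp_unique; rewrite <- comp_hadd_r, hadd_opp; apply comp_zero_r. Qed.

Lemma comp_opp_l A B D (g : Hom B D) (f : Hom A B) : (- g) ∘ f ≈ - (g ∘ f).
Proof. apply hopp_unique; rewrite <- comp_hadd_l, hadd_opp; apply comp_zero_l. Qed.

Lemma hopp_sub A B (f g : Hom A B) : - (g - f) ≈ f - g.
Proof.
  symmetry; apply hopp_unique.
  rewrite <- hadd_assoc, (hadd_assoc (- f)), (hadd_comm (- f) f), hadd_opp, zero_hadd.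
  apply hadd_opp.
Qed.

Lemma sub_add_sub A B (f g h : Hom A B) : (h - g) + (g - f) ≈ h - f.
Proof.
  rewrite <- hadd_assoc, (hadd_assoc (- g)), (hadd_comm (- g) g), hadd_opp, zero_hadd.
  reflexivity.
Qed.

Lemma sub_add A B (f g : Hom A B) : f + (g - f) ≈ g.
Proof.
  rewrite (hadd_comm g), hadd_assoc, hadd_opp, zero_hadd; reflexivity.
Qed.

Lemma sub_zero_eq A B (f g : Hom A B) : g - f ≈ hzero A B -> f ≈ g.
Proof. intro H; rewrite <- (sub_add f g), H, hadd_zero; reflexivity. Qed.

Lemma sub_self A B (f g : Hom A B) : f ≈ g -> g - f ≈ hzero A B.
Proof. intro H; rewrite H; apply hadd_opp. Qed.

Lemma hopp_zero A B : - hzero A B ≈ hzero A B.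
Proof. symmetry; apply hopp_unique, hadd_zero. Qed.

End AdditiveLemmas.

Section Stable.
Variable E : ExactCategory.
Implicit Types A B D : E.

Lemma biproduct_projinj A B (S : E) (i : Hom A S) (j : Hom B S) (p : Hom S A) (q : Hom S B) :
  p ∘ i ≈ idm A -> q ∘ j ≈ idm B -> p ∘ j ≈ hzero B A -> q ∘ i ≈ hzero A B ->
  i ∘ p + j ∘ q ≈ idm S ->
  projinj A -> projinj B -> projinj S.
Proof.
  intros pi qj pj qi sum [PA IA] [PB IB]; split.
  - intros M N e He f.
    destruct (PA _ _ e He (f ∘ i)) as [a Ha].
    destruct (PB _ _ e He (f ∘ j)) as [b Hb].
    exists (a ∘ p + b ∘ q).
    rewrite comp_hadd_r, !comp_assoc, Ha, Hb, <- !comp_assoc, <- comp_hadd_r, sum.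
    apply comp_idr.
  - intros M N e He f.
    destruct (IA _ _ e He (p ∘ f)) as [a Ha].
    destruct (IB _ _ e He (q ∘ f)) as [b Hb].
    exists (i ∘ a + j ∘ b).
    rewrite comp_hadd_l, <- !comp_assoc, Ha, Hb, !comp_assoc, <- comp_hadd_l, sum.
    apply comp_idl.
Qed.

Lemma zero_projinj (O : E) : is_zero O -> projinj O.
Proof.
  intros [H1 H2]; split.
  - intros M N e He f; destruct (H1 N) as [u Hu].
    exists (hzero O M); rewrite (Hu (e ∘ _)), (Hu f); reflexivity.
  - intros M N e He f; destruct (H2 M) as [u Hu].
    exists (hzero N O); rewrite (Hu (_ ∘ e)), (Hu f); reflexivity.
Qed.

Lemma heq_stable A B (f g : Hom A B) : f ≈ g -> stable_eq f g.
Proof.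
  intro H; destruct (zero_exists E) as [O HO].
  exists O, (hzero A O), (hzero O B); split; [now apply zero_projinj|].
  rewrite (sub_self H); symmetry; apply comp_zero_r.
Qed.

Lemma stable_equivalence A B : Equivalence (@stable_eq E A B).
Proof.
  split.
  - intro f; apply heq_stable; reflexivity.
  - intros f g (P & h & k & HP & H); exists P, h, (- k); split; [exact HP|].
    rewrite comp_opp_l, <- H; symmetry; apply hopp_sub.
  - intros f g l (P & h & k & HP & H) (P' & h' & k' & HP' & H').
    destruct (biproduct_exists P P') as (S & i & j & p & q & pi & qj & pj & qi & sum).
    exists S, (i ∘ h + j ∘ h'), (k ∘ p + k' ∘ q); split.
    + exact (biproduct_projinj pi qj pj qi sum HP HP').
    + rewrite <- (sub_add_sub f g l), H, H', comp_hadd_l, !comp_hadd_r.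
      rewrite <- !comp_assoc, (comp_assoc p i), (comp_assoc p j),
        (comp_assoc q i), (comp_assoc q j), pi, pj, qi, qj.
      rewrite !comp_zero_l, !comp_zero_r, !comp_idl, zero_hadd, hadd_zero.
      apply hadd_comm.
Qed.

Lemma stable_comp A B D (g g' : Hom B D) (f f' : Hom A B) :
  stable_eq g g' -> stable_eq f f' -> stable_eq (g ∘ f) (g' ∘ f').
Proof.
  intros (P & h & k & HP & H) (P' & h' & k' & HP' & H').
  apply (@Equivalence_Transitive _ _ (stable_equivalence A D)) with (y := g ∘ f').
  - exists P', h', (g ∘ k'); split; [exact HP'|].
    rewrite <- comp_assoc, <- H', comp_hadd_r, comp_opp_r; reflexivity.
  - exists P, (h ∘ f'), k; split; [exact HP|].
    rewrite comp_assoc, <- H, comp_hadd_l, comp_opp_l; reflexivity.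
Qed.

Definition stable : Category.
Proof.
  refine (@Build_Category E (fun A B => Hom A B) (@stable_eq E)
            (fun A => idm A) (fun A B D g f => g ∘ f) _ _ _ _ _).
  - exact stable_equivalence.
  - exact stable_comp.
  - intros; apply heq_stable, comp_assoc.
  - intros; apply heq_stable, comp_idl.
  - intros; apply heq_stable, comp_idr.
Defined.

Lemma projinj_stable_zero (P : E) : projinj P -> @is_zero stable P.
Proof.
  intro HP; split; intro A.
  - exists (hzero P A); intro g; exists P, (idm P), (hzero P A - g); split; [exact HP|].
    symmetry; apply comp_idr.
  - exists (hzero A P); intro g; exists P, (hzero A P - g), (idm P); split; [exact HP|].
    symmetry; apply comp_idl.
Qed.

(* A choice of suspensions: for each [A] a short exact sequence
   A >-> sus_env A ->> sus A with projective-injective middle term, and for each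
   f : A -> B a morphism of the chosen sequences extending [f].  Such a choice
   exists in every Frobenius category, and any two give isomorphic shifts. *)
Record suspension := {
  sus_env : E -> E;
  sus : E -> E;
  sus_i : forall A, Hom A (sus_env A);
  sus_p : forall A, Hom (sus_env A) (sus A);
  sus_ses : forall A, ses (sus_i A) (sus_p A);
  sus_projinj : forall A, projinj (sus_env A);
  sus_env_map : forall A B, Hom A B -> Hom (sus_env A) (sus_env B);
  sus_map : forall A B, Hom A B -> Hom (sus A) (sus B);
  sus_comm_i : forall A B (f : Hom A B), sus_env_map f ∘ sus_i A ≈ sus_i B ∘ f;
  sus_comm_p : forall A B (f : Hom A B), sus_map f ∘ sus_p A ≈ sus_p B ∘ sus_env_map f
}.

Variable S : suspension.

Lemma sus_unique A B (f f' : Hom A B) (w w' : Hom (sus_env S A) (sus_env S B))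
    (s s' : Hom (sus S A) (sus S B)) :
  stable_eq f f' ->
  w ∘ sus_i S A ≈ sus_i S B ∘ f -> s ∘ sus_p S A ≈ sus_p S B ∘ w ->
  w' ∘ sus_i S A ≈ sus_i S B ∘ f' -> s' ∘ sus_p S A ≈ sus_p S B ∘ w' ->
  stable_eq s s'.
Proof.
  intros (P & h & k & [_ IP] & H) Hi Hp Hi' Hp'.
  pose proof (sus_ses S A) as SA; pose proof (sus_ses S B) as SB.
  destruct (IP _ _ (sus_i S A) (ex_intro _ _ (ex_intro _ _ SA)) h) as [h' Hh'].
  destruct (ses_cokernel SA) as [_ UA].
  destruct (ses_cokernel SB) as [ZB _].
  destruct (UA _ ((w' - w) - sus_i S B ∘ k ∘ h')) as [t [Ht _]].
  { rewrite !comp_hadd_l, !comp_opp_l, Hi, Hi', <- !comp_assoc, Hh', <- H.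
    rewrite comp_hadd_r, comp_opp_r; apply hadd_opp. }
  exists (sus_env S B), t, (sus_p S B); split; [apply sus_projinj|].
  assert (epi : forall (u v : Hom (sus S A) (sus S B)),
             u ∘ sus_p S A ≈ v ∘ sus_p S A -> u ≈ v).
  { intros u v Huv.
    destruct (ses_cokernel SA) as [ZA UA'].
    destruct (UA' _ (v ∘ sus_p S A)) as [x [_ Hx]].
    { rewrite <- comp_assoc, ZA; apply comp_zero_r. }
    rewrite (Hx u Huv), (Hx v); reflexivity. }
  apply epi.
  rewrite <- comp_assoc, Ht, comp_hadd_l, comp_opp_l, Hp, Hp'.
  rewrite !comp_hadd_r, !comp_opp_r, !comp_assoc, ZB, !comp_zero_l.
  rewrite hopp_zero, hadd_zero; reflexivity.
Qed.

Lemma sus_map_id A : stable_eq (sus_map S (idm A)) (idm (sus S A)).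
Proof.
  apply (sus_unique (heq_stable (reflexivity (idm A)))
           (sus_comm_i S (idm A)) (sus_comm_p S (idm A)) (w' := idm _));
    rewrite comp_idl, comp_idr; reflexivity.
Qed.

Lemma sus_map_comp A B D (g : Hom B D) (f : Hom A B) :
  stable_eq (sus_map S (g ∘ f)) (sus_map S g ∘ sus_map S f).
Proof.
  apply (sus_unique (heq_stable (reflexivity (g ∘ f)))
           (sus_comm_i S (g ∘ f)) (sus_comm_p S (g ∘ f))
           (w' := sus_env_map S g ∘ sus_env_map S f)).
  - rewrite <- comp_assoc, sus_comm_i, comp_assoc, sus_comm_i, comp_assoc; reflexivity.
  - rewrite <- comp_assoc, sus_comm_p, comp_assoc, sus_comm_p, comp_assoc; reflexivity.
Qed.

Definition stable_shift : Functor stable stable.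
Proof.
  refine (@Build_Functor stable stable (sus S) (fun A B f => sus_map S f) _ _ _).
  - intros A B f g H.
    apply (sus_unique H (sus_comm_i S f) (sus_comm_p S f) (sus_comm_i S g) (sus_comm_p S g)).
  - exact sus_map_id.
  - exact sus_map_comp.
Defined.

(* Happel's standard triangle A --f--> B --g--> D --h--> sus A: [D] is the
   pushout of A >-> sus_env A along [f], and [h] is induced by
   sus_env A ->> sus A and 0 : B -> sus A. *)
Definition standard_triangle (A B D : E) (f : Hom A B) (g : Hom B D)
    (h : Hom D (sus S A)) : Prop :=
  exists w : Hom (sus_env S A) D,
    is_pushout (sus_i S A) f w g /\ h ∘ w ≈ sus_p S A /\ h ∘ g ≈ hzero B (sus S A).

Definition stable_triangle (A B D : stable) (f : Hom A B) (g : Hom B D)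
    (h : Hom D (stable_shift A)) : Prop :=
  exists (A' B' D' : E) (f' : Hom A' B') (g' : Hom B' D') (h' : Hom D' (sus S A'))
         (a : @Hom stable A A') (b : @Hom stable B B') (d : @Hom stable D D'),
    standard_triangle f' g' h' /\ is_iso a /\ is_iso b /\ is_iso d /\
    @heq stable _ _ (b ∘ f) (comp (c := stable) f' a) /\
    @heq stable _ _ (d ∘ g) (comp (c := stable) g' b) /\
    @heq stable _ _ (fmap stable_shift a ∘ h) (comp (c := stable) h' d).

Definition stable_tri : TriCat :=
  {| tcat := stable; shift := stable_shift; triangle := stable_triangle |}.

End Stable.

(* ------------------------------------------------------------------ *)
(* The localization A/Y (Gabriel-Zisman): same objects, and morphisms the formal
   composites of morphisms of [E] and formal inverses of morphisms in [weq Y],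
   modulo the congruence generated by functoriality of [loc_map] and
   invertibility. *)
Section Localization.
Variables (E : ExactCategory) (Y : E -> Prop).
Implicit Types A B D : E.

Definition weq A B (f : Hom A B) : Prop :=
  exists (M K L : E) (i : Hom A M) (c : Hom M K) (k : Hom L M) (p : Hom M B),
    ses i c /\ Y K /\ ses k p /\ Y L /\ f ≈ p ∘ i.

Inductive loc_hom : E -> E -> Type :=
| loc_map A B (f : Hom A B) : loc_hom A B
| loc_inv A B (f : Hom A B) (w : weq f) : loc_hom B A
| loc_comp A B D (g : loc_hom B D) (f : loc_hom A B) : loc_hom A D.

Inductive loc_eq : forall A B, loc_hom A B -> loc_hom A B -> Prop :=
| le_refl A B (f : loc_hom A B) : loc_eq f f
| le_sym A B (f g : loc_hom A B) : loc_eq f g -> loc_eq g f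
| le_trans A B (f g h : loc_hom A B) : loc_eq f g -> loc_eq g h -> loc_eq f h
| le_cong A B D (g g' : loc_hom B D) (f f' : loc_hom A B) :
    loc_eq g g' -> loc_eq f f' -> loc_eq (loc_comp g f) (loc_comp g' f')
| le_assoc A B D F (h : loc_hom D F) (g : loc_hom B D) (f : loc_hom A B) :
    loc_eq (loc_comp h (loc_comp g f)) (loc_comp (loc_comp h g) f)
| le_idl A B (f : loc_hom A B) : loc_eq (loc_comp (loc_map (idm B)) f) f
| le_idr A B (f : loc_hom A B) : loc_eq (loc_comp f (loc_map (idm A))) f
| le_map A B (f g : Hom A B) : f ≈ g -> loc_eq (loc_map f) (loc_map g)
| le_map_comp A B D (g : Hom B D) (f : Hom A B) :
    loc_eq (loc_map (g ∘ f)) (loc_comp (loc_map g) (loc_map f))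
| le_inv_l A B (f : Hom A B) (w : weq f) :
    loc_eq (loc_comp (loc_inv w) (loc_map f)) (loc_map (idm A))
| le_inv_r A B (f : Hom A B) (w : weq f) :
    loc_eq (loc_comp (loc_map f) (loc_inv w)) (loc_map (idm B)).

Definition loc : Category.
Proof.
  refine (@Build_Category E loc_hom loc_eq (fun A => loc_map (idm A)) loc_comp _ _ _ _ _).
  - intros A B; split; [exact (@le_refl A B)|exact (@le_sym A B)|exact (@le_trans A B)].
  - exact le_cong.
  - exact le_assoc.
  - exact le_idl.
  - exact le_idr.
Defined.

Definition gamma : Functor E loc.
Proof.
  refine (@Build_Functor E loc (fun A => A) loc_map _ _ _); intros.
  - now apply le_map.
  - reflexivity.
  - apply le_map_comp.
Defined.

Lemma weq_gamma_iso A B (f : Hom A B) : weq f -> is_iso (fmap gamma f).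
Proof. intro w; exists (loc_inv w); split; [apply le_inv_l|apply le_inv_r]. Qed.

Lemma ses_id_zero A : exists (O : E) (c : Hom A O), is_zero O /\ ses (idm A) c.
Proof.
  destruct (id_adm_mono A) as (D & c & H); exists D, c; split; [|exact H].
  destruct (ses_cokernel H) as [Hz HU].
  assert (Hid : idm D ≈ hzero D D).
  { destruct (HU D c Hz) as [u [_ Hu]].
    rewrite (Hu (idm D) (comp_idl c)), (Hu (hzero D D)); [reflexivity|].
    rewrite comp_zero_l, <- (comp_idr c), Hz; reflexivity. }
  split; intro B.
  - exists (hzero D B); intro g; rewrite <- (comp_idr g), Hid; apply comp_zero_r.
  - exists (hzero B D); intro g; rewrite <- (comp_idl g), Hid; apply comp_zero_l.
Qed.

(* A biproduct diagram gives a short exact sequence B >-> A + B ->> A. *)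
Lemma ses_biproduct A B (S : E) (i : Hom A S) (j : Hom B S) (p : Hom S A) (q : Hom S B) :
  p ∘ i ≈ idm A -> q ∘ j ≈ idm B -> p ∘ j ≈ hzero B A -> q ∘ i ≈ hzero A B ->
  i ∘ p + j ∘ q ≈ idm S -> ses j p.
Proof.
  intros pi qj pj qi sum.
  assert (Hdec : forall T (u : Hom T S), u ≈ i ∘ (p ∘ u) + j ∘ (q ∘ u)).
  { intros T u; rewrite !comp_assoc, <- comp_hadd_l, sum, comp_idl; reflexivity. }
  assert (HO : exists (O : E) (z : Hom O A), is_zero O /\ adm_mono (@ses E) z).
  { destruct (id_adm_epi A) as (O & z & H); exists O, z; split; [|exists A, (idm A); exact H].
    destruct (ses_kernel H) as [Hz HU].
    assert (Hid : idm O ≈ hzero O O).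
    { destruct (HU O z Hz) as [u [_ Hu]].
      rewrite (Hu (idm O) (comp_idr z)), (Hu (hzero O O)); [reflexivity|].
      rewrite comp_zero_r, <- (comp_idl z), Hz; reflexivity. }
    split; intro D.
    - exists (hzero O D); intro g; rewrite <- (comp_idr g), Hid; apply comp_zero_r.
    - exists (hzero D O); intro g; rewrite <- (comp_idl g), Hid; apply comp_zero_l. }
  destruct HO as (O & z & HO & Hz).
  destruct (pushout_adm_mono (hzero O B) Hz) as (B' & g & j' & [Hc HU] & (D & c & Hs)).
  destruct (HU S i j) as [u [[ug uj] _]].
  { destruct HO as [HO _]; destruct (HO S) as [t Ht].
    rewrite (Ht (i ∘ z)), (Ht (j ∘ _)); reflexivity. }
  assert (gz : forall T (a b : Hom O T), a ≈ b).
  { intros T a b; destruct HO as [HO _]; destruct (HO T) as [t Ht].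
    rewrite (Ht a), (Ht b); reflexivity. }
  assert (Hu : is_iso u).
  { exists (g ∘ p + j' ∘ q); split.
    - destruct (HU B' g j') as [x [_ Hx]]; [apply gz|].
      rewrite (Hx (idm B')); [| apply comp_idl | apply comp_idl].
      apply Hx.
      + rewrite <- comp_assoc, ug, comp_hadd_l, <- !comp_assoc, pi, qi.
        rewrite comp_zero_r, comp_idr, hadd_zero; reflexivity.
      + rewrite <- comp_assoc, uj, comp_hadd_l, <- !comp_assoc, pj, qj.
        rewrite comp_zero_r, comp_idr, zero_hadd; reflexivity.
    - rewrite comp_hadd_r, !comp_assoc, ug, uj; exact sum. }
  destruct (ses_cokernel Hs) as [cj HC].
  destruct (HC A (p ∘ u)) as [v [Hv _]].
  { rewrite <- comp_assoc, uj; exact pj. }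
  assert (Hviso : is_iso v).
  { exists (c ∘ g); split.
    - destruct (HC D c cj) as [x [_ Hx]].
      rewrite (Hx (idm D) (comp_idl c)); apply Hx.
      destruct Hu as [u' [u'u uu']].
      assert (Hg : g ∘ (p ∘ u) + j' ∘ (q ∘ u) ≈ idm B').
      { rewrite <- (comp_idl (_ + _)), <- u'u, <- comp_assoc, comp_hadd_r, !comp_assoc, ug, uj.
        rewrite <- !comp_assoc, (comp_assoc i p u), (comp_assoc j q u), <- comp_hadd_l, sum.
        rewrite comp_idl; reflexivity. }
      rewrite <- comp_assoc, Hv, <- comp_assoc.
      rewrite <- (comp_idr c) at 2; rewrite <- Hg, comp_hadd_r, (comp_assoc c j'), cj.
      rewrite comp_zero_l, hadd_zero; reflexivity.
    - rewrite comp_assoc, Hv, <- comp_assoc, ug; exact pi. }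
  apply (ses_iso (i := j') (p := c) (a := idm B) (b := u) (c := v)); try assumption.
  - exists (idm B); split; apply comp_idl.
  - rewrite comp_idr; exact uj.
Qed.

(* [gamma] factors through the stable category: two sections of the projection
   A + P ->> A, with P projective-injective, become equal under [gamma]. *)
Lemma gamma_stable (hY : forall P, projinj P -> Y P) A B (f g : Hom A B) :
  stable_eq f g -> fmap gamma f ≈ fmap gamma g.
Proof.
  intros (P & h & k & HP & H).
  destruct (biproduct_exists A P) as (S & i & j & p & q & pi & qj & pj & qi & sum).
  assert (Hw : weq p).
  { destruct (ses_id_zero S) as (O & c & HO & Hs).
    exists S, O, P, (idm S), c, j, p; repeat split; try assumption.
    - now apply hY, zero_projinj.
    - now apply (ses_biproduct pi qj).
    - now apply hY.
    - symmetry; apply comp_idr. }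
  destruct (weq_gamma_iso Hw) as [r [rp _]].
  assert (E1 : p ∘ (i + j ∘ h) ≈ idm A).
  { rewrite comp_hadd_r, comp_assoc, pj, comp_zero_l, hadd_zero; exact pi. }
  assert (Hsec : fmap gamma i ≈ fmap gamma (i + j ∘ h)).
  { rewrite <- (comp_idl (fmap gamma i)), <- (comp_idl (fmap gamma (i + j ∘ h))), <- rp.
    rewrite <- !comp_assoc, <- !fmap_comp, (fmap_heq gamma pi), (fmap_heq gamma E1).
    reflexivity. }
  assert (Hf : (f ∘ p + k ∘ q) ∘ i ≈ f).
  { rewrite comp_hadd_l, <- !comp_assoc, pi, qi, comp_zero_r, hadd_zero; apply comp_idr. }
  assert (Hg : (f ∘ p + k ∘ q) ∘ (i + j ∘ h) ≈ g).
  { rewrite comp_hadd_r, Hf, comp_hadd_l, <- !comp_assoc, (comp_assoc p j), (comp_assoc q j).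
    rewrite pj, qj, comp_zero_l, comp_zero_r, zero_hadd, comp_idl, <- H; apply sub_add. }
  rewrite <- (fmap_heq gamma Hf), <- (fmap_heq gamma Hg), !fmap_comp, Hsec.
  reflexivity.
Qed.

Definition quotient (hY : forall P, projinj P -> Y P) : Functor (stable E) loc.
Proof.
  refine (@Build_Functor (stable E) loc (fun A => A) (fun A B f => fmap gamma f) _ _ _).
  - intros A B f g; now apply gamma_stable.
  - exact (fmap_id gamma).
  - exact (fmap_comp gamma).
Defined.

(* The triangulated structure of A/Y: a shift through which [quotient] commutes
   with shifts up to natural isomorphism (unique up to isomorphism by the
   universal property of the localization), the distinguished triangles being
   those isomorphic to images of distinguished triangles of the stable
   category. *)
Variable S : suspension E.

Record loc_shift (hY : forall P, projinj P -> Y P) := {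
  ls_shift : Functor loc loc;
  ls_iso : NatIso (ls_shift ∘F quotient hY) (quotient hY ∘F stable_shift S)
}.

Definition loc_triangle (hY : forall P, projinj P -> Y P) (L : loc_shift hY)
    (A B D : loc) (f : Hom A B) (g : Hom B D) (h : Hom D (ls_shift L A)) : Prop :=
  exists (A' B' D' : stable E) (f' : Hom A' B') (g' : Hom B' D')
         (h' : Hom D' (stable_shift S A'))
         (a : Hom A (quotient hY A')) (b : Hom B (quotient hY B'))
         (d : Hom D (quotient hY D')),
    stable_triangle f' g' h' /\ is_iso a /\ is_iso b /\ is_iso d /\
    b ∘ f ≈ fmap (quotient hY) f' ∘ a /\
    d ∘ g ≈ fmap (quotient hY) g' ∘ b /\
    ls_iso L A' ∘ fmap (ls_shift L) a ∘ h ≈ fmap (quotient hY) h' ∘ d.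

Definition loc_tri (hY : forall P, projinj P -> Y P) (L : loc_shift hY) : TriCat :=
  {| tcat := loc; shift := ls_shift L; triangle := loc_triangle (L := L) |}.

End Localization.

Lemma thick_projinj (E : ExactCategory) (S : suspension E) (Y : E -> Prop) :
  thick (T := stable_tri S) Y -> forall P : E, projinj P -> Y P.
Proof. intros H P HP; exact (thick_zero H (projinj_stable_zero HP)). Qed.

(* ------------------------------------------------------------------ *)
(* The functors C(U,V) and E(U,V), on a category [D] under A/~ via
   [K : A/~ -> D] (here [K] is the identity of A/~ or the quotient A/~ -> A/Y):
   [F] is induced by A |-> U if F(K A) is the middle term of a sequence
   V >-> F(K A) ->> A, stably naturally in [A]; dually for A |-> V'. *)
Section InducedFunctors.
Variables (E : ExactCategory) (D : Category) (K : Functor (stable E) D).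
Variables (F : Functor D (stable E)) (U V : E -> Prop).

Definition is_C : Prop :=
  exists eps : forall A : stable E, Hom (F (K A)) A,
    natural (F := F ∘F K) (G := fid (stable E)) eps /\
    forall A : E, U (F (K A)) /\
      exists (B : E) (i : @Hom E B (F (K A))), V B /\ ses (e := E) i (eps A).

Definition is_E : Prop :=
  exists eta : forall A : stable E, Hom A (F (K A)),
    natural (F := fid (stable E)) (G := F ∘F K) eta /\
    forall A : E, V (F (K A)) /\
      exists (B : E) (p : @Hom E (F (K A)) B), U B /\ ses (e := E) (eta A) p.

End InducedFunctors.

Section Diagrams.
Variables (E : ExactCategory) (X Y Z : E -> Prop) (hY : forall P, projinj P -> Y P).

Definition adjoint_functors :=
  Adjoints (fullsub (C := stable E) Y) (stable E) (loc Y).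

Let I : Functor (fullsub (C := stable E) Y) (stable E) := incl (C := stable E) Y.
Let Q : Functor (stable E) (loc Y) := quotient hY.
Let all_objects (_ : E) : Prop := True.

(*       E(X,Y)         C(X,Y)
         <-----         <-----
    Y/~  --I-->  A/~  --Q-->   A/Y
         <-----         <-----
         C(Y,Z)         E(Y,Z)         *)
Definition triple_adjoints (d : adjoint_functors) : Prop :=
  is_E (fid _) (I ∘F inc_l d) X Y /\ is_C (fid _) (I ∘F inc_r d) Y Z /\
  is_C Q (quo_l d) X Y /\ is_E Q (quo_r d) Y Z.

(* The functors of the injective recollement theorem for M_1 = (W, A),
   M_2 = (X, Y), M_3 = (Y, Z): E(M_2), C(M_3), the functor on A/Y induced by
   C(M_2) o E(M_1), and E(M_3). *)
Definition injective_adjoints (d : adjoint_functors) : Prop :=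
  is_E (fid _) (I ∘F inc_l d) X Y /\ is_C (fid _) (I ∘F inc_r d) Y Z /\
  (exists E1 C2 : Functor (stable E) (stable E),
      is_E (fid _) E1 (@projinj E) all_objects /\ is_C (fid _) C2 X Y /\
      nat_isomorphic (quo_l d ∘F Q) (C2 ∘F E1)) /\
  is_E Q (quo_r d) Y Z.

(* The functors of the projective recollement theorem for M_1 = (A, W),
   M_2 = (Y, Z), M_3 = (X, Y): E(M_3), C(M_2), C(M_3), and the functor on A/Y
   induced by E(M_2) o C(M_1). *)
Definition projective_adjoints (d : adjoint_functors) : Prop :=
  is_E (fid _) (I ∘F inc_l d) X Y /\ is_C (fid _) (I ∘F inc_r d) Y Z /\
  is_C Q (quo_l d) X Y /\
  (exists C1 E2 : Functor (stable E) (stable E),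
      is_C (fid _) C1 all_objects (@projinj E) /\ is_E (fid _) E2 Y Z /\
      nat_isomorphic (quo_r d ∘F Q) (E2 ∘F C1)).

End Diagrams.

(* Main.v *)
Require Import Defs.
From Stdlib Require Import Setoid Morphisms ClassicalEpsilon.

Set Implicit Arguments.
Unset Strict Implicit.
Unset Printing Implicit Defensive.
Local Open Scope cat_scope.

(** In a Frobenius category an extension of [A] by [B] is the same thing, up to equivalence,
    as a stable map from [A] to the suspension of [B] (its connecting map), so that
    Ext^1-orthogonality is Hom-orthogonality in the stable category up to a
    shift: [Ext1_zero_iff].  Short exact sequences give triangles and, after
    adding projective-injective objects, every triangle arises from a short
    exact sequence ([ses_triangle], [standard_cone_ses]).  Therefore thick classes
    containing the projective-injective objects are thick subcategories, approximation
    sequences are torsion triangles, and localizing cotorsion pairs are torsion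
    pairs of thick subcategories: [torsion_of_localizing], [localizing_of_torsion].

    For a torsion triple (X, Y, Z) everything else rests on one notion.  Call a
    stable map X-colocal if it induces bijections on Hom(U, -) for [U] in X, and dually
    Z-local.  A map with cone in Y is X-colocal and Z-local because Hom(X, Y) = 0 and
    Hom(Y, Z) = 0, and a colocal map between objects of X is invertible.  So the
    coreflection C(X, Y) of the stable category onto X inverts the maps
    defining the localization A/Y and, by the universal property, becomes a functor
    on A/Y; its counit has kernel in Y, hence is inverted in A/Y.  This makes it
    a fully faithful left adjoint of the quotient functor with essential image
    X ([coreflects_adjoint]), and an equivalence between A/Y and X; dually E(Y, Z) is
    the right adjoint, with image Z.  That C(X, Y) and E(Y, Z) preserve
    triangles is the five lemma: the cone of the coreflected map already lies in X, and
    it maps to the original cone by a colocal map ([coreflection_triangle]).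

    The functors of the injective and projective recollement theorems differ from these
    by E(W, A) and C(A, W), with W the projective-injective objects, and both are
    isomorphic to the identity of the stable category ([injective_coreflects],
    [projective_reflects]).  The two diagrams agree because adjoints are unique. *)

(** * Isomorphisms, opposite categories and adjunctions *)

Section Isomorphisms.
Variable C : Category.
Implicit Types A B D : C.

Lemma is_iso_id A : is_iso (idm A).
Proof. exists (idm A); split; apply comp_idl. Qed.

Lemma is_iso_comp A B D (g : Hom B D) (f : Hom A B) :
  is_iso g -> is_iso f -> is_iso (g ∘ f).
Proof.
  intros (g' & H1 & H2) (f' & H3 & H4); exists (f' ∘ g'); split.
  - rewrite <- comp_assoc, (comp_assoc g' g f), H1, comp_idl; exact H3.
  - rewrite <- comp_assoc, (comp_assoc f f' g'), H4, comp_idl; exact H2.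
Qed.

Lemma is_iso_heq A B (f g : Hom A B) : f ≈ g -> is_iso f -> is_iso g.
Proof.
  intros H (f' & H1 & H2); exists f'; split; [rewrite <- H|rewrite <- H]; assumption.
Qed.

Lemma isomorphic_sym A B : isomorphic A B -> isomorphic B A.
Proof. intros (f & g & H1 & H2); exists g, f; split; assumption. Qed.

Lemma iso_cancel_l A B D (f : Hom B D) (u v : Hom A B) :
  is_iso f -> f ∘ u ≈ f ∘ v -> u ≈ v.
Proof.
  intros (f' & H1 & _) H.
  rewrite <- (comp_idl u), <- (comp_idl v), <- H1, <- !comp_assoc, H; reflexivity.
Qed.

Lemma iso_cancel_r A B D (f : Hom A B) (u v : Hom B D) :
  is_iso f -> u ∘ f ≈ v ∘ f -> u ≈ v.
Proof.
  intros (f' & _ & H1) H.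
  rewrite <- (comp_idr u), <- (comp_idr v), <- H1, !comp_assoc, H; reflexivity.
Qed.

Lemma is_iso_cancel_r A B D (g : Hom B D) (f : Hom A B) :
  is_iso f -> is_iso (g ∘ f) -> is_iso g.
Proof.
  intros (f' & H1 & H2) Hgf.
  apply is_iso_heq with (f := (g ∘ f) ∘ f').
  - rewrite <- comp_assoc, H2; apply comp_idr.
  - apply is_iso_comp; [exact Hgf|exists f; split; assumption].
Qed.

Lemma is_zero_iso A B : isomorphic A B -> is_zero A -> is_zero B.
Proof.
  intros (f & g & H1 & H2) [HI HT]; split; intro D.
  - destruct (HI D) as [u Hu]; exists (u ∘ g); intro v.
    rewrite <- (comp_idr v), <- H2, comp_assoc, (Hu (v ∘ f)); reflexivity.
  - destruct (HT D) as [u Hu]; exists (f ∘ u); intro v.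
    rewrite <- (comp_idl v), <- H2, <- comp_assoc, (Hu (g ∘ v)); reflexivity.
Qed.

End Isomorphisms.

Lemma fmap_is_iso (C D : Category) (F : Functor C D) (A B : C) (f : Hom A B) :
  is_iso f -> is_iso (fmap F f).
Proof.
  intros (g & H1 & H2); exists (fmap F g).
  split; rewrite <- fmap_comp, <- fmap_id; apply fmap_heq; assumption.
Qed.

Lemma fmap_comp_is_iso (C D : Category) (F : Functor C D) (A B M : C) (g : Hom B M) (f : Hom A B) :
  is_iso (fmap F g) -> is_iso (fmap F f) -> is_iso (fmap F (g ∘ f)).
Proof.
  intros Hg Hf; apply (is_iso_heq (f := fmap F g ∘ fmap F f)).
  - symmetry; apply fmap_comp.
  - apply is_iso_comp; assumption.
Qed.

#[global] Instance fmap_Proper (C D : Category) (F : Functor C D) (A B : C) :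
  Proper (@heq C A B ==> @heq D (F A) (F B)) (@fmap C D F A B).
Proof. intros f g; apply fmap_heq. Qed.

(** Inverses are only given by existence statements; naming one needs choice. *)
Definition inverse (C : Category) (A B : C) (f : Hom A B) (Hf : is_iso f) : Hom B A :=
  proj1_sig (constructive_indefinite_description _ Hf).

Lemma inverse_l (C : Category) (A B : C) (f : Hom A B) (Hf : is_iso f) :
  inverse Hf ∘ f ≈ idm A.
Proof. exact (proj1 (proj2_sig (constructive_indefinite_description _ Hf))). Qed.

Lemma inverse_r (C : Category) (A B : C) (f : Hom A B) (Hf : is_iso f) :
  f ∘ inverse Hf ≈ idm B.
Proof. exact (proj2 (proj2_sig (constructive_indefinite_description _ Hf))). Qed.

Lemma inverse_is_iso (C : Category) (A B : C) (f : Hom A B) (Hf : is_iso f) :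
  is_iso (inverse Hf).
Proof. exists f; split; [apply inverse_r|apply inverse_l]. Qed.

Lemma natural_inverse (C D : Category) (F G : Functor C D)
    (t : forall A : C, Hom (F A) (G A)) (Ht : forall A, is_iso (t A)) :
  natural t -> natural (fun A => inverse (Ht A)).
Proof.
  intros H A B f; apply (iso_cancel_l (Ht B)).
  rewrite !comp_assoc, inverse_r, comp_idl, (H A B f), <- comp_assoc, inverse_r, comp_idr.
  reflexivity.
Qed.

Lemma natural_comp (C D : Category) (F G H : Functor C D)
    (s : forall A : C, Hom (F A) (G A)) (t : forall A : C, Hom (G A) (H A)) :
  natural s -> natural t -> natural (F := F) (G := H) (fun A => t A ∘ s A).
Proof.
  intros Hs Ht A B f; rewrite <- comp_assoc, (Hs A B f), comp_assoc, (Ht A B f), <- comp_assoc.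
  reflexivity.
Qed.

Lemma nat_isomorphic_sym (C D : Category) (F G : Functor C D) :
  nat_isomorphic F G -> nat_isomorphic G F.
Proof.
  intros [t]; constructor.
  exact (Build_NatIso (natural_inverse (ni_iso t) (@ni_natural _ _ _ _ t))
           (fun A => inverse_is_iso (ni_iso t A))).
Qed.

Definition op (C : Category) : Category.
Proof.
  refine (@Build_Category C (fun A B => @Hom C B A) (fun A B f g => f ≈ g)
            (fun A => idm A) (fun A B D g f => f ∘ g) _ _ _ _ _).
  - intros A B D g g' f f' Hg Hf; now apply comp_heq.
  - intros; symmetry; apply comp_assoc.
  - intros; apply comp_idr.
  - intros; apply comp_idl.
Defined.

Definition op_functor (C D : Category) (F : Functor C D) : Functor (op C) (op D).
Proof.
  refine (@Build_Functor (op C) (op D) (fun A => F A) (fun A B f => @fmap C D F B A f) _ _ _).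
  - intros A B f g; exact (@fmap_heq C D F B A f g).
  - intro A; exact (fmap_id F A).
  - intros A B E g f; exact (@fmap_comp C D F E B A f g).
Defined.

Lemma op_is_iso (C : Category) (A B : C) (f : Hom A B) :
  is_iso f <-> @is_iso (op C) B A f.
Proof. split; intros (g & H1 & H2); exists g; split; assumption. Qed.

Lemma op_nat_isomorphic (C D : Category) (F G : Functor C D) :
  nat_isomorphic (op_functor F) (op_functor G) -> nat_isomorphic G F.
Proof.
  intros [[t Ht Hi]]; constructor.
  unshelve refine (@Build_NatIso C D G F (fun A => t A) _ _).
  - intros A B f; symmetry; exact (Ht B A f).
  - intro A; apply op_is_iso, Hi.
Qed.

Lemma op_adjoint (C D : Category) (L : Functor C D) (R : Functor D C) :
  adjoint L R <-> adjoint (op_functor R) (op_functor L).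
Proof.
  split; intros (eta & eps & N1 & N2 & T1 & T2); exists eps, eta;
    (split; [|split; [|split; assumption]]); intros A B f; symmetry;
    first [exact (N2 B A f) | exact (N1 B A f)].
Qed.

Lemma op_fully_faithful (C D : Category) (F : Functor C D) :
  fully_faithful (op_functor F) -> fully_faithful F.
Proof.
  intros [H1 H2]; split; [intros A B; exact (H1 B A)|intros A B; exact (H2 B A)].
Qed.

Section Adjunctions.
Variables C D : Category.

(** The unit and its inverse control one triangle identity; for the other one,
    the composite [x] of counit and image of the unit satisfies [R x = id], and
    naturality of the counit at [x] allows to cancel the isomorphism
    [eps (L A)]. *)
Lemma adjoint_of_iso_unit (L : Functor C D) (R : Functor D C)
    (eta : forall A : C, Hom A (R (L A))) (eps : forall B : D, Hom (L (R B)) B) :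
  natural (F := fid C) (G := R ∘F L) eta ->
  natural (F := L ∘F R) (G := fid D) eps ->
  (forall A, is_iso (eta A)) -> (forall A, is_iso (eps (L A))) ->
  (forall B, fmap R (eps B) ∘ eta (R B) ≈ idm (R B)) ->
  adjoint L R /\ fully_faithful L.
Proof.
  intros N1 N2 I1 I2 T2.
  assert (N1' : forall A B (f : Hom A B), eta B ∘ f ≈ fmap R (fmap L f) ∘ eta A) by exact N1.
  assert (N2' : forall A B (f : Hom A B), eps B ∘ fmap L (fmap R f) ≈ f ∘ eps A) by exact N2.
  assert (T1 : forall A, eps (L A) ∘ fmap L (eta A) ≈ idm (L A)).
  { intro A; set (x := eps (L A) ∘ fmap L (eta A)).
    assert (Hx : fmap R x ≈ idm _).
    { apply (iso_cancel_r (I1 A)); unfold x.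
      rewrite fmap_comp, <- comp_assoc, <- N1', comp_assoc, T2; reflexivity. }
    apply (iso_cancel_r (I2 A)).
    rewrite <- (N2' _ _ x), Hx, fmap_id, comp_idl; apply comp_idr. }
  split; [exists eta, eps; repeat split; assumption|split].
  - intros A B g; exists (inverse (I1 B) ∘ (fmap R g ∘ eta A)).
    assert (H : fmap L (inverse (I1 B)) ≈ eps (L B)).
    { apply (iso_cancel_r (fmap_is_iso L (I1 B))).
      rewrite <- fmap_comp, inverse_l, fmap_id, T1; reflexivity. }
    rewrite !fmap_comp, H, comp_assoc, N2', <- comp_assoc, T1; apply comp_idr.
  - intros A B f g H; apply (iso_cancel_l (I1 B)).
    rewrite !N1', H; reflexivity.
Qed.

Lemma right_adjoint_additive (L : Functor C D) (R : Functor D C) :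
  adjoint L R -> additive_functor R.
Proof.
  intros (eta & eps & N1 & N2 & T1 & T2).
  assert (N1' : forall A B (f : Hom A B), eta B ∘ f ≈ fmap R (fmap L f) ∘ eta A) by exact N1.
  assert (N2' : forall A B (f : Hom A B), eps B ∘ fmap L (fmap R f) ≈ f ∘ eps A) by exact N2.
  assert (tr : forall A B (g : Hom A (R B)), fmap R (eps B ∘ fmap L g) ∘ eta A ≈ g).
  { intros A B g; rewrite fmap_comp, <- comp_assoc, <- N1', comp_assoc, T2; apply comp_idl. }
  assert (untr : forall A B (f : Hom (L A) B), eps B ∘ fmap L (fmap R f ∘ eta A) ≈ f).
  { intros A B f; rewrite fmap_comp, comp_assoc, N2', <- comp_assoc, T1; apply comp_idr. }
  split.
  - intros T HT A; destruct (HT (L A)) as [t Ht].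
    exists (fmap R t ∘ eta A); intro g.
    rewrite <- (tr _ _ g), (Ht (eps T ∘ fmap L g)); reflexivity.
  - intros A B P p q HP T a b.
    destruct (HP (L T) (eps A ∘ fmap L a) (eps B ∘ fmap L b)) as (u & [Hp Hq] & Hu).
    exists (fmap R u ∘ eta T); repeat split.
    + rewrite comp_assoc, <- fmap_comp, Hp; apply tr.
    + rewrite comp_assoc, <- fmap_comp, Hq; apply tr.
    + intros v Hv1 Hv2.
      rewrite <- (tr _ _ v), (Hu (eps P ∘ fmap L v)); [reflexivity| |].
      * rewrite comp_assoc, <- N2', <- comp_assoc, <- fmap_comp, Hv1; reflexivity.
      * rewrite comp_assoc, <- N2', <- comp_assoc, <- fmap_comp, Hv2; reflexivity.
Qed.

Lemma left_adjoint_unique (L L' : Functor C D) (R : Functor D C) :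
  adjoint L R -> adjoint L' R -> nat_isomorphic L L'.
Proof.
  intros (eta & eps & N1 & N2 & T1 & T2) (eta' & eps' & N1' & N2' & T1' & T2').
  assert (N1e : forall A B (f : Hom A B), eta B ∘ f ≈ fmap R (fmap L f) ∘ eta A) by exact N1.
  assert (N2e : forall A B (f : Hom A B), eps B ∘ fmap L (fmap R f) ≈ f ∘ eps A) by exact N2.
  assert (N1e' : forall A B (f : Hom A B), eta' B ∘ f ≈ fmap R (fmap L' f) ∘ eta' A) by exact N1'.
  assert (N2e' : forall A B (f : Hom A B), eps' B ∘ fmap L' (fmap R f) ≈ f ∘ eps' A) by exact N2'.
  constructor.
  unshelve refine (@Build_NatIso _ _ L L' (fun A => eps (L' A) ∘ fmap L (eta' A)) _ _).
  - intros A B f.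
    rewrite <- comp_assoc, <- fmap_comp, N1e', fmap_comp, !comp_assoc, N2e; reflexivity.
  - intro A; exists (eps' (L A) ∘ fmap L' (eta A)); split.
    + rewrite comp_assoc, <- N2e, <- comp_assoc, <- fmap_comp, (fmap_comp R), <- comp_assoc.
      rewrite <- N1e', comp_assoc, T2', comp_idl; apply T1.
    + rewrite comp_assoc, <- N2e', <- comp_assoc, <- fmap_comp, (fmap_comp R), <- comp_assoc.
      rewrite <- N1e, comp_assoc, T2, comp_idl; apply T1'.
Qed.

End Adjunctions.

Lemma adjoint_of_iso_counit (C D : Category) (L : Functor C D) (R : Functor D C)
    (eta : forall A : C, Hom A (R (L A))) (eps : forall B : D, Hom (L (R B)) B) :
  natural (F := fid C) (G := R ∘F L) eta ->
  natural (F := L ∘F R) (G := fid D) eps ->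
  (forall B, is_iso (eps B)) -> (forall B, is_iso (eta (R B))) ->
  (forall A, eps (L A) ∘ fmap L (eta A) ≈ idm (L A)) ->
  adjoint L R /\ fully_faithful R.
Proof.
  intros N1 N2 I1 I2 T1.
  destruct (@adjoint_of_iso_unit (op D) (op C) (op_functor R) (op_functor L) eps eta)
    as [HA HF].
  - intros A B f; symmetry; exact (N2 B A f).
  - intros A B f; symmetry; exact (N1 B A f).
  - intro B; apply op_is_iso, I1.
  - intro B; apply op_is_iso, I2.
  - exact T1.
  - split; [apply op_adjoint, HA|apply op_fully_faithful, HF].
Qed.

Lemma right_adjoint_unique (C D : Category) (L : Functor C D) (R R' : Functor D C) :
  adjoint L R -> adjoint L R' -> nat_isomorphic R R'.
Proof.
  intros H H'; apply op_nat_isomorphic.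
  apply left_adjoint_unique with (R := op_functor L); apply op_adjoint; assumption.
Qed.

(** * Triangulated categories *)

Section AdditiveComplements.
Variable T : AdditiveCategory.
Implicit Types A B D : T.

Lemma comp_sub_r A B D (g : Hom B D) (f f' : Hom A B) : g ∘ (f - f') ≈ g ∘ f - g ∘ f'.
Proof. rewrite comp_hadd_r, comp_opp_r; reflexivity. Qed.

Lemma comp_sub_l A B D (g g' : Hom B D) (f : Hom A B) : (g - g') ∘ f ≈ g ∘ f - g' ∘ f.
Proof. rewrite comp_hadd_l, comp_opp_l; reflexivity. Qed.

Lemma sub_zero_r A B (f : Hom A B) : f - hzero A B ≈ f.
Proof. rewrite hopp_zero; apply hadd_zero. Qed.

Lemma hopp_hopp A B (f : Hom A B) : - (- f) ≈ f.
Proof. symmetry; apply hopp_unique; rewrite hadd_comm; apply hadd_opp. Qed.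

Lemma hom_zero_iff A B : hom_zero A B <-> forall f : Hom A B, f ≈ hzero A B.
Proof.
  split; intro H; [intro f; apply H|intros f g; rewrite (H f), (H g); reflexivity].
Qed.

Lemma zero_object_hom_l A B (f : Hom A B) : is_zero A -> f ≈ hzero A B.
Proof. intros [H _]; destruct (H B) as [u Hu]; rewrite (Hu f), (Hu (hzero A B)); reflexivity. Qed.

Lemma zero_object_hom_r A B (f : Hom A B) : is_zero B -> f ≈ hzero A B.
Proof. intros [_ H]; destruct (H A) as [u Hu]; rewrite (Hu f), (Hu (hzero A B)); reflexivity. Qed.

Lemma zero_object_of_id A : idm A ≈ hzero A A -> is_zero A.
Proof.
  intro H; split; intro B.
  - exists (hzero A B); intro g; rewrite <- (comp_idr g), H; apply comp_zero_r.
  - exists (hzero B A); intro g; rewrite <- (comp_idl g), H; apply comp_zero_l.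
Qed.

End AdditiveComplements.

Section HomBijections.
Variable T : Category.
Implicit Types (A B : T) (P : T -> Prop).

Definition hom_bij_cov (U A B : T) (f : Hom A B) : Prop :=
  (forall v : Hom U B, exists u : Hom U A, f ∘ u ≈ v) /\
  (forall u u' : Hom U A, f ∘ u ≈ f ∘ u' -> u ≈ u').

Definition hom_bij_contra (A B : T) (f : Hom A B) (U : T) : Prop :=
  (forall v : Hom A U, exists u : Hom B U, u ∘ f ≈ v) /\
  (forall u u' : Hom B U, u ∘ f ≈ u' ∘ f -> u ≈ u').

(** A [P]-colocal map becomes invertible under every coreflection onto [P]; dually for
    local maps and reflections. *)
Definition colocal P A B (f : Hom A B) : Prop := forall U, P U -> hom_bij_cov U f.
Definition local P A B (f : Hom A B) : Prop := forall U, P U -> hom_bij_contra f U.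

Lemma hom_bij_cov_iso U A B (f : Hom A B) : is_iso f -> hom_bij_cov U f.
Proof.
  intro H; split; [|intros u u'; apply (iso_cancel_l H)].
  intro v; exists (inverse H ∘ v); rewrite comp_assoc, inverse_r; apply comp_idl.
Qed.

Lemma hom_bij_contra_iso U A B (f : Hom A B) : is_iso f -> hom_bij_contra f U.
Proof.
  intro H; split; [|intros u u'; apply (iso_cancel_r H)].
  intro v; exists (v ∘ inverse H); rewrite <- comp_assoc, inverse_l; apply comp_idr.
Qed.

Lemma hom_bij_cov_heq U A B (f g : Hom A B) : f ≈ g -> hom_bij_cov U f -> hom_bij_cov U g.
Proof.
  intros E [H1 H2]; split.
  - intro v; destruct (H1 v) as [u Hu]; exists u; rewrite <- E; exact Hu.
  - intros u u' H; apply H2; rewrite E; exact H.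
Qed.

Lemma hom_bij_contra_heq U A B (f g : Hom A B) :
  f ≈ g -> hom_bij_contra f U -> hom_bij_contra g U.
Proof.
  intros E [H1 H2]; split.
  - intro v; destruct (H1 v) as [u Hu]; exists u; rewrite <- E; exact Hu.
  - intros u u' H; apply H2; rewrite E; exact H.
Qed.

Lemma hom_bij_cov_comp U A B D (g : Hom B D) (f : Hom A B) :
  hom_bij_cov U g -> hom_bij_cov U f -> hom_bij_cov U (g ∘ f).
Proof.
  intros [G1 G2] [F1 F2]; split.
  - intro v; destruct (G1 v) as [w Hw]; destruct (F1 w) as [u Hu]; exists u.
    rewrite <- comp_assoc, Hu; exact Hw.
  - intros u u' H; apply F2, G2; rewrite !comp_assoc; exact H.
Qed.

Lemma hom_bij_contra_comp U A B D (g : Hom B D) (f : Hom A B) :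
  hom_bij_contra g U -> hom_bij_contra f U -> hom_bij_contra (g ∘ f) U.
Proof.
  intros [G1 G2] [F1 F2]; split.
  - intro v; destruct (F1 v) as [w Hw]; destruct (G1 w) as [u Hu]; exists u.
    rewrite comp_assoc, Hu; exact Hw.
  - intros u u' H; apply G2, F2; rewrite <- !comp_assoc; exact H.
Qed.

Lemma hom_bij_cov_cancel U A B D (g : Hom B D) (f : Hom A B) :
  hom_bij_cov U g -> hom_bij_cov U (g ∘ f) -> hom_bij_cov U f.
Proof.
  intros [G1 G2] [F1 F2]; split.
  - intro v; destruct (F1 (g ∘ v)) as [u Hu]; exists u; apply G2.
    rewrite comp_assoc; exact Hu.
  - intros u u' H; apply F2; rewrite <- !comp_assoc, H; reflexivity.
Qed.

Lemma hom_bij_contra_cancel U A B D (g : Hom B D) (f : Hom A B) :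
  hom_bij_contra f U -> hom_bij_contra (g ∘ f) U -> hom_bij_contra g U.
Proof.
  intros [F1 F2] [G1 G2]; split.
  - intro v; destruct (G1 (v ∘ f)) as [u Hu]; exists u; apply F2.
    rewrite <- comp_assoc; exact Hu.
  - intros u u' H; apply G2; rewrite !comp_assoc, H; reflexivity.
Qed.

(** Yoneda inside [P]: the inverse is the preimage of an identity. *)
Lemma colocal_is_iso P A B (f : Hom A B) : colocal P f -> P A -> P B -> is_iso f.
Proof.
  intros H HA HB; destruct (proj1 (H B HB) (idm B)) as [g Hg].
  exists g; split; [|exact Hg].
  apply (proj2 (H A HA)); rewrite comp_assoc, Hg, comp_idl, comp_idr; reflexivity.
Qed.

Lemma local_is_iso P A B (f : Hom A B) : local P f -> P A -> P B -> is_iso f.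
Proof.
  intros H HA HB; destruct (proj1 (H A HA) (idm A)) as [g Hg].
  exists g; split; [exact Hg|].
  apply (proj2 (H B HB)); rewrite <- comp_assoc, Hg, comp_idl, comp_idr; reflexivity.
Qed.

End HomBijections.

(** The axioms up to the octahedral one.  The weak kernel and cokernel properties follow from
    the usual axioms; they are listed because for stable categories they come
    directly from the exactness of short exact sequences. *)
Record triangulated (T : AdditiveCategory) (Sh : Functor T T)
    (tri : forall A B D : T, Hom A B -> Hom B D -> Hom D (Sh A) -> Prop) : Prop := {
  tri_iso : forall (A B D A' B' D' : T) (f : Hom A B) (g : Hom B D) (h : Hom D (Sh A))
      (f' : Hom A' B') (g' : Hom B' D') (h' : Hom D' (Sh A'))
      (a : Hom A A') (b : Hom B B') (d : Hom D D'),
      is_iso a -> is_iso b -> is_iso d ->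
      b ∘ f ≈ f' ∘ a -> d ∘ g ≈ g' ∘ b -> fmap Sh a ∘ h ≈ h' ∘ d ->
      tri _ _ _ f' g' h' -> tri _ _ _ f g h;
  tri_cone : forall (A B : T) (f : Hom A B), exists (D : T) (g : Hom B D) (h : Hom D (Sh A)),
      tri _ _ _ f g h;
  tri_rot : forall (A B D : T) (f : Hom A B) (g : Hom B D) (h : Hom D (Sh A)),
      tri _ _ _ f g h -> tri _ _ _ g h (- fmap Sh f);
  tri_fill : forall (A B D A' B' D' : T) (f : Hom A B) (g : Hom B D) (h : Hom D (Sh A))
      (f' : Hom A' B') (g' : Hom B' D') (h' : Hom D' (Sh A')) (a : Hom A A') (b : Hom B B'),
      tri _ _ _ f g h -> tri _ _ _ f' g' h' -> b ∘ f ≈ f' ∘ a ->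
      exists d : Hom D D', d ∘ g ≈ g' ∘ b /\ fmap Sh a ∘ h ≈ h' ∘ d;
  tri_zero : forall (A B D : T) (f : Hom A B) (g : Hom B D) (h : Hom D (Sh A)),
      tri _ _ _ f g h -> g ∘ f ≈ hzero A D;
  tri_ker : forall (A B D : T) (f : Hom A B) (g : Hom B D) (h : Hom D (Sh A)),
      tri _ _ _ f g h -> forall (U : T) (u : Hom U B), g ∘ u ≈ hzero U D ->
      exists v : Hom U A, f ∘ v ≈ u;
  tri_coker : forall (A B D : T) (f : Hom A B) (g : Hom B D) (h : Hom D (Sh A)),
      tri _ _ _ f g h -> forall (U : T) (u : Hom B U), u ∘ f ≈ hzero A U ->
      exists v : Hom D U, v ∘ g ≈ u;
  shift_zero : forall A B : T, fmap Sh (hzero A B) ≈ hzero (Sh A) (Sh B);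
  shift_ff : fully_faithful Sh;
  shift_surj : forall A : T, essential_image Sh A
}.

Lemma thick_ext (T : TriCat) (P P' : T -> Prop) :
  (forall A, P A <-> P' A) -> thick P -> thick P'.
Proof.
  intros HPP H; split.
  - intros A B Hi HA; apply HPP; apply HPP in HA; exact (thick_iso H Hi HA).
  - intros A HA; apply HPP; exact (thick_zero H HA).
  - intros A HA; apply HPP; apply HPP in HA; exact (thick_shift H HA).
  - intros A HA; apply HPP; apply HPP in HA; exact (thick_unshift H HA).
  - intros A B D f g h Ht HA HB; apply HPP; apply HPP in HA; apply HPP in HB.
    exact (thick_cone H Ht HA HB).
  - intros A B Hs HB; apply HPP; apply HPP in HB; exact (thick_summand H Hs HB).
Qed.

Section Triangulated.
Variables (T : AdditiveCategory) (Sh : Functor T T).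
Variable tri : forall A B D : T, Hom A B -> Hom B D -> Hom D (Sh A) -> Prop.
Hypothesis HT : triangulated tri.
Implicit Types (A B D U : T) (P : T -> Prop).

Let TT : TriCat := {| tcat := T; shift := Sh; triangle := tri |}.

Lemma shift_faithful_zero A B (f : Hom A B) : fmap Sh f ≈ hzero _ _ -> f ≈ hzero A B.
Proof. intro H; apply (proj2 (shift_ff HT)); rewrite H, (shift_zero HT); reflexivity. Qed.

Section Triangle.
Variables (A B D : T) (f : Hom A B) (g : Hom B D) (h : Hom D (Sh A)).
Hypothesis Ht : tri f g h.

Lemma tri_zero3 : fmap Sh f ∘ h ≈ hzero _ _.
Proof.
  pose proof (tri_zero HT (tri_rot HT (tri_rot HT Ht))) as H.
  rewrite comp_opp_l in H; rewrite <- (hopp_hopp (_ ∘ h)), H; apply hopp_zero.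
Qed.

Lemma tri_ker2 U (u : Hom U D) : h ∘ u ≈ hzero _ _ -> exists v, g ∘ v ≈ u.
Proof. exact (tri_ker HT (tri_rot HT Ht) (u := u)). Qed.

Lemma tri_ker3 U (u : Hom U (Sh A)) : fmap Sh f ∘ u ≈ hzero _ _ -> exists v, h ∘ v ≈ u.
Proof.
  intro H; apply (tri_ker HT (tri_rot HT (tri_rot HT Ht))).
  rewrite comp_opp_l, H; apply hopp_zero.
Qed.

Lemma tri_coker2 U (u : Hom D U) : u ∘ g ≈ hzero _ _ -> exists v, v ∘ h ≈ u.
Proof. exact (tri_coker HT (tri_rot HT Ht) (u := u)). Qed.

Lemma tri_coker3 U (u : Hom (Sh A) U) : u ∘ h ≈ hzero _ _ -> exists v, v ∘ fmap Sh f ≈ u.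
Proof.
  intro H; destruct (tri_coker HT (tri_rot HT (tri_rot HT Ht)) H) as [v Hv].
  exists (- v); rewrite comp_opp_l, <- Hv, comp_opp_r; reflexivity.
Qed.

End Triangle.

Section FiveLemma.
Variables (A B D A' B' D' : T) (f : Hom A B) (g : Hom B D) (h : Hom D (Sh A)).
Variables (f' : Hom A' B') (g' : Hom B' D') (h' : Hom D' (Sh A')).
Variables (a : Hom A A') (b : Hom B B') (d : Hom D D').
Hypotheses (Ht : tri f g h) (Ht' : tri f' g' h').
Hypotheses (Hf : b ∘ f ≈ f' ∘ a) (Hg : d ∘ g ≈ g' ∘ b) (Hh : fmap Sh a ∘ h ≈ h' ∘ d).
Variable U : T.

Let HSf : fmap Sh b ∘ fmap Sh f ≈ fmap Sh f' ∘ fmap Sh a.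
Proof. rewrite <- !fmap_comp, Hf; reflexivity. Qed.

Lemma five_lemma_cov :
  hom_bij_cov U a -> hom_bij_cov U b ->
  hom_bij_cov U (fmap Sh a) -> hom_bij_cov U (fmap Sh b) -> hom_bij_cov U d.
Proof.
  intros [a1 a2] [b1 b2] [sa1 sa2] [sb1 sb2].
  assert (inj : forall u : Hom U D, d ∘ u ≈ hzero _ _ -> u ≈ hzero _ _).
  { intros u Hu.
    destruct (tri_ker2 Ht (u := u)) as [v Hv].
    { apply sa2; rewrite comp_assoc, Hh, <- comp_assoc, Hu, !comp_zero_r; reflexivity. }
    destruct (tri_ker HT Ht' (u := b ∘ v)) as [x Hx].
    { rewrite comp_assoc, <- Hg, <- comp_assoc, Hv; exact Hu. }
    destruct (a1 x) as [y Hy].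
    assert (Hvy : v ≈ f ∘ y).
    { apply b2; rewrite comp_assoc, Hf, <- comp_assoc, Hy, Hx; reflexivity. }
    rewrite <- Hv, Hvy, comp_assoc, (tri_zero HT Ht); apply comp_zero_l. }
  split.
  - intro w.
    destruct (sa1 (h' ∘ w)) as [x Hx].
    destruct (tri_ker3 Ht (u := x)) as [v Hv].
    { apply sb2; rewrite comp_assoc, HSf, <- comp_assoc, Hx, comp_assoc, (tri_zero3 Ht').
      rewrite comp_zero_l, comp_zero_r; reflexivity. }
    destruct (tri_ker2 Ht' (u := w - d ∘ v)) as [y Hy].
    { rewrite comp_sub_r, (comp_assoc h' d), <- Hh, <- comp_assoc, Hv, Hx; apply hadd_opp. }
    destruct (b1 y) as [z Hz]; exists (v + g ∘ z).
    rewrite comp_hadd_r, (comp_assoc d g), Hg, <- comp_assoc, Hz, Hy; apply sub_add.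
  - intros u u' H; apply sub_zero_eq, inj; rewrite comp_sub_r, H; apply hadd_opp.
Qed.

Lemma five_lemma_contra :
  hom_bij_contra a U -> hom_bij_contra b U ->
  hom_bij_contra (fmap Sh a) U -> hom_bij_contra (fmap Sh b) U -> hom_bij_contra d U.
Proof.
  intros [a1 a2] [b1 b2] [sa1 sa2] [sb1 sb2].
  assert (inj : forall u : Hom D' U, u ∘ d ≈ hzero _ _ -> u ≈ hzero _ _).
  { intros u Hu.
    destruct (tri_coker2 Ht' (u := u)) as [v Hv].
    { apply b2; rewrite <- comp_assoc, <- Hg, comp_assoc, Hu, !comp_zero_l; reflexivity. }
    destruct (tri_coker3 Ht (u := v ∘ fmap Sh a)) as [x Hx].
    { rewrite <- comp_assoc, Hh, comp_assoc, Hv; exact Hu. }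
    destruct (sb1 x) as [y Hy].
    assert (Hvy : v ≈ y ∘ fmap Sh f').
    { apply sa2; rewrite <- comp_assoc, <- HSf, comp_assoc, Hy, Hx; reflexivity. }
    rewrite <- Hv, Hvy, <- comp_assoc, (tri_zero3 Ht'); apply comp_zero_r. }
  split.
  - intro w.
    destruct (b1 (w ∘ g)) as [x Hx].
    destruct (tri_coker HT Ht' (u := x)) as [v Hv].
    { apply a2; rewrite <- comp_assoc, <- Hf, comp_assoc, Hx, <- comp_assoc, (tri_zero HT Ht).
      rewrite comp_zero_l, comp_zero_r; reflexivity. }
    destruct (tri_coker2 Ht (u := w - v ∘ d)) as [y Hy].
    { rewrite comp_sub_l, <- comp_assoc, Hg, comp_assoc, Hv, Hx; apply hadd_opp. }
    destruct (sa1 y) as [z Hz]; exists (v + z ∘ h').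
    rewrite comp_hadd_l, <- (comp_assoc z h'), <- Hh, comp_assoc, Hz, Hy; apply sub_add.
  - intros u u' H; apply sub_zero_eq, inj; rewrite comp_sub_l, H; apply hadd_opp.
Qed.

End FiveLemma.

Lemma cone_unique A B (f : Hom A B) D (g : Hom B D) (h : Hom D (Sh A))
    D' (g' : Hom B D') (h' : Hom D' (Sh A)) :
  tri f g h -> tri f g' h' -> isomorphic D D'.
Proof.
  intros H H'.
  destruct (tri_fill HT H H' (a := idm A) (b := idm B)) as (d & H1 & H2).
  { rewrite comp_idl, comp_idr; reflexivity. }
  exists d; apply (colocal_is_iso (P := fun _ => True)); [|exact I|exact I].
  intros U _; assert (H0 : idm B ∘ f ≈ f ∘ idm A) by (rewrite comp_idl, comp_idr; reflexivity).
  apply (five_lemma_cov H H' H0 H1 H2);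
    apply hom_bij_cov_iso; repeat apply fmap_is_iso; apply is_iso_id.
Qed.

Section ThickSubcategories.
Variable P : T -> Prop.
Hypothesis HP : thick (T := TT) P.

Lemma thick_middle_of_ends A B D (f : Hom A B) (g : Hom B D) (h : Hom D (Sh A)) :
  tri f g h -> P A -> P D -> P B.
Proof.
  intros H HA HD; apply (thick_unshift HP (A := B)).
  apply (thick_cone HP (tri_rot HT (tri_rot HT H)) HD), (thick_shift HP), HA.
Qed.

Lemma thick_first A B D (f : Hom A B) (g : Hom B D) (h : Hom D (Sh A)) :
  tri f g h -> P B -> P D -> P A.
Proof.
  intros H HB HD; apply (thick_unshift HP (A := A)).
  exact (thick_cone HP (tri_rot HT H) HB HD).
Qed.

(** A split monomorphism [s] has vanishing connecting map, so that the cone of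
    [s] is a complementary summand. *)
Lemma thick_retract A B : retract A B -> P B -> P A.
Proof.
  intros (s & r & Hrs); apply (thick_summand HP).
  destruct (tri_cone HT s) as (D & q & h & Ht); exists D, r, q.
  change (is_product (C := T) r q).
  assert (Hh : h ≈ hzero _ _).
  { rewrite <- (comp_idl h), <- fmap_id, <- Hrs, fmap_comp, <- comp_assoc, (tri_zero3 Ht).
    apply comp_zero_r. }
  intros U a b.
  destruct (tri_ker2 Ht (u := b)) as [b' Hb']; [rewrite Hh; apply comp_zero_l|].
  assert (Hr : r ∘ (b' + s ∘ (a - r ∘ b')) ≈ a).
  { rewrite comp_hadd_r, comp_assoc, Hrs, comp_idl; apply sub_add. }
  assert (Hq : q ∘ (b' + s ∘ (a - r ∘ b')) ≈ b).
  { rewrite comp_hadd_r, comp_assoc, (tri_zero HT Ht), comp_zero_l, hadd_zero; exact Hb'. }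
  exists (b' + s ∘ (a - r ∘ b')); split; [split; assumption|].
  intros v Hv1 Hv2; symmetry; apply sub_zero_eq.
  destruct (tri_ker HT Ht (u := v - (b' + s ∘ (a - r ∘ b')))) as [x Hx].
  { rewrite (comp_sub_r q v), Hv2, Hq; apply hadd_opp. }
  rewrite <- Hx; apply (transitivity (y := s ∘ (r ∘ (s ∘ x)))).
  - rewrite (comp_assoc r s), Hrs, comp_idl; reflexivity.
  - rewrite Hx, (comp_sub_r r v), Hv1, Hr, hadd_opp; apply comp_zero_r.
Qed.

Lemma thick_desuspension A : P A -> exists K, P K /\ isomorphic (Sh K) A.
Proof.
  intro HA; destruct (shift_surj HT A) as [K HK]; exists K; split; [|exact HK].
  exact (thick_unshift HP (thick_iso HP (isomorphic_sym HK) HA)).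
Qed.

Lemma hom_bij_cov_desuspend K U A B (f : Hom A B) :
  isomorphic (Sh K) U -> hom_bij_cov K f -> hom_bij_cov U (fmap Sh f).
Proof.
  intros (k & k' & Hk1 & Hk2) [H1 H2]; destruct (shift_ff HT) as [Fu Fa]; split.
  - intro v; destruct (Fu _ _ (v ∘ k)) as [v' Hv']; destruct (H1 v') as [u Hu].
    exists (fmap Sh u ∘ k'); rewrite comp_assoc, <- fmap_comp, Hu, Hv', <- comp_assoc, Hk2.
    apply comp_idr.
  - intros u u' H.
    destruct (Fu _ _ (u ∘ k)) as [v Hv]; destruct (Fu _ _ (u' ∘ k)) as [v' Hv'].
    apply (iso_cancel_r (f := k)); [exists k'; split; assumption|].
    rewrite <- Hv, <- Hv'; apply fmap_heq, H2, Fa.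
    rewrite !fmap_comp, Hv, Hv', !comp_assoc, H; reflexivity.
Qed.

Lemma hom_bij_contra_desuspend K U A B (f : Hom A B) :
  isomorphic (Sh K) U -> hom_bij_contra f K -> hom_bij_contra (fmap Sh f) U.
Proof.
  intros (k & k' & Hk1 & Hk2) [H1 H2]; destruct (shift_ff HT) as [Fu Fa]; split.
  - intro v; destruct (Fu _ _ (k' ∘ v)) as [v' Hv']; destruct (H1 v') as [u Hu].
    exists (k ∘ fmap Sh u); rewrite <- comp_assoc, <- fmap_comp, Hu, Hv', comp_assoc, Hk2.
    apply comp_idl.
  - intros u u' H.
    destruct (Fu _ _ (k' ∘ u)) as [v Hv]; destruct (Fu _ _ (k' ∘ u')) as [v' Hv'].
    apply (iso_cancel_l (f := k')); [exists k; split; assumption|].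
    rewrite <- Hv, <- Hv'; apply fmap_heq, H2, Fa.
    rewrite !fmap_comp, Hv, Hv', <- !comp_assoc, H; reflexivity.
Qed.

(** Every object of [P] is the suspension of an object of [P], so testing the suspended map on
    [P] amounts to testing [f] on [P]. *)
Lemma colocal_shift A B (f : Hom A B) : colocal P f -> colocal P (fmap Sh f).
Proof.
  intros H U HU; destruct (thick_desuspension HU) as (K & HK & Hiso).
  exact (hom_bij_cov_desuspend Hiso (H K HK)).
Qed.

Lemma local_shift A B (f : Hom A B) : local P f -> local P (fmap Sh f).
Proof.
  intros H U HU; destruct (thick_desuspension HU) as (K & HK & Hiso).
  exact (hom_bij_contra_desuspend Hiso (H K HK)).
Qed.

(** The shift is fully faithful, so it can be moved to the test objects, and [P] is closed
    under the shift and its inverse. *)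
Lemma orthogonal_shift B :
  (forall U, P U -> hom_zero U B) <-> (forall U, P U -> hom_zero U (Sh B)).
Proof.
  destruct (shift_ff HT) as [Fu Fa]; split; intros H U HU.
  - destruct (thick_desuspension HU) as (K & HK & k & k' & Hk1 & Hk2).
    intros f f'; destruct (Fu _ _ (f ∘ k)) as [v Hv]; destruct (Fu _ _ (f' ∘ k)) as [v' Hv'].
    apply (iso_cancel_r (f := k)); [exists k'; split; assumption|].
    rewrite <- Hv, <- Hv'; apply fmap_heq, (H K HK).
  - intros f f'; apply Fa, (H (Sh U)), (thick_shift HP), HU.
Qed.

Lemma thick_orthogonal : thick (T := TT) (fun B => forall U, P U -> hom_zero U B).
Proof.
  split; cbn.
  - intros A B (f & g & H1 & H2) H U HU u u'.
    rewrite <- (comp_idl u), <- (comp_idl u'), <- H2, <- !comp_assoc.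
    rewrite (H U HU (g ∘ u) (g ∘ u')); reflexivity.
  - intros A HA U HU u u'; rewrite (zero_object_hom_r u HA), (zero_object_hom_r u' HA).
    reflexivity.
  - intro A; exact (proj1 (orthogonal_shift A)).
  - intro A; exact (proj2 (orthogonal_shift A)).
  - intros A B D f g h Ht HA HB U HU; apply hom_zero_iff; intro u.
    destruct (tri_ker2 Ht (u := u)) as [v Hv].
    { exact (proj1 (orthogonal_shift A) HA U HU _ _). }
    rewrite <- Hv, (HB U HU v (hzero _ _)); apply comp_zero_r.
  - intros A B (A' & p & q & Hp) H U HU u u'.
    destruct (Hp U u (hzero _ _)) as (v & [Hv _] & _).
    destruct (Hp U u' (hzero _ _)) as (v' & [Hv' _] & _).
    rewrite <- Hv, <- Hv', (H U HU v v'); reflexivity.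
Qed.

End ThickSubcategories.

Section TorsionPair.
Variables X Y : T -> Prop.
Hypotheses (HX : thick (T := TT) X) (HY : thick (T := TT) Y).

(** In the long exact sequence of Hom(U, -), with [U] in [X], both neighbours of the map
    induced by [f] vanish: Hom(U, D) and, after one suspension, Hom(U, D) for the
    suspension of [U]. *)
Lemma colocal_of_cone A B D (f : Hom A B) (g : Hom B D) (h : Hom D (Sh A)) :
  (forall U V, X U -> Y V -> hom_zero U V) -> tri f g h -> Y D -> colocal X f.
Proof.
  intros HXY Ht HD U HU; split.
  - intro v; exact (tri_ker HT Ht (HXY U D HU HD _ _)).
  - intros u u' H; apply sub_zero_eq, shift_faithful_zero.
    destruct (tri_ker3 Ht (u := fmap Sh (u' - u))) as [v Hv].
    { rewrite <- fmap_comp, comp_sub_r, H, hadd_opp; apply (shift_zero HT). }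
    rewrite <- Hv, (HXY (Sh U) D (thick_shift HX HU) HD v (hzero _ _)); apply comp_zero_r.
Qed.

Lemma local_of_cone A B D (f : Hom A B) (g : Hom B D) (h : Hom D (Sh A)) :
  (forall U V, X U -> Y V -> hom_zero U V) -> tri f g h -> X D -> local Y f.
Proof.
  intros HXY Ht HD U HU; destruct (shift_ff HT) as [Fu Fa]; split.
  - intro v.
    destruct (tri_coker3 Ht (u := fmap Sh v)) as [w Hw].
    { exact (HXY D (Sh U) HD (thick_shift HY HU) _ _). }
    destruct (Fu _ _ w) as [u Hu]; exists u; apply Fa; rewrite fmap_comp, Hu; exact Hw.
  - intros u u' H; apply sub_zero_eq.
    destruct (tri_coker HT Ht (u := u' - u)) as [v Hv].
    { rewrite comp_sub_l, H; apply hadd_opp. }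
    rewrite <- Hv, (HXY D U HD HU v (hzero _ _)); apply comp_zero_l.
Qed.

Hypothesis HXY : torsion_pair (T := TT) X Y.

Lemma torsion_pair_left A : X A <-> forall B, Y B -> hom_zero A B.
Proof.
  split; [intros HA B HB; exact (tp_hom HXY HA HB)|intro H].
  destruct (tp_triangle HXY A) as (U & V & f & g & h & HU & HV & Ht).
  destruct (tri_ker HT Ht (u := idm A)) as [s Hs]; [apply (H V HV)|].
  apply (thick_retract HX (B := U)); [exists s, f; exact Hs|exact HU].
Qed.

Lemma torsion_pair_right B : Y B <-> forall A, X A -> hom_zero A B.
Proof.
  split; [intros HB A HA; exact (tp_hom HXY HA HB)|intro H].
  destruct (tp_triangle HXY B) as (U & V & f & g & h & HU & HV & Ht).
  destruct (tri_coker HT Ht (u := idm B)) as [r Hr]; [apply (H U HU)|].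
  apply (thick_retract HY (B := V)); [exists g, r; exact Hr|exact HV].
Qed.

End TorsionPair.

(** Coreflections onto a thick subcategory [P] are triangle functors: a triangle on
    the coreflected map lies in [P], it maps to the given triangle, and by the
    five lemma its third map is again a coreflection. *)
Section Coreflection.
Variables (P : T -> Prop) (F : Functor T T) (eps : forall A, Hom (F A) A).
Hypotheses (HP : thick (T := TT) P).
Hypothesis eps_natural : natural (F := F) (G := fid T) eps.
Hypotheses (FP : forall A, P (F A)) (eps_colocal : forall A, colocal P (eps A)).

Let nat_eps A B (f : Hom A B) : eps B ∘ fmap F f ≈ f ∘ eps A.
Proof. exact (eps_natural f). Qed.

Lemma coreflection_shift : exists psi : NatIso (F ∘F Sh) (Sh ∘F F),
  forall A, fmap Sh (eps A) ∘ psi A ≈ eps (Sh A).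
Proof.
  assert (co : forall A, colocal P (fmap Sh (eps A))).
  { intro A; apply (colocal_shift HP), eps_colocal. }
  pose (t := fun A => constructive_indefinite_description _
               (proj1 (co A (F (Sh A)) (FP _)) (eps (Sh A)))).
  assert (Ht : forall A, fmap Sh (eps A) ∘ proj1_sig (t A) ≈ eps (Sh A)).
  { intro A; exact (proj2_sig (t A)). }
  unshelve eexists (@Build_NatIso _ _ (F ∘F Sh) (Sh ∘F F) (fun A => proj1_sig (t A)) _ _).
  - intros A B f; cbn.
    apply (proj2 (co B (F (Sh A)) (FP _))).
    rewrite !comp_assoc, Ht, <- fmap_comp, !nat_eps, fmap_comp, <- comp_assoc, Ht.
    reflexivity.
  - intro A; apply (colocal_is_iso (P := P)); [|apply FP|apply (thick_shift HP), FP].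
    intros U HU; apply (hom_bij_cov_cancel (co A U HU)).
    apply (hom_bij_cov_heq (f := eps (Sh A))); [symmetry; apply Ht|exact (eps_colocal _ HU)].
  - exact Ht.
Qed.

Lemma coreflection_triangle (psi : forall A, Hom (F (Sh A)) (Sh (F A))) :
  (forall A, fmap Sh (eps A) ∘ psi A ≈ eps (Sh A)) ->
  forall A B D (f : Hom A B) (g : Hom B D) (h : Hom D (Sh A)),
  tri f g h -> tri (fmap F f) (fmap F g) (psi A ∘ fmap F h).
Proof.
  intros Hpsi A B D f g h Ht.
  destruct (tri_cone HT (fmap F f)) as (D' & g' & h' & Ht').
  destruct (tri_fill HT Ht' Ht (nat_eps f)) as (e & He1 & He2).
  assert (HD' : P D') by exact (thick_cone HP Ht' (FP A) (FP B)).
  assert (co : colocal P e).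
  { intros U HU; apply (five_lemma_cov Ht' Ht (nat_eps f) He1 He2);
      first [exact (eps_colocal _ HU) | apply (colocal_shift HP (eps_colocal _)), HU]. }
  destruct (proj1 (co _ (FP D)) (eps D)) as [d Hd].
  assert (Id : is_iso d).
  { apply (colocal_is_iso (P := P)); [|apply FP|exact HD'].
    intros U HU; apply (hom_bij_cov_cancel (co U HU)).
    apply (hom_bij_cov_heq (f := eps D)); [symmetry; exact Hd|exact (eps_colocal _ HU)]. }
  apply (tri_iso HT (a := idm _) (b := idm _) (d := d) (is_iso_id _) (is_iso_id _) Id)
    with (4 := Ht').
  - rewrite comp_idl, comp_idr; reflexivity.
  - rewrite comp_idr; apply (proj2 (co _ (FP B))).
    rewrite comp_assoc, Hd, nat_eps, He1; reflexivity.
  - rewrite fmap_id, comp_idl.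
    apply (proj2 (colocal_shift HP (eps_colocal A) (FP D))).
    rewrite comp_assoc, Hpsi, nat_eps, comp_assoc, He2, <- comp_assoc, Hd; reflexivity.
Qed.

End Coreflection.

Section Reflection.
Variables (P : T -> Prop) (F : Functor T T) (eta : forall A, Hom A (F A)).
Hypotheses (HP : thick (T := TT) P).
Hypothesis eta_natural : natural (F := fid T) (G := F) eta.
Hypotheses (FP : forall A, P (F A)) (eta_local : forall A, local P (eta A)).

Let nat_eta A B (f : Hom A B) : eta B ∘ f ≈ fmap F f ∘ eta A.
Proof. exact (eta_natural f). Qed.

Let P_shift A : P A -> P (Sh A).
Proof. exact (thick_shift HP (A := A)). Qed.

Lemma reflection_shift : exists psi : NatIso (F ∘F Sh) (Sh ∘F F),
  forall A, psi A ∘ eta (Sh A) ≈ fmap Sh (eta A).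
Proof.
  pose (t := fun A => constructive_indefinite_description _
               (proj1 (eta_local (Sh A) (P_shift (FP A))) (fmap Sh (eta A)))).
  assert (Ht : forall A, proj1_sig (t A) ∘ eta (Sh A) ≈ fmap Sh (eta A)).
  { intro A; exact (proj2_sig (t A)). }
  unshelve eexists (@Build_NatIso _ _ (F ∘F Sh) (Sh ∘F F) (fun A => proj1_sig (t A)) _ _).
  - intros A B f; cbn.
    apply (proj2 (eta_local (Sh A) (P_shift (FP B)))).
    rewrite <- !comp_assoc, Ht, <- nat_eta, comp_assoc, Ht, <- !fmap_comp, nat_eta.
    reflexivity.
  - intro A; apply (local_is_iso (P := P)); [|apply FP|apply (thick_shift HP), FP].
    intros U HU; apply (hom_bij_contra_cancel (eta_local (Sh A) HU)).
    apply (hom_bij_contra_heq (f := fmap Sh (eta A))); [symmetry; apply Ht|].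
    apply (local_shift HP (eta_local A)), HU.
  - exact Ht.
Qed.

Lemma reflection_triangle (psi : forall A, Hom (F (Sh A)) (Sh (F A))) :
  (forall A, psi A ∘ eta (Sh A) ≈ fmap Sh (eta A)) ->
  forall A B D (f : Hom A B) (g : Hom B D) (h : Hom D (Sh A)),
  tri f g h -> tri (fmap F f) (fmap F g) (psi A ∘ fmap F h).
Proof.
  intros Hpsi A B D f g h Ht.
  destruct (tri_cone HT (fmap F f)) as (D' & g' & h' & Ht').
  destruct (tri_fill HT Ht Ht' (nat_eta f)) as (e & He1 & He2).
  assert (HD' : P D') by exact (thick_cone HP Ht' (FP A) (FP B)).
  assert (lo : local P e).
  { intros U HU; apply (five_lemma_contra Ht Ht' (nat_eta f) He1 He2);
      first [exact (eta_local _ HU) | apply (local_shift HP (eta_local _)), HU]. }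
  destruct (proj1 (eta_local D HD') e) as [d Hd].
  assert (Id : is_iso d).
  { apply (local_is_iso (P := P)); [|apply FP|exact HD'].
    intros U HU; apply (hom_bij_contra_cancel (eta_local D HU)).
    apply (hom_bij_contra_heq (f := e)); [symmetry; exact Hd|exact (lo U HU)]. }
  apply (tri_iso HT (a := idm _) (b := idm _) (d := d) (is_iso_id _) (is_iso_id _) Id)
    with (4 := Ht').
  - rewrite comp_idl, comp_idr; reflexivity.
  - rewrite comp_idr; apply (proj2 (eta_local B HD')).
    rewrite <- comp_assoc, <- nat_eta, comp_assoc, Hd, He1; reflexivity.
  - rewrite fmap_id, comp_idl.
    apply (proj2 (eta_local D (P_shift (FP A)))).
    rewrite <- !comp_assoc, <- nat_eta, comp_assoc, Hpsi, He2, Hd; reflexivity.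
Qed.

End Reflection.

End Triangulated.

(** * Short exact sequences *)

Section ShortExact.
Variable E : ExactCategory.
Implicit Types A B D U : E.

Lemma ses_zero A B D (i : Hom A B) (p : Hom B D) : ses i p -> p ∘ i ≈ hzero A D.
Proof. intro H; apply (ses_kernel H). Qed.

Lemma ses_mono A B D (i : Hom A B) (p : Hom B D) U (u v : Hom U A) :
  ses i p -> i ∘ u ≈ i ∘ v -> u ≈ v.
Proof.
  intros H Huv; destruct (ses_kernel H) as [Hz HU].
  destruct (HU U (i ∘ v)) as (x & _ & Hx).
  { rewrite comp_assoc, Hz; apply comp_zero_l. }
  rewrite (Hx u Huv), (Hx v); reflexivity.
Qed.

Lemma ses_epi A B D (i : Hom A B) (p : Hom B D) U (u v : Hom D U) :
  ses i p -> u ∘ p ≈ v ∘ p -> u ≈ v.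
Proof.
  intros H Huv; destruct (ses_cokernel H) as [Hz HU].
  destruct (HU U (v ∘ p)) as (x & _ & Hx).
  { rewrite <- comp_assoc, Hz; apply comp_zero_r. }
  rewrite (Hx u Huv), (Hx v); reflexivity.
Qed.

Lemma ses_lift A B D (i : Hom A B) (p : Hom B D) U (t : Hom U B) :
  ses i p -> p ∘ t ≈ hzero U D -> exists u : Hom U A, i ∘ u ≈ t.
Proof.
  intros H Ht; destruct (proj2 (ses_kernel H) U t Ht) as (u & Hu & _); exists u; exact Hu.
Qed.

Lemma ses_desc A B D (i : Hom A B) (p : Hom B D) U (t : Hom B U) :
  ses i p -> t ∘ i ≈ hzero A U -> exists u : Hom D U, u ∘ p ≈ t.
Proof.
  intros H Ht; destruct (proj2 (ses_cokernel H) U t Ht) as (u & Hu & _); exists u; exact Hu.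
Qed.

Lemma ses_adm_mono A B D (i : Hom A B) (p : Hom B D) : ses i p -> adm_mono (@ses E) i.
Proof. intro H; exists D, p; exact H. Qed.

Lemma ses_adm_epi A B D (i : Hom A B) (p : Hom B D) : ses i p -> adm_epi (@ses E) p.
Proof. intro H; exists A, i; exact H. Qed.

Lemma pushout_ext A B A' B' (i : Hom A B) (f : Hom A A') (g : Hom B B') (j : Hom A' B')
    U (u v : Hom B' U) :
  is_pushout i f g j -> u ∘ g ≈ v ∘ g -> u ∘ j ≈ v ∘ j -> u ≈ v.
Proof.
  intros [H HU] H1 H2; destruct (HU U (v ∘ g) (v ∘ j)) as (x & _ & Hx).
  { rewrite <- !comp_assoc, H; reflexivity. }
  rewrite (Hx u H1 H2), (Hx v); reflexivity.
Qed.

Lemma pullback_ext B D B' D' (p : Hom B D) (f : Hom D' D) (g : Hom B' B) (q : Hom B' D')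
    U (u v : Hom U B') :
  is_pullback p f g q -> g ∘ u ≈ g ∘ v -> q ∘ u ≈ q ∘ v -> u ≈ v.
Proof.
  intros [H HU] H1 H2; destruct (HU U (g ∘ v) (q ∘ v)) as (x & _ & Hx).
  { rewrite !comp_assoc, H; reflexivity. }
  rewrite (Hx u H1 H2), (Hx v); reflexivity.
Qed.

Lemma is_pushout_sym A B A' B' (i : Hom A B) (f : Hom A A') (g : Hom B B') (j : Hom A' B') :
  is_pushout i f g j -> is_pushout f i j g.
Proof.
  intros [H HU]; split; [symmetry; exact H|].
  intros U b a Hba; destruct (HU U a b) as (u & [H1 H2] & Hu); [symmetry; exact Hba|].
  exists u; split; [split; assumption|intros v H3 H4; apply Hu; assumption].
Qed.

Lemma pushout_ses A B D A' B' (i : Hom A B) (p : Hom B D) (f : Hom A A')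
    (g : Hom B B') (j : Hom A' B') :
  ses i p -> is_pushout i f g j -> exists q : Hom B' D, ses j q /\ q ∘ g ≈ p.
Proof.
  intros Hs HP; pose proof HP as [Hsq HU].
  destruct (HU D p (hzero _ _)) as (q & [Hqg Hqj] & _).
  { rewrite (ses_zero Hs); symmetry; apply comp_zero_l. }
  exists q; split; [|exact Hqg].
  destruct (pushout_adm_mono f (ses_adm_mono Hs)) as (B2 & g2 & j2 & HP2 & (D2 & q2 & Hs2)).
  pose proof HP2 as [Hsq2 HU2].
  destruct (HU B2 g2 j2 Hsq2) as (u & [Hug Huj] & _).
  destruct (HU2 B' g j Hsq) as (u' & [Hug' Huj'] & _).
  assert (Hu : is_iso u').
  { exists u; split.
    - apply (pushout_ext HP2); rewrite <- comp_assoc, comp_idl.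
      + rewrite Hug'; exact Hug.
      + rewrite Huj'; exact Huj.
    - apply (pushout_ext HP); rewrite <- comp_assoc, comp_idl.
      + rewrite Hug; exact Hug'.
      + rewrite Huj; exact Huj'. }
  destruct (ses_desc (t := q ∘ u') Hs2) as [c Hc].
  { rewrite <- comp_assoc, Huj'; exact Hqj. }
  destruct (ses_desc (t := q2 ∘ g2) Hs) as [c' Hc'].
  { rewrite <- comp_assoc, Hsq2, comp_assoc, (ses_zero Hs2); apply comp_zero_l. }
  apply (ses_iso (a := idm A') (b := u') (c := c) (is_iso_id _) Hu) with (4 := Hs2).
  - exists c'; split.
    + apply (ses_epi Hs2); rewrite <- comp_assoc, Hc, comp_idl.
      apply (pushout_ext HP2).
      * rewrite <- !comp_assoc, Hug', Hqg; exact Hc'.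
      * rewrite <- !comp_assoc, Huj', Hqj, (ses_zero Hs2); apply comp_zero_r.
    + apply (ses_epi Hs); rewrite <- comp_assoc, Hc', comp_assoc, Hc, <- comp_assoc, Hug'.
      rewrite comp_idl; exact Hqg.
  - rewrite comp_idr; exact Huj'.
  - exact Hc.
Qed.

Lemma pullback_ses A B D B' D' (i : Hom A B) (p : Hom B D) (f : Hom D' D)
    (g : Hom B' B) (q : Hom B' D') :
  ses i p -> is_pullback p f g q -> exists k : Hom A B', ses k q /\ g ∘ k ≈ i.
Proof.
  intros Hs HP; pose proof HP as [Hsq HU].
  destruct (HU A i (hzero _ _)) as (k & [Hgk Hqk] & _).
  { rewrite (ses_zero Hs); symmetry; apply comp_zero_r. }
  exists k; split; [|exact Hgk].
  destruct (pullback_adm_epi f (ses_adm_epi Hs)) as (B2 & g2 & q2 & HP2 & (A2 & k2 & Hs2)).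
  pose proof HP2 as [Hsq2 HU2].
  destruct (HU B2 g2 q2 Hsq2) as (u & [Hgu Hqu] & _).
  destruct (HU2 B' g q Hsq) as (u' & [Hgu' Hqu'] & _).
  assert (Hu : is_iso u).
  { exists u'; split.
    - apply (pullback_ext HP2); rewrite comp_assoc, comp_idr.
      + rewrite Hgu'; exact Hgu.
      + rewrite Hqu'; exact Hqu.
    - apply (pullback_ext HP); rewrite comp_assoc, comp_idr.
      + rewrite Hgu; exact Hgu'.
      + rewrite Hqu; exact Hqu'. }
  destruct (ses_lift (t := u' ∘ k) Hs2) as [c Hc].
  { rewrite comp_assoc, Hqu'; exact Hqk. }
  destruct (ses_lift (t := g2 ∘ k2) Hs) as [c' Hc'].
  { rewrite comp_assoc, Hsq2, <- comp_assoc, (ses_zero Hs2); apply comp_zero_r. }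
  assert (Hck : k ∘ c' ≈ u ∘ k2).
  { apply (pullback_ext HP).
    - rewrite !comp_assoc, Hgk, Hgu; exact Hc'.
    - rewrite !comp_assoc, Hqk, Hqu, (ses_zero Hs2); apply comp_zero_l. }
  apply (ses_iso (a := c') (b := u) (c := idm D')) with (6 := Hs2);
    [|exact Hu|apply is_iso_id|symmetry; exact Hck|].
  - exists c; split.
    + apply (ses_mono Hs2); rewrite comp_assoc, Hc, comp_idr, <- comp_assoc, Hck.
      apply (iso_cancel_l Hu); destruct Hu as (v & Hvu & Huv).
      apply (pullback_ext HP).
      * rewrite !comp_assoc, Hgu, Hgu', Hgu; reflexivity.
      * rewrite !comp_assoc, Hqu, Hqu', Hqu; reflexivity.
    + apply (ses_mono Hs); rewrite comp_assoc, Hc', <- comp_assoc, Hc, comp_assoc, Hgu'.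
      rewrite comp_idr; exact Hgk.
  - rewrite comp_idl; symmetry; exact Hqu.
Qed.

(** As [D] is an extension of [C] by [B], the pullback of [I -> C <- D] is the biproduct
    [B + I]; so this sequence is, up to sign, the pullback of [A -> I -> C] along
    [D -> C]. *)
Lemma pushout_cone_ses A I C B D (i : Hom A I) (p : Hom I C) (f : Hom A B)
    (w : Hom I D) (g : Hom B D) (M : E)
    (iB : Hom B M) (iI : Hom I M) (pB : Hom M B) (pI : Hom M I) :
  ses i p -> is_pushout i f w g ->
  pB ∘ iB ≈ idm B -> pI ∘ iI ≈ idm I -> pB ∘ iI ≈ hzero I B -> pI ∘ iB ≈ hzero B I ->
  iB ∘ pB + iI ∘ pI ≈ idm M ->
  ses (iB ∘ f - iI ∘ i) (g ∘ pB + w ∘ pI).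
Proof.
  intros Hs HP BB II BI IB sum.
  destruct (pushout_ses Hs HP) as (q & Hq & Hqw).
  assert (Hpb : is_pullback p q pI (g ∘ pB + w ∘ pI)).
  { split.
    - rewrite comp_hadd_r, !comp_assoc, (ses_zero Hq), Hqw, comp_zero_l, zero_hadd; reflexivity.
    - intros U c d Hcd.
      destruct (ses_lift (t := d - w ∘ c) Hq) as [b Hb].
      { rewrite comp_sub_r, comp_assoc, Hqw, Hcd; apply hadd_opp. }
      exists (iB ∘ b + iI ∘ c); split; [split|].
      + rewrite comp_hadd_r, !comp_assoc, IB, II, comp_zero_l, zero_hadd; apply comp_idl.
      + rewrite comp_hadd_l, !comp_hadd_r, <- !comp_assoc, (comp_assoc pB), (comp_assoc pB).
        rewrite (comp_assoc pI), (comp_assoc pI), BB, II, BI, IB, !comp_zero_l, !comp_zero_r.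
        rewrite !comp_idl, hadd_zero, zero_hadd, Hb, hadd_comm; apply sub_add.
      + intros v Hv1 Hv2.
        rewrite <- (comp_idl v), <- sum, comp_hadd_l, <- !comp_assoc, Hv1.
        assert (Hvb : pB ∘ v ≈ b).
        { apply (ses_mono Hq); rewrite Hb, <- Hv2, comp_hadd_l, <- !comp_assoc, Hv1.
          rewrite <- hadd_assoc, hadd_opp, hadd_zero; reflexivity. }
        rewrite Hvb; reflexivity. }
  destruct (pullback_ses Hs Hpb) as (k & Hk & HIk).
  assert (HBk : pB ∘ k ≈ - f).
  { apply (ses_mono Hq), (hadd_cancel_r (h := w ∘ i)).
    rewrite comp_opp_r, (proj1 HP), (hadd_comm (- _)), hadd_opp, <- (ses_zero Hk).
    rewrite comp_hadd_l, <- !comp_assoc, HIk, (proj1 HP); reflexivity. }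
  apply (ses_iso (a := - idm A) (b := idm M) (c := idm D)) with (6 := Hk);
    try apply is_iso_id.
  - exists (- idm A); split; rewrite comp_opp_l, comp_opp_r, comp_idl; apply hopp_hopp.
  - rewrite comp_idl, comp_opp_r, comp_idr, hopp_sub.
    rewrite <- (comp_idl k), <- sum, comp_hadd_l, <- !comp_assoc, HIk, HBk, comp_opp_r.
    apply hadd_comm.
  - rewrite comp_idl, comp_idr; reflexivity.
Qed.

End ShortExact.

(** * The stable category of a Frobenius category *)

Section StableMaps.
Variable E : ExactCategory.
Implicit Types A B D U : E.

Definition null A B (f : Hom A B) : Prop :=
  exists (P : E) (h : Hom A P) (k : Hom P B), projinj P /\ f ≈ k ∘ h.

Lemma null_heq A B (f g : Hom A B) : f ≈ g -> null f -> null g.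
Proof. intros H (P & h & k & HP & Hf); exists P, h, k; split; [exact HP|rewrite <- H; exact Hf]. Qed.

Lemma null_through A B (P : E) (h : Hom A P) (k : Hom P B) : projinj P -> null (k ∘ h).
Proof. intro HP; exists P, h, k; split; [exact HP|reflexivity]. Qed.

Lemma null_comp_l A B D (g : Hom B D) (f : Hom A B) : null f -> null (g ∘ f).
Proof.
  intros (P & h & k & HP & Hf); exists P, h, (g ∘ k); split; [exact HP|].
  rewrite Hf, comp_assoc; reflexivity.
Qed.

Lemma null_iff A B (f : Hom A B) : stable_eq f (hzero A B) <-> null f.
Proof.
  split; intros (P & h & k & HP & H); exists P, h, (- k); (split; [exact HP|]).
  - rewrite comp_opp_l, <- H, hopp_sub; symmetry; apply sub_zero_r.
  - rewrite zero_hadd, H, comp_opp_l; reflexivity.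
Qed.

Lemma null_extend A B D (i : Hom A B) (p : Hom B D) U (f : Hom A U) :
  ses i p -> null f -> exists f' : Hom B U, f' ∘ i ≈ f /\ null f'.
Proof.
  intros Hs (P & h & k & HP & Hf).
  destruct (proj2 HP _ _ i (ses_adm_mono Hs) h) as [h' Hh'].
  exists (k ∘ h'); split; [|apply null_through, HP].
  rewrite <- comp_assoc, Hh', Hf; reflexivity.
Qed.

Lemma null_lift A B D (i : Hom A B) (p : Hom B D) U (f : Hom U D) :
  ses i p -> null f -> exists f' : Hom U B, p ∘ f' ≈ f /\ null f'.
Proof.
  intros Hs (P & h & k & HP & Hf).
  destruct (proj1 HP _ _ p (ses_adm_epi Hs) k) as [k' Hk'].
  exists (k' ∘ h); split; [|apply null_through, HP].
  rewrite comp_assoc, Hk', Hf; reflexivity.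
Qed.

Lemma ses_weak_kernel A B D (i : Hom A B) (p : Hom B D) U (u : Hom U B) :
  ses i p -> null (p ∘ u) -> exists v : Hom U A, stable_eq (i ∘ v) u.
Proof.
  intros Hs Hu; destruct (null_lift Hs Hu) as (t & Ht & Hn).
  destruct (ses_lift (t := u - t) Hs) as [v Hv].
  { rewrite comp_sub_r, Ht; apply hadd_opp. }
  exists v; apply (null_heq (f := t)); [|exact Hn].
  rewrite Hv, hopp_sub; symmetry; apply sub_add.
Qed.

Lemma ses_weak_cokernel A B D (i : Hom A B) (p : Hom B D) U (u : Hom B U) :
  ses i p -> null (u ∘ i) -> exists v : Hom D U, stable_eq (v ∘ p) u.
Proof.
  intros Hs Hu; destruct (null_extend Hs Hu) as (t & Ht & Hn).
  destruct (ses_desc (t := u - t) Hs) as [v Hv].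
  { rewrite comp_sub_l, Ht; apply hadd_opp. }
  exists v; apply (null_heq (f := t)); [|exact Hn].
  rewrite Hv, hopp_sub; symmetry; apply sub_add.
Qed.

Definition stable_additive : AdditiveCategory.
Proof.
  refine (@Build_AdditiveCategory (stable E) (fun A B => @hzero E A B)
            (fun A B f g => @hadd E A B f g) (fun A B f => @hopp E A B f)
            _ _ _ _ _ _ _ _ _ _).
  - intros A B f f' g g' (P & h & k & HP & H) (P' & h' & k' & HP' & H').
    destruct (@stable_equivalence E A B) as [_ _ tr].
    apply (tr _ (@hadd E A B f' g)).
    + exists P, h, k; split; [exact HP|].
      rewrite <- H; apply (hadd_cancel_r (h := @hadd E A B f g)).
      rewrite <- hadd_assoc, (hadd_comm (- _)), hadd_opp, hadd_zero, hadd_assoc.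
      rewrite (hadd_comm (f' - f)), sub_add; reflexivity.
    + exists P', h', k'; split; [exact HP'|].
      rewrite <- H'; apply (hadd_cancel_r (h := @hadd E A B f' g)).
      rewrite <- hadd_assoc, (hadd_comm (- _)), hadd_opp, hadd_zero.
      rewrite (hadd_comm (g' - g)), <- hadd_assoc, sub_add; reflexivity.
  - intros A B f f' (P & h & k & HP & H); exists P, h, (- k); split; [exact HP|].
    rewrite comp_opp_l, <- H, hopp_sub, hopp_hopp; apply hadd_comm.
  - intros; apply heq_stable, hadd_assoc.
  - intros; apply heq_stable, hadd_comm.
  - intros; apply heq_stable, hadd_zero.
  - intros; apply heq_stable, hadd_opp.
  - intros; apply heq_stable, comp_hadd_l.
  - intros; apply heq_stable, comp_hadd_r.
  - destruct (zero_exists E) as [O HO]; exists O; apply projinj_stable_zero, zero_projinj, HO.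
  - intros A B; destruct (@biproduct_exists E A B) as (M & i & j & p & q & H1 & H2 & H3 & H4 & H5).
    exists M, i, j, p, q; repeat split; apply heq_stable; assumption.
Defined.

End StableMaps.

(** The triangle axioms only have to be verified on standard triangles. *)
Section IsoClosure.
Variables (T : AdditiveCategory) (Sh : Functor T T).
Variable std : forall A B D : T, Hom A B -> Hom B D -> Hom D (Sh A) -> Prop.

Definition iso_closure (A B D : T) (f : Hom A B) (g : Hom B D) (h : Hom D (Sh A)) : Prop :=
  exists (A' B' D' : T) (f' : Hom A' B') (g' : Hom B' D') (h' : Hom D' (Sh A'))
         (a : Hom A A') (b : Hom B B') (d : Hom D D'),
    std f' g' h' /\ is_iso a /\ is_iso b /\ is_iso d /\
    b ∘ f ≈ f' ∘ a /\ d ∘ g ≈ g' ∘ b /\ fmap Sh a ∘ h ≈ h' ∘ d.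

Lemma iso_closure_iso A B D A' B' D' (f : Hom A B) (g : Hom B D) (h : Hom D (Sh A))
    (f' : Hom A' B') (g' : Hom B' D') (h' : Hom D' (Sh A'))
    (a : Hom A A') (b : Hom B B') (d : Hom D D') :
  is_iso a -> is_iso b -> is_iso d ->
  b ∘ f ≈ f' ∘ a -> d ∘ g ≈ g' ∘ b -> fmap Sh a ∘ h ≈ h' ∘ d ->
  iso_closure f' g' h' -> iso_closure f g h.
Proof.
  intros Ia Ib Id H1 H2 H3
    (A2 & B2 & D2 & f2 & g2 & h2 & a2 & b2 & d2 & Hs & Ja & Jb & Jd & K1 & K2 & K3).
  exists A2, B2, D2, f2, g2, h2, (a2 ∘ a), (b2 ∘ b), (d2 ∘ d).
  split; [exact Hs|]; repeat (split; [now apply is_iso_comp|]); repeat split.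
  - rewrite <- comp_assoc, H1, comp_assoc, K1, comp_assoc; reflexivity.
  - rewrite <- comp_assoc, H2, comp_assoc, K2, comp_assoc; reflexivity.
  - rewrite fmap_comp, <- comp_assoc, H3, comp_assoc, K3, comp_assoc; reflexivity.
Qed.

Lemma iso_closure_std A B D (f : Hom A B) (g : Hom B D) (h : Hom D (Sh A)) :
  std f g h -> iso_closure f g h.
Proof.
  intro H; exists A, B, D, f, g, h, (idm A), (idm B), (idm D).
  repeat split; try apply is_iso_id; try exact H;
    rewrite ?fmap_id, comp_idl, comp_idr; reflexivity.
Qed.

Hypothesis std_cone : forall A B (f : Hom A B), exists D (g : Hom B D) (h : Hom D (Sh A)),
  std f g h.
Hypothesis std_rot : forall A B D (f : Hom A B) (g : Hom B D) (h : Hom D (Sh A)),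
  std f g h -> iso_closure g h (- fmap Sh f).
Hypothesis std_fill : forall A B D A' B' D' (f : Hom A B) (g : Hom B D) (h : Hom D (Sh A))
  (f' : Hom A' B') (g' : Hom B' D') (h' : Hom D' (Sh A')) (a : Hom A A') (b : Hom B B'),
  std f g h -> std f' g' h' -> b ∘ f ≈ f' ∘ a ->
  exists d : Hom D D', d ∘ g ≈ g' ∘ b /\ fmap Sh a ∘ h ≈ h' ∘ d.
Hypothesis std_zero : forall A B D (f : Hom A B) (g : Hom B D) (h : Hom D (Sh A)),
  std f g h -> g ∘ f ≈ hzero A D.
Hypothesis std_ker : forall A B D (f : Hom A B) (g : Hom B D) (h : Hom D (Sh A)),
  std f g h -> forall U (u : Hom U B), g ∘ u ≈ hzero U D -> exists v : Hom U A, f ∘ v ≈ u.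
Hypothesis std_coker : forall A B D (f : Hom A B) (g : Hom B D) (h : Hom D (Sh A)),
  std f g h -> forall U (u : Hom B U), u ∘ f ≈ hzero A U -> exists v : Hom D U, v ∘ g ≈ u.
Hypothesis Sh_zero : forall A B : T, fmap Sh (hzero A B) ≈ hzero (Sh A) (Sh B).
Hypothesis Sh_ff : fully_faithful Sh.
Hypothesis Sh_surj : forall A : T, essential_image Sh A.

Lemma triangulated_iso_closure : triangulated iso_closure.
Proof.
  split; try assumption.
  - exact iso_closure_iso.
  - intros A B f; destruct (std_cone f) as (D & g & h & H); exists D, g, h.
    apply iso_closure_std, H.
  - intros A B D f g h
      (A' & B' & D' & f' & g' & h' & a & b & d & Hs & Ia & Ib & Id & H1 & H2 & H3).
    apply (iso_closure_iso (a := b) (b := d) (d := fmap Sh a) Ib Id (fmap_is_iso Sh Ia))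
      with (4 := std_rot Hs); [exact H2|exact H3|].
    rewrite comp_opp_l, comp_opp_r, <- !fmap_comp, H1; reflexivity.
  - intros A B D A' B' D' f g h f' g' h' x y
      (A1 & B1 & D1 & f1 & g1 & h1 & a1 & b1 & d1 & Hs1 & Ia1 & Ib1 & Id1 & H1 & H2 & H3)
      (A2 & B2 & D2 & f2 & g2 & h2 & a2 & b2 & d2 & Hs2 & Ia2 & Ib2 & Id2 & K1 & K2 & K3) Hxy.
    destruct (std_fill (a := a2 ∘ x ∘ inverse Ia1) (b := b2 ∘ y ∘ inverse Ib1) Hs1 Hs2)
      as (z & Hz1 & Hz2).
    { apply (iso_cancel_r Ia1).
      rewrite <- (comp_assoc _ f1 a1), <- H1, <- !comp_assoc, (comp_assoc (inverse Ib1)).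
      rewrite inverse_l, comp_idl, Hxy, inverse_l, comp_idr, !comp_assoc, K1; reflexivity. }
    exists (inverse Id2 ∘ z ∘ d1); split.
    + rewrite <- !comp_assoc, H2, (comp_assoc z), Hz1, <- !comp_assoc, inverse_l, comp_idr.
      rewrite (comp_assoc g2 b2), <- K2, !comp_assoc, inverse_l, comp_idl; reflexivity.
    + apply (iso_cancel_l (fmap_is_iso Sh Ia2)).
      rewrite (comp_assoc _ h'), K3, (comp_assoc (h2 ∘ d2)), (comp_assoc (h2 ∘ d2)).
      rewrite <- (comp_assoc h2 d2), inverse_r, comp_idr, <- Hz2, <- comp_assoc, <- H3.
      rewrite !comp_assoc, <- !fmap_comp, <- (comp_assoc (a2 ∘ x)), inverse_l, comp_idr.
      reflexivity.
  - intros A B D f g h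
      (A' & B' & D' & f' & g' & h' & a & b & d & Hs & Ia & Ib & Id & H1 & H2 & H3).
    apply (iso_cancel_l Id).
    rewrite comp_assoc, H2, <- comp_assoc, H1, comp_assoc, (std_zero Hs).
    rewrite comp_zero_l, comp_zero_r; reflexivity.
  - intros A B D f g h
      (A' & B' & D' & f' & g' & h' & a & b & d & Hs & Ia & Ib & Id & H1 & H2 & H3) U u Hu.
    destruct (std_ker (u := b ∘ u) Hs) as [v Hv].
    { rewrite comp_assoc, <- H2, <- comp_assoc, Hu; apply comp_zero_r. }
    exists (inverse Ia ∘ v); apply (iso_cancel_l Ib).
    rewrite !comp_assoc, H1, <- (comp_assoc f'), inverse_r, comp_idr; exact Hv.
  - intros A B D f g h
      (A' & B' & D' & f' & g' & h' & a & b & d & Hs & Ia & Ib & Id & H1 & H2 & H3) U u Hu.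
    destruct (std_coker (u := u ∘ inverse Ib) Hs) as [v Hv].
    { apply (iso_cancel_r Ia); rewrite comp_zero_l, <- comp_assoc, <- H1, comp_assoc.
      rewrite <- (comp_assoc u), inverse_l, comp_idr; exact Hu. }
    exists (v ∘ d); rewrite <- comp_assoc, H2, comp_assoc, Hv, <- comp_assoc, inverse_l.
    apply comp_idr.
Qed.

End IsoClosure.

Section StableTriangulated.
Variables (E : ExactCategory) (S : suspension E).
Implicit Types A B D U : E.

Let std : forall A B D : stable_additive E,
    Hom A B -> Hom B D -> Hom D (stable_shift S A) -> Prop :=
  fun A B D f g h => standard_triangle (E := E) f g h.

(** The connecting map of an extension; the sign makes the resulting triangle one of
    Happel's standard triangles up to isomorphism. *)
Definition connecting A B D (i : Hom A B) (p : Hom B D) (h : Hom D (sus S A)) : Prop :=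
  exists w : Hom B (sus_env S A), w ∘ i ≈ - sus_i S A /\ h ∘ p ≈ sus_p S A ∘ w.

Lemma connecting_exists A B D (i : Hom A B) (p : Hom B D) :
  ses i p -> exists h, connecting i p h.
Proof.
  intro Hs.
  destruct (proj2 (sus_projinj S A) _ _ i (ses_adm_mono Hs) (- sus_i S A)) as [w Hw].
  destruct (ses_desc (t := sus_p S A ∘ w) Hs) as [h Hh].
  { rewrite <- comp_assoc, Hw, comp_opp_r, (ses_zero (sus_ses S A)); apply hopp_zero. }
  exists h, w; split; assumption.
Qed.

(** The pushout of [A >-> sus_env A] along [f] has the same cokernel, and the third map of
    the standard triangle is this cokernel. *)
Lemma standard_ses A B D (f : Hom A B) (g : Hom B D) (h : Hom D (sus S A)) :
  standard_triangle f g h -> ses g h.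
Proof.
  intros (w & HP & Hw & Hg); destruct (pushout_ses (sus_ses S A) HP) as (q & Hq & Hqw).
  apply (ses_heq (i := g) (p := q)); [reflexivity| |exact Hq].
  apply (pushout_ext HP); [rewrite Hw; exact Hqw|rewrite Hg; exact (ses_zero Hq)].
Qed.

(** A short exact sequence [A -> B -> D] and the standard triangle on [A -> B] differ
    by the pushout of [A >-> sus_env A] along [A -> B], an extension of [D] by
    a projective-injective object. *)
Lemma ses_triangle A B D (i : Hom A B) (p : Hom B D) (h : Hom D (sus S A)) :
  ses i p -> connecting i p h -> stable_triangle (S := S) i p h.
Proof.
  intros Hs (w & Hw1 & Hw2).
  destruct (pushout_adm_mono (sus_i S A) (ses_adm_mono Hs)) as (M & g & w0 & HP & _).
  destruct (pushout_ses Hs HP) as (d & Hd & Hdg).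
  pose proof (is_pushout_sym HP) as HP'; pose proof HP' as [Hsq HU].
  destruct (HU _ (sus_p S A) (hzero _ _)) as (h0 & [Hh1 Hh2] & _).
  { rewrite (ses_zero (sus_ses S A)); symmetry; apply comp_zero_l. }
  (* The kernel of [d] is injective, so [d] has a section [s], which is a stable inverse. *)
  destruct (proj2 (sus_projinj S A) _ _ w0 (ses_adm_mono Hd) (idm _)) as [r Hr].
  destruct (ses_desc (t := idm M - w0 ∘ r) Hd) as [s Hsd].
  { rewrite comp_sub_l, comp_idl, <- comp_assoc, Hr, comp_idr; apply hadd_opp. }
  assert (Hds : d ∘ s ≈ idm D).
  { apply (ses_epi Hd); rewrite <- comp_assoc, Hsd, comp_sub_r, comp_assoc, (ses_zero Hd).
    rewrite comp_zero_l, sub_zero_r, comp_idl; apply comp_idr. }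
  (* [t] factors the difference of the two connecting maps through the envelope of [A]. *)
  destruct (HU _ (- idm _) w) as (t & [Ht1 Ht2] & _).
  { rewrite comp_opp_l, comp_idl, Hw1; reflexivity. }
  assert (HW : standard_triangle (S := S) i g h0) by (exists w0; repeat split; assumption).
  exists A, B, M, i, g, h0, (@idm (stable E) A), (@idm (stable E) B), s; split; [exact HW|].
  split; [apply is_iso_id|split; [apply is_iso_id|]].
  assert (Hsd' : stable_eq (s ∘ d) (idm M)).
  { apply (null_heq (f := w0 ∘ r)); [|apply null_through, sus_projinj].
    rewrite Hsd, hopp_sub; symmetry; apply sub_add. }
  split; [exists d; split; [exact (heq_stable Hds)|exact Hsd']|].
  change (@stable_eq E A B (idm B ∘ i) (i ∘ idm A) /\ @stable_eq E B M (s ∘ p) (g ∘ idm B) /\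
    @stable_eq E D (sus S A) (sus_map S (idm A) ∘ h) (h0 ∘ s)).
  split; [apply heq_stable; rewrite comp_idl, comp_idr; reflexivity|].
  destruct (@stable_equivalence E B M) as [_ sy1 tr1].
  destruct (@stable_equivalence E D (sus S A)) as [_ sy2 tr2].
  split.
  - apply (tr1 _ (s ∘ (d ∘ g))); [apply heq_stable; rewrite Hdg; reflexivity|].
    apply (tr1 _ (idm M ∘ g)); [|apply heq_stable; rewrite comp_idl, comp_idr; reflexivity].
    apply (tr1 _ (s ∘ d ∘ g)); [apply heq_stable, comp_assoc|].
    apply (stable_comp Hsd'), (heq_stable (reflexivity g)).
  - apply (tr2 _ (idm _ ∘ h)); [apply (stable_comp (sus_map_id S A)), heq_stable; reflexivity|].
    apply (tr2 _ (h ∘ d ∘ s)).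
    { apply heq_stable; rewrite comp_idl, <- comp_assoc, Hds, comp_idr; reflexivity. }
    apply (fun H => stable_comp (g := h ∘ d) (g' := h0) H (heq_stable (reflexivity s))).
    apply (null_heq (f := sus_p S A ∘ (- t))); [|apply null_through, sus_projinj].
    apply (pushout_ext HP').
    + rewrite <- comp_assoc, comp_opp_l, Ht1, hopp_hopp, comp_idr, comp_sub_l, Hh1.
      rewrite <- comp_assoc, (ses_zero Hd), comp_zero_r, sub_zero_r; reflexivity.
    + rewrite <- comp_assoc, comp_opp_l, Ht2, comp_opp_r, <- Hw2, comp_sub_l, Hh2, zero_hadd.
      rewrite <- comp_assoc, Hdg; reflexivity.
Qed.

Lemma ses_in_triangle A B D (i : Hom A B) (p : Hom B D) :
  ses i p -> exists h, stable_triangle (S := S) i p h.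
Proof.
  intro Hs; destruct (connecting_exists Hs) as [h Hh]; exists h; exact (ses_triangle Hs Hh).
Qed.

(** Every stable map is, up to projective-injective objects, an admissible
    monomorphism, whose cokernel is the cone. *)
Lemma standard_cone_ses A B D (f : Hom A B) (g : Hom B D) (h : Hom D (sus S A)) :
  standard_triangle f g h ->
  exists (M P : E) (iB : Hom B M) (pB : Hom M B) (iP : Hom P M) (m : Hom A M) (c : Hom M D),
    projinj P /\ ses m c /\ ses iP pB /\ pB ∘ iB ≈ idm B /\ pB ∘ m ≈ f /\ c ∘ iB ≈ g.
Proof.
  intros (w & HP & Hw & Hg).
  destruct (@biproduct_exists E B (sus_env S A)) as (M & iB & iI & pB & pI & H1 & H2 & H3 & H4 & H5).
  exists M, (sus_env S A), iB, pB, iI, (iB ∘ f - iI ∘ sus_i S A), (g ∘ pB + w ∘ pI).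
  split; [apply sus_projinj|].
  split; [exact (pushout_cone_ses (sus_ses S A) HP H1 H2 H3 H4 H5)|].
  split; [exact (ses_biproduct H1 H2 H3 H4 H5)|]; split; [exact H1|split].
  - rewrite comp_sub_r, !comp_assoc, H1, H3, comp_zero_l, sub_zero_r; apply comp_idl.
  - rewrite comp_hadd_l, <- !comp_assoc, H1, H4, comp_zero_r, hadd_zero; apply comp_idr.
Qed.

(** If the suspension of [f] vanishes stably, the extension of [f] to the envelopes can be
    corrected to take values in the subobject [B]; so [f] factors through the envelope
    of [A]. *)
Lemma sus_faithful A B (f : Hom A B) : null (sus_map S f) -> null f.
Proof.
  intro H; pose proof (sus_ses S A) as SA; pose proof (sus_ses S B) as SB.
  destruct (null_lift SB H) as (t & Ht & _).
  destruct (ses_lift (t := sus_env_map S f - t ∘ sus_p S A) SB) as [s Hs].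
  { rewrite comp_sub_r, comp_assoc, Ht, <- sus_comm_p; apply hadd_opp. }
  exists (sus_env S A), (sus_i S A), s; split; [apply sus_projinj|].
  apply (ses_mono SB); rewrite comp_assoc, Hs, comp_sub_l, <- comp_assoc, (ses_zero SA).
  rewrite comp_zero_r, sub_zero_r, sus_comm_i; reflexivity.
Qed.

Lemma sus_full A B (g : Hom (sus S A) (sus S B)) : exists f : Hom A B, stable_eq (sus_map S f) g.
Proof.
  pose proof (sus_ses S A) as SA; pose proof (sus_ses S B) as SB.
  destruct (proj1 (sus_projinj S A) _ _ _ (ses_adm_epi SB) (g ∘ sus_p S A)) as [e He].
  destruct (ses_lift (t := e ∘ sus_i S A) SB) as [f Hf].
  { rewrite comp_assoc, He, <- comp_assoc, (ses_zero SA); apply comp_zero_r. }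
  exists f; apply (sus_unique (S := S) (f := f) (f' := f) (w := sus_env_map S f) (w' := e)).
  - apply heq_stable; reflexivity.
  - apply sus_comm_i.
  - apply sus_comm_p.
  - symmetry; exact Hf.
  - symmetry; exact He.
Qed.

(** Two short exact sequences with the same kernel and projective-injective middle terms
    have stably isomorphic cokernels: comparison maps in both directions exist,
    and this lemma handles their composites. *)
Lemma ses_endo_stable_id A P D (i : Hom A P) (p : Hom P D) (w : Hom P P) (h : Hom D D) :
  projinj P -> ses i p -> w ∘ i ≈ i -> h ∘ p ≈ p ∘ w -> stable_eq h (idm D).
Proof.
  intros HP Hs Hw Hh; destruct (ses_desc (t := idm P - w) Hs) as [t Ht].
  { rewrite comp_sub_l, comp_idl, Hw; apply hadd_opp. }
  apply (null_heq (f := p ∘ t)); [|apply null_through, HP].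
  apply (ses_epi Hs); rewrite <- comp_assoc, Ht, comp_sub_r, comp_sub_l, Hh, comp_idl, comp_idr.
  reflexivity.
Qed.

Lemma sus_surj (hF : frobenius E) (A : stable E) : essential_image (stable_shift S) A.
Proof.
  destruct (proj1 hF A) as (P & p & HP & K & i & Hs).
  assert (HPI : projinj P) by (split; [|apply (proj2 (proj2 hF))]; exact HP).
  pose proof (sus_ses S K) as SK.
  destruct (proj2 (sus_projinj S K) _ _ i (ses_adm_mono Hs) (sus_i S K)) as [w Hw].
  destruct (proj2 HPI _ _ _ (ses_adm_mono SK) i) as [w' Hw'].
  destruct (ses_desc (t := sus_p S K ∘ w) Hs) as [h Hh].
  { rewrite <- comp_assoc, Hw; exact (ses_zero SK). }
  destruct (ses_desc (t := p ∘ w') SK) as [h' Hh'].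
  { rewrite <- comp_assoc, Hw'; exact (ses_zero Hs). }
  exists K, h', h; split.
  - apply (ses_endo_stable_id (w := w ∘ w') (h := h ∘ h') (sus_projinj S K) SK).
    + rewrite <- comp_assoc, Hw'; exact Hw.
    + rewrite <- comp_assoc, Hh', comp_assoc, Hh, <- comp_assoc; reflexivity.
  - apply (ses_endo_stable_id (w := w' ∘ w) (h := h' ∘ h) HPI Hs).
    + rewrite <- comp_assoc, Hw; exact Hw'.
    + rewrite <- comp_assoc, Hh, comp_assoc, Hh', <- comp_assoc; reflexivity.
Qed.

Lemma standard_exists A B (f : Hom A B) :
  exists (D : E) (g : Hom B D) (h : Hom D (sus S A)), standard_triangle f g h.
Proof.
  destruct (pushout_adm_mono f (ses_adm_mono (sus_ses S A))) as (D & w & g & HP & _).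
  destruct (proj2 HP _ (sus_p S A) (hzero _ _)) as (h & [H1 H2] & _).
  { rewrite (ses_zero (sus_ses S A)); symmetry; apply comp_zero_l. }
  exists D, g, h, w; repeat split; try assumption; apply HP.
Qed.

(** The homotopy making the square commute only stably extends to the envelope of [A], where
    it corrects the evident map of pushouts. *)
Lemma standard_fill A B D A' B' D' (f : Hom A B) (g : Hom B D) (h : Hom D (sus S A))
    (f' : Hom A' B') (g' : Hom B' D') (h' : Hom D' (sus S A')) (a : Hom A A') (b : Hom B B') :
  standard_triangle f g h -> standard_triangle f' g' h' -> stable_eq (f' ∘ a) (b ∘ f) ->
  exists d : Hom D D', d ∘ g ≈ g' ∘ b /\ sus_map S a ∘ h ≈ h' ∘ d.
Proof.
  intros (w & HP & Hw & Hg) (w' & HP' & Hw' & Hg') Hab.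
  destruct (null_extend (sus_ses S A) (f := b ∘ f - f' ∘ a) Hab) as (k & Hk & _).
  destruct (proj2 HP _ (w' ∘ sus_env_map S a + g' ∘ k) (g' ∘ b)) as (d & [Hd1 Hd2] & _).
  { rewrite comp_hadd_l, <- !comp_assoc, Hk, sus_comm_i, comp_sub_r, (comp_assoc w').
    rewrite (proj1 HP'), <- comp_assoc; apply sub_add. }
  exists d; split; [exact Hd2|]; apply (pushout_ext HP).
  - rewrite <- !comp_assoc, Hd1, Hw, comp_hadd_r, !comp_assoc, Hw', Hg', comp_zero_l, hadd_zero.
    apply sus_comm_p.
  - rewrite <- !comp_assoc, Hd2, Hg, comp_assoc, Hg', comp_zero_l; apply comp_zero_r.
Qed.

Lemma standard_ker A B D (f : Hom A B) (g : Hom B D) (h : Hom D (sus S A)) U (u : Hom U B) :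
  standard_triangle f g h -> null (g ∘ u) -> exists v : Hom U A, stable_eq (f ∘ v) u.
Proof.
  intros Hst Hu.
  destruct (standard_cone_ses Hst) as (M & P & iB & pB & iP & m & c & HP & Hm & _ & HB & Hf & Hg).
  destruct (ses_weak_kernel (u := iB ∘ u) Hm) as [v Hv].
  { apply (null_heq (f := g ∘ u)); [rewrite comp_assoc, Hg; reflexivity|exact Hu]. }
  exists v; apply (null_heq (f := pB ∘ (iB ∘ u - m ∘ v))); [|apply null_comp_l, Hv].
  rewrite comp_sub_r, !comp_assoc, HB, Hf, comp_idl; reflexivity.
Qed.

Lemma standard_coker A B D (f : Hom A B) (g : Hom B D) (h : Hom D (sus S A)) U (u : Hom B U) :
  standard_triangle f g h -> null (u ∘ f) -> exists v : Hom D U, stable_eq (v ∘ g) u.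
Proof.
  intros Hst Hu.
  destruct (standard_cone_ses Hst) as (M & P & iB & pB & iP & m & c & HP & Hm & _ & HB & Hf & Hg).
  destruct (ses_weak_cokernel (u := u ∘ pB) Hm) as [v Hv].
  { apply (null_heq (f := u ∘ f)); [rewrite <- comp_assoc, Hf; reflexivity|exact Hu]. }
  exists v; destruct Hv as (Q & x & y & HQ & Hxy).
  apply (null_heq (f := y ∘ (x ∘ iB))); [|apply null_through, HQ].
  rewrite comp_assoc, <- Hxy, comp_sub_l, <- !comp_assoc, HB, Hg, comp_idr; reflexivity.
Qed.

Lemma stable_triangulated (hF : frobenius E) :
  triangulated (T := stable_additive E) (Sh := stable_shift S) (stable_triangle (S := S)).
Proof.
  apply (triangulated_iso_closure (T := stable_additive E) (Sh := stable_shift S) (std := std)).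
  - intros A B; exact (@standard_exists A B).
  - intros A B D f g h Hst; pose proof (standard_ses Hst) as Hs.
    destruct Hst as (w & HP & Hw & Hg).
    apply (ses_triangle Hs).
    destruct (proj2 HP _ (sus_env_map S f) (sus_i S B)) as (w' & [H1 H2] & _).
    { apply sus_comm_i. }
    exists (- w'); split; [rewrite comp_opp_l, H2; reflexivity|].
    change (@heq E _ _ (@hopp E _ _ (sus_map S f) ∘ h) (sus_p S B ∘ - w')).
    rewrite comp_opp_l, comp_opp_r; apply hopp_heq, (pushout_ext HP).
    + rewrite <- !comp_assoc, Hw, H1; apply sus_comm_p.
    + rewrite <- !comp_assoc, Hg, H2, (ses_zero (sus_ses S B)); apply comp_zero_r.
  - intros A B D A' B' D' f g h f' g' h' a b H1 H2 H3.
    destruct (standard_fill H1 H2 (a := a) (b := b)) as (d & Hd1 & Hd2).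
    { destruct (@stable_equivalence E A B') as [_ sy _]; apply sy, H3. }
    exists d; split; apply heq_stable; assumption.
  - intros A B D f g h (w & HP & _); apply null_iff.
    apply (null_heq (proj1 HP)), null_through, sus_projinj.
  - intros A B D f g h Hst U u Hu; exact (standard_ker Hst (proj1 (null_iff _) Hu)).
  - intros A B D f g h Hst U u Hu; exact (standard_coker Hst (proj1 (null_iff _) Hu)).
  - intros A B.
    apply (sus_unique (S := S) (f := @hzero E A B) (f' := @hzero E A B)
             (w := sus_env_map S (@hzero E A B)) (s' := @hzero E _ _) (w' := @hzero E _ _)).
    + apply heq_stable; reflexivity.
    + apply sus_comm_i.
    + apply sus_comm_p.
    + rewrite comp_zero_l, comp_zero_r; reflexivity.
    + rewrite comp_zero_l, comp_zero_r; reflexivity.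
  - split; [intros A B; exact (@sus_full A B)|].
    enough (Hfa : forall (A B : E) (f g : Hom A B),
              null (sus_map S g - sus_map S f) -> null (g - f)) by exact Hfa.
    { intros A B f g H; apply sus_faithful.
      apply (null_iff (sus_map S (g - f))).
      destruct (@stable_equivalence E (sus S A) (sus S B)) as [_ sy tr].
      apply (tr _ (sus_map S g - sus_map S f)).
      * apply (sus_unique (S := S) (f := g - f) (f' := g - f)
                 (w := sus_env_map S (g - f)) (w' := sus_env_map S g - sus_env_map S f)).
        -- apply heq_stable; reflexivity.
        -- apply sus_comm_i.
        -- apply sus_comm_p.
        -- rewrite comp_sub_l, comp_sub_r, !sus_comm_i; reflexivity.
        -- rewrite comp_sub_l, comp_sub_r, !sus_comm_p; reflexivity.
      * apply null_iff, H. }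
  - exact (sus_surj hF).
Qed.

End StableTriangulated.

(** * Cotorsion pairs and torsion pairs *)

Section Cotorsion.
Variables (E : ExactCategory) (hF : frobenius E) (S : suspension E).
Implicit Types A B D U V : E.

Let HT := stable_triangulated S hF.

Lemma projinj_of_projective (P : E) : projective P -> projinj P.
Proof. intro H; split; [exact H|apply hF, H]. Qed.

Lemma projinj_of_injective (P : E) : injective P -> projinj P.
Proof. intro H; split; [apply hF, H|exact H]. Qed.

Lemma projinj_retract A B : retract A B -> projinj B -> projinj A.
Proof.
  intros (s & r & Hrs) HB; apply projinj_of_projective; intros M N e He f.
  destruct (proj1 HB _ _ e He (f ∘ r)) as [g Hg]; exists (g ∘ s).
  rewrite comp_assoc, Hg, <- comp_assoc, Hrs; apply comp_idr.
Qed.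

Lemma Ext1_zero_projinj_l P B : projinj P -> Ext1_zero P B.
Proof. intros [HP _] M i p Hs; exact (HP _ _ p (ses_adm_epi Hs) (idm P)). Qed.

(** Ext^1 is the stable Hom into the suspension: the class of an extension is its
    connecting map, and conversely an extension is pulled back from
    [B >-> sus_env B ->> sus B]. *)
Lemma Ext1_zero_iff A B : Ext1_zero A B <-> hom_zero (C := stable E) A (sus S B).
Proof.
  split; intro H.
  - apply (hom_zero_iff (T := stable_additive E)); intro f; apply (proj2 (null_iff (E := E) f)).
    pose proof (sus_ses S B) as Hs.
    destruct (pullback_adm_epi f (ses_adm_epi Hs)) as (M & g & q & HP & _).
    destruct (pullback_ses Hs HP) as (k & Hk & _).
    destruct (H M k q Hk) as [s Hqs].
    apply (null_heq (f := sus_p S B ∘ (g ∘ s))); [|apply null_through, sus_projinj].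
    rewrite comp_assoc, (proj1 HP), <- comp_assoc, Hqs; apply comp_idr.
  - intros M i p Hs; destruct (ses_in_triangle S Hs) as [h Ht].
    destruct (tri_ker2 HT Ht (u := @idm (stable E) A)) as [v Hv]; [apply H|].
    destruct (null_lift Hs (f := idm A - p ∘ v) Hv) as (t & Hpt & _).
    exists (@hadd E A M v t); rewrite comp_hadd_r, Hpt; apply sub_add.
Qed.

Section ThickClasses.
Variable X : E -> Prop.

Lemma thick_class_ses_middle A B D (i : Hom A B) (p : Hom B D) :
  thick_class X -> ses i p -> X A -> X D -> X B.
Proof. intros [_ H] Hs; exact (proj1 (proj2 (H _ _ _ _ _ Hs))). Qed.

(** A stable retract of [B] is an honest retract of the sum of [B] and the projective-injective
    object through which the defect from the identity factors. *)
Lemma thick_class_stable_retract A B :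
  thick_class X -> (forall P, projinj P -> X P) ->
  retract (C := stable E) A B -> X B -> X A.
Proof.
  intros HX HP (s0 & r0 & Hrs0) HB.
  enough (H : forall (s : @Hom E A B) (r : @Hom E B A), null (idm A - r ∘ s) -> X A)
    by exact (H s0 r0 Hrs0).
  clear s0 r0 Hrs0; intros s r (P & h & k & HPP & Hrs).
  destruct (@biproduct_exists E B P) as (M & iB & iP & pB & pP & H1 & H2 & H3 & H4 & H5).
  apply (proj1 HX A M).
  - exists (iB ∘ s + iP ∘ h), (r ∘ pB + k ∘ pP).
    rewrite comp_hadd_l, !comp_hadd_r, <- !comp_assoc, (comp_assoc pB), (comp_assoc pB).
    rewrite (comp_assoc pP), (comp_assoc pP), H1, H2, H3, H4, !comp_zero_l, !comp_zero_r.
    rewrite !comp_idl, hadd_zero, zero_hadd, <- Hrs; apply sub_add.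
  - exact (thick_class_ses_middle HX (ses_biproduct H1 H2 H3 H4 H5) (HP P HPP) HB).
Qed.

Lemma isomorphic_retract (C : Category) (A B : C) : isomorphic A B -> retract B A.
Proof. intros (f & g & H1 & H2); exists g, f; exact H2. Qed.

Lemma thick_of_thick_class :
  thick_class X -> (forall P, projinj P -> X P) -> thick (T := stable_tri S) X.
Proof.
  intros HX HP.
  assert (ret : forall A B, retract (C := stable E) A B -> X B -> X A).
  { intros A B; exact (thick_class_stable_retract HX HP). }
  assert (iso : forall A B, isomorphic (C := stable E) A B -> X A -> X B).
  { intros A B H; exact (ret _ _ (isomorphic_retract H)). }
  pose proof (proj2 HX) as H3; split.
  - exact iso.
  - intros A HA; destruct (zero_exists E) as [O HO].
    apply (ret A O); [|apply HP, zero_projinj, HO].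
    exists (@hzero E A O), (@hzero E O A); destruct (proj2 HA A) as [u Hu].
    etransitivity; [apply Hu|symmetry; apply Hu].
  - intros A HA; exact (proj1 (H3 _ _ _ _ _ (sus_ses S A)) HA (HP _ (sus_projinj S A))).
  - intros A HA.
    exact (proj2 (proj2 (H3 _ _ _ _ _ (sus_ses S A))) (HP _ (sus_projinj S A)) HA).
  - intros A B D f g h
      (A' & B' & D' & f' & g' & h' & a & b & d & Hs & Ia & Ib & Id & _) HA HB.
    destruct (standard_cone_ses Hs) as (M & P & iB & pB & iP & m & c & HPP & Hm & HM & _).
    apply (iso D' D); [apply isomorphic_sym; exists d; exact Id|].
    apply (proj1 (H3 _ _ _ _ _ Hm)).
    + apply (iso A A'); [exists a; exact Ia|exact HA].
    + apply (thick_class_ses_middle HX HM (HP P HPP)).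
      apply (iso B B'); [exists b; exact Ib|exact HB].
  - intros A B (A' & p & q & Hp) HB; apply (ret A B); [|exact HB].
    destruct (Hp A (idm _) (@hzero E A A')) as (u & [Hu _] & _).
    exists u, p; exact Hu.
Qed.

Lemma thick_class_of_thick : thick (T := stable_tri S) X -> thick_class X.
Proof.
  intro HX; split.
  - intros A B (s & r & Hrs); apply (thick_retract HT HX).
    exists s, r; exact (heq_stable Hrs).
  - intros A B D i p Hs; destruct (ses_in_triangle S Hs) as [h Ht]; split; [|split].
    + exact (thick_cone HX Ht).
    + exact (thick_middle_of_ends HT HX Ht).
    + exact (thick_first HT HX Ht).
Qed.

End ThickClasses.

Section LocalizingPair.
Variables U V : E -> Prop.

Lemma cotorsion_projinj_l : cotorsion_pair U V -> forall P, projinj P -> U P.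
Proof. intros [H _] P HP; apply H; intros B _; apply Ext1_zero_projinj_l, HP. Qed.

(** The shift between Ext^1 and Hom disappears because [U] is closed under desuspension. *)
Lemma cotorsion_orthogonal :
  cotorsion_pair U V -> thick (T := stable_tri S) U ->
  forall B, V B <-> forall A, U A -> hom_zero (C := stable E) A B.
Proof.
  intros [_ H] HU B; rewrite (H B); etransitivity;
    [|symmetry; apply (orthogonal_shift HT HU)].
  split; intros HB A HA; apply Ext1_zero_iff, HB, HA.
Qed.

(** The class [V] is thick as the right orthogonal of a thick subcategory, and the
    approximation sequences are rotated torsion triangles. *)
Lemma torsion_of_localizing :
  localizing_cotorsion_pair U V ->
  thick (T := stable_tri S) U /\ thick (T := stable_tri S) V /\
  torsion_pair (T := stable_tri S) U V.
Proof.
  intros [[HC Hc] HU].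
  assert (TU : thick (T := stable_tri S) U).
  { exact (thick_of_thick_class HU (cotorsion_projinj_l HC)). }
  pose proof (cotorsion_orthogonal HC TU) as HV.
  assert (TV : thick (T := stable_tri S) V).
  { apply (thick_ext (T := stable_tri S) (P := fun B => forall A, U A -> hom_zero (C := stable E) A B)).
    - intro B; symmetry; apply HV.
    - exact (thick_orthogonal HT TU). }
  split; [exact TU|split; [exact TV|]]; split.
  - exact (thick_iso TU).
  - exact (thick_iso TV).
  - intros A B HA HB; exact (proj1 (HV B) HB A HA).
  - exact (thick_shift TU).
  - exact (thick_unshift TV).
  - intro A; destruct (Hc A) as [(B & D & i & p & Hs & HB & HD) _].
    destruct (ses_in_triangle S Hs) as [h Ht].
    exists D, (sus S B), p, h, (@hopp (stable_additive E) _ _ (fmap (stable_shift S) i)).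
    split; [exact HD|split; [exact (thick_shift TV HB)|]].
    exact (tri_rot HT Ht).
Qed.

(** One half of completeness comes from the torsion triangle [U -> A -> V]: make its second
    map an admissible monomorphism, with cokernel isomorphic to the suspension
    of [U].  The other half follows from it by the pushout argument of Salce. *)
Lemma localizing_of_torsion :
  thick (T := stable_tri S) U -> thick (T := stable_tri S) V ->
  torsion_pair (T := stable_tri S) U V -> localizing_cotorsion_pair U V.
Proof.
  intros TU TV Htp.
  assert (PU := thick_projinj TU); assert (PV := thick_projinj TV).
  assert (CU := thick_class_of_thick TU); assert (CV := thick_class_of_thick TV).
  assert (Hinj : forall A, exists (B D : E) (i : Hom A B) (p : Hom B D),
             ses i p /\ V B /\ U D).
  { intro A; destruct (tp_triangle Htp A) as (U0 & V0 & f & g & h & HU0 & HV0 & Ht).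
    destruct (standard_exists S (g : @Hom E A V0)) as (D & g' & h' & Hst).
    destruct (standard_cone_ses Hst) as (M & P & iB & pB & iP & m & c & HP & Hm & HM & _).
    exists M, D, m, c; split; [exact Hm|split].
    - exact (thick_class_ses_middle CV HM (PV P HP) HV0).
    - apply (thick_iso TU (A := sus S U0)); [|exact (thick_shift TU HU0)].
      apply (cone_unique HT (tri_rot HT Ht)
               (iso_closure_std (T := stable_additive E) (Sh := stable_shift S)
                  (std := fun A B D f g h => standard_triangle (E := E) f g h) Hst)). }
  split; [|exact CU]; split; [split|intro A; split; [|apply Hinj]].
  - intro A; split.
    + intros HA B HB; apply Ext1_zero_iff, (tp_hom Htp HA (thick_shift TV HB)).
    + intro H; apply (torsion_pair_left HT TU Htp); intros B HB.
      destruct (thick_desuspension HT TV HB) as (K & HK & k & k' & _ & Hkk').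
      intros u u'; rewrite <- (comp_idl u), <- (comp_idl u'), <- Hkk', <- !comp_assoc.
      pose proof (proj1 (Ext1_zero_iff A K) (H K HK)) as H0.
      rewrite (H0 (k' ∘ u) (k' ∘ u')); reflexivity.
  - intro B; split.
    + intros HB A HA; apply Ext1_zero_iff, (tp_hom Htp HA (thick_shift TV HB)).
    + intro H; apply (thick_unshift TV (A := B)), (torsion_pair_right HT TV Htp).
      intros A HA; apply Ext1_zero_iff, H, HA.
  - destruct (proj1 hF A) as (P & p & HP & K & i & Hs).
    destruct (Hinj K) as (V0 & U0 & j & c & Hj & HV0 & HU0).
    destruct (pushout_adm_mono j (ses_adm_mono Hs)) as (M & g & k & HPO & _).
    destruct (pushout_ses Hs HPO) as (q & Hq & _).
    destruct (pushout_ses Hj (is_pushout_sym HPO)) as (q' & Hq' & _).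
    exists V0, M, k, q; split; [exact Hq|split; [exact HV0|]].
    exact (thick_class_ses_middle CU Hq' (PU P (projinj_of_projective HP)) HU0).
Qed.

End LocalizingPair.

Theorem localizing_triple_iff_torsion_triple (X Y Z : E -> Prop) :
  localizing_cotorsion_triple X Y Z <-> torsion_triple (T := stable_tri S) X Y Z.
Proof.
  split.
  - intros [HL HR]; destruct (torsion_of_localizing HL) as (TX & TY & H1).
    destruct (torsion_of_localizing HR) as (_ & TZ & H2); split; assumption.
  - intros [TX TY TZ H1 H2]; split; apply localizing_of_torsion; assumption.
Qed.

Section RecollementHypotheses.
Variables U V : E -> Prop.
Hypotheses (TU : thick (T := stable_tri S) U) (TV : thick (T := stable_tri S) V).
Hypothesis Htp : torsion_pair (T := stable_tri S) U V.

(** An object orthogonal to itself is stably zero, that is, a retract of a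
    projective-injective object. *)
Lemma localizing_core A : (U A /\ V A) <-> projinj A.
Proof.
  split.
  - intros [HA HA'].
    destruct (proj1 (null_iff (E := E) (idm A)) (tp_hom Htp HA HA' _ _)) as (P & h & k & HP & H).
    apply (projinj_retract (B := P)); [exists h, k; symmetry; exact H|exact HP].
  - intro HA; split; [exact (thick_projinj TU HA)|exact (thick_projinj TV HA)].
Qed.

Lemma injective_of_localizing : injective_cotorsion_pair U V.
Proof.
  destruct (localizing_of_torsion TU TV Htp) as [H1 H2]; split; [exact H1|split; [exact H2|]].
  intro A; rewrite localizing_core; split; [intro H; apply H|apply projinj_of_injective].
Qed.

Lemma projective_of_localizing : projective_cotorsion_pair U V.
Proof.
  split; [apply (localizing_of_torsion TU TV Htp)|split; [exact (thick_class_of_thick TV)|]].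
  intro A; rewrite localizing_core; split; [intro H; apply H|apply projinj_of_projective].
Qed.

End RecollementHypotheses.

Let all_objects (_ : E) : Prop := True.

Lemma thick_all : thick (T := stable_tri S) all_objects.
Proof. split; repeat intro; exact I. Qed.

(** The projective-injective objects are exactly the stably zero ones. *)
Lemma thick_projective_injective : thick (T := stable_tri S) (@projinj E).
Proof.
  apply (thick_ext (T := stable_tri S)
           (P := fun B => forall A, all_objects A -> hom_zero (C := stable E) A B)).
  - intro B; split.
    + intro H; destruct (proj1 (null_iff (E := E) (idm B)) (H B I _ _)) as (P & h & k & HP & HB).
      apply (projinj_retract (B := P)); [exists h, k; symmetry; exact HB|exact HP].
    + intros HB A _; apply (hom_zero_iff (T := stable_additive E)); intro f.
      exact (zero_object_hom_r (T := stable_additive E) f (projinj_stable_zero HB)).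
  - exact (thick_orthogonal HT thick_all).
Qed.

Lemma torsion_pair_projinj_all : torsion_pair (T := stable_tri S) (@projinj E) all_objects.
Proof.
  split.
  - exact (thick_iso thick_projective_injective).
  - repeat intro; exact I.
  - intros A B HA _; apply (hom_zero_iff (T := stable_additive E)); intro f.
    exact (zero_object_hom_l (T := stable_additive E) f (projinj_stable_zero HA)).
  - exact (thick_shift thick_projective_injective).
  - repeat intro; exact I.
  - intro A; destruct (id_adm_epi A) as (K & k & Hk).
    destruct (ses_in_triangle S Hk) as [h Ht].
    exists K, A, k, (@idm E A), h; split; [|split; [exact I|exact Ht]].
    apply zero_projinj, zero_object_of_id, (ses_mono Hk).
    rewrite comp_idr, comp_zero_r, <- (comp_idl k); exact (ses_zero Hk).
Qed.

Lemma torsion_pair_all_projinj : torsion_pair (T := stable_tri S) all_objects (@projinj E).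
Proof.
  split.
  - repeat intro; exact I.
  - exact (thick_iso thick_projective_injective).
  - intros A B _ HB; apply (hom_zero_iff (T := stable_additive E)); intro f.
    exact (zero_object_hom_r (T := stable_additive E) f (projinj_stable_zero HB)).
  - repeat intro; exact I.
  - exact (thick_unshift thick_projective_injective).
  - intro A; destruct (ses_id_zero A) as (D & c & HD & Hc).
    destruct (ses_in_triangle S Hc) as [h Ht].
    exists A, D, (@idm E A), c, h; split; [exact I|split; [|exact Ht]].
    apply zero_projinj, HD.
Qed.

Lemma recollement_hypotheses (X Y Z : E -> Prop) :
  torsion_triple (T := stable_tri S) X Y Z ->
  injective_recollement_hypotheses (@projinj E) all_objects X Y Y Z /\
  projective_recollement_hypotheses all_objects (@projinj E) Y Z X Y.
Proof.
  intros [TX TY TZ H1 H2]; split; split.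
  - exact (injective_of_localizing thick_projective_injective thick_all torsion_pair_projinj_all).
  - split; [exact (injective_of_localizing TX TY H1)|].
    split; [exact (injective_of_localizing TY TZ H2)|].
    repeat split; try exact I; intros; tauto.
  - exact (projective_of_localizing thick_all thick_projective_injective torsion_pair_all_projinj).
  - split; [exact (projective_of_localizing TY TZ H2)|].
    split; [exact (projective_of_localizing TX TY H1)|].
    repeat split; try exact I; intros; tauto.
Qed.

End Cotorsion.

(** * Equivalences, reflections and coreflections *)

Lemma quasi_inverse_sym (C D : Category) (F : Functor C D) (G : Functor D C) :
  quasi_inverse F G -> quasi_inverse G F.
Proof. intros [H1 H2]; split; assumption. Qed.

Lemma quasi_inverse_faithful (C D : Category) (F : Functor C D) (G : Functor D C) :
  quasi_inverse F G -> faithful F.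
Proof.
  intros [[[al nal ial]] _] A B f g H; apply (iso_cancel_r (ial A)).
  pose proof (nal A B f) as Hf; pose proof (nal A B g) as Hg; cbn in Hf, Hg.
  rewrite <- Hf, <- Hg, H; reflexivity.
Qed.

Lemma quasi_inverse_full (C D : Category) (F : Functor C D) (G : Functor D C) :
  quasi_inverse F G -> full F.
Proof.
  intro HQ; pose proof (quasi_inverse_faithful (quasi_inverse_sym HQ)) as HG.
  destruct HQ as [[[al nal ial]] _]; intros A B g.
  exists (al B ∘ fmap G g ∘ inverse (ial A)); apply HG, (iso_cancel_l (ial B)).
  pose proof (nal A B (al B ∘ fmap G g ∘ inverse (ial A))) as Hf; cbn in Hf.
  rewrite Hf, <- comp_assoc, inverse_l; apply comp_idr.
Qed.

(** Terminal objects and products are defined by mapping properties, which equivalences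
    transport. *)
Lemma quasi_inverse_additive (C D : Category) (F : Functor C D) (G : Functor D C) :
  quasi_inverse F G -> additive_functor F.
Proof.
  intro HQ; pose proof (quasi_inverse_faithful HQ) as Fa; pose proof (quasi_inverse_full HQ) as Fu.
  destruct HQ as [_ [[be _ ibe]]].
  assert (lift : forall (A : D) (B : C) (g : Hom A (F B)),
             exists f : Hom (G A) B, fmap F f ≈ g ∘ be A).
  { intros A B g; exact (Fu (G A) B (g ∘ be A)). }
  split.
  - intros T HT A; destruct (HT (G A)) as [t Ht].
    exists (fmap F t ∘ inverse (ibe A)); intro g.
    destruct (lift A T g) as [f Hf]; apply (iso_cancel_r (ibe A)).
    rewrite <- Hf, (Ht f), <- comp_assoc, inverse_l; symmetry; apply comp_idr.
  - intros A B P p q HP T a b.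
    destruct (lift T A a) as [a' Ha]; destruct (lift T B b) as [b' Hb].
    destruct (HP _ a' b') as (u & [Hp Hq] & Hu).
    exists (fmap F u ∘ inverse (ibe T)); repeat split.
    + rewrite comp_assoc, <- fmap_comp, Hp, Ha, <- comp_assoc, inverse_r; apply comp_idr.
    + rewrite comp_assoc, <- fmap_comp, Hq, Hb, <- comp_assoc, inverse_r; apply comp_idr.
    + intros v Hv1 Hv2; destruct (lift T P v) as [v' Hv'].
      assert (Hvu : v' ≈ u).
      { apply Hu; apply Fa.
        - rewrite fmap_comp, Hv', comp_assoc, Hv1, Ha; reflexivity.
        - rewrite fmap_comp, Hv', comp_assoc, Hv2, Hb; reflexivity. }
      apply (iso_cancel_r (ibe T)).
      rewrite <- comp_assoc, inverse_l, <- Hv', Hvu; symmetry; apply comp_idr.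
Qed.

Lemma left_adjoint_initial (C D : Category) (L : Functor C D) (R : Functor D C) (A : C) :
  adjoint L R -> is_initial A -> is_initial (L A).
Proof.
  intros H HA; exact (proj1 (right_adjoint_additive (proj1 (op_adjoint L R) H)) A HA).
Qed.

Section ReflectiveSubcategories.
Variables (T : Category) (P : T -> Prop).

Lemma fullsub_is_iso (A B : fullsub P) (f : Hom A B) :
  is_iso (C := T) (A := proj1_sig A) (B := proj1_sig B) f -> is_iso f.
Proof. intros (g & H1 & H2); exists g; split; assumption. Qed.

Lemma fully_faithful_incl : fully_faithful (incl P).
Proof. split; [intros A B g; exists g; cbn; reflexivity|intros A B f g H; exact H]. Qed.

(** The counit is the inverse of the reflection maps of the objects of [P]. *)
Lemma adjoint_of_reflection (F : Functor T (fullsub P))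
    (eta : forall A : T, Hom A ((incl P ∘F F) A)) :
  natural (F := fid T) (G := incl P ∘F F) eta -> (forall A, local P (eta A)) ->
  adjoint F (incl P).
Proof.
  intros N H.
  assert (N' : forall A B (f : Hom A B), eta B ∘ f ≈ fmap (incl P ∘F F) f ∘ eta A) by exact N.
  assert (Hi : forall B : fullsub P, is_iso (eta (proj1_sig B))).
  { intro B; apply (local_is_iso (H _)); [exact (proj2_sig B)|exact (proj2_sig (F _))]. }
  assert (HL : forall A, fmap (incl P ∘F F) (eta A) ≈ eta ((incl P ∘F F) A)).
  { intro A; apply (proj2 (H A _ (proj2_sig (F _)))); symmetry; apply N. }
  apply (adjoint_of_iso_counit (L := F) (R := incl P) (eta := eta)
           (eps := fun B : fullsub P => inverse (Hi B))).
  - exact N.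
  - enough (K : forall (A B : fullsub P) (f : @Hom T (proj1_sig A) (proj1_sig B)),
               inverse (Hi B) ∘ fmap (incl P ∘F F) f ≈ f ∘ inverse (Hi A)) by exact K.
    intros A B f; apply (iso_cancel_l (Hi B)), (iso_cancel_r (Hi A)).
    rewrite <- !comp_assoc, inverse_l, comp_idr, (comp_assoc _ (inverse (Hi B))), inverse_r.
    rewrite comp_idl; symmetry; exact (N' _ _ f).
  - intro B; apply fullsub_is_iso, inverse_is_iso.
  - exact Hi.
  - intro A; change (inverse (Hi (F A)) ∘ fmap (incl P ∘F F) (eta A) ≈ idm _).
    rewrite HL; exact (inverse_l (Hi (F A))).
Qed.

Lemma adjoint_of_coreflection (F : Functor T (fullsub P))
    (eps : forall A : T, Hom ((incl P ∘F F) A) A) :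
  natural (F := incl P ∘F F) (G := fid T) eps -> (forall A, colocal P (eps A)) ->
  adjoint (incl P) F.
Proof.
  intros N H.
  assert (N' : forall A B (f : Hom A B), eps B ∘ fmap (incl P ∘F F) f ≈ f ∘ eps A) by exact N.
  assert (Hi : forall B : fullsub P, is_iso (eps (proj1_sig B))).
  { intro B; apply (colocal_is_iso (H _)); [exact (proj2_sig (F _))|exact (proj2_sig B)]. }
  assert (HL : forall A, fmap (incl P ∘F F) (eps A) ≈ eps ((incl P ∘F F) A)).
  { intro A; apply (proj2 (H A _ (proj2_sig (F _)))); apply N. }
  apply (adjoint_of_iso_unit (L := incl P) (R := F) (eps := eps)
           (eta := fun B : fullsub P => inverse (Hi B))).
  - enough (K : forall (A B : fullsub P) (f : @Hom T (proj1_sig A) (proj1_sig B)),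
               inverse (Hi B) ∘ f ≈ fmap (incl P ∘F F) f ∘ inverse (Hi A)) by exact K.
    intros A B f; apply (iso_cancel_l (Hi B)), (iso_cancel_r (Hi A)).
    rewrite <- !comp_assoc, inverse_l, comp_idr, (comp_assoc _ (inverse (Hi B))), inverse_r.
    rewrite comp_idl; symmetry; exact (N' _ _ f).
  - exact N.
  - intro B; apply fullsub_is_iso, inverse_is_iso.
  - exact Hi.
  - intro A; change (fmap (incl P ∘F F) (eps A) ∘ inverse (Hi (F A)) ≈ idm _).
    rewrite HL; exact (inverse_r (Hi (F A))).
Qed.

Variable R : forall A B : T, Hom A B -> Prop.

(** Coreflection maps chosen objectwise form a functor, as lifts along colocal maps are
    unique.  The property [R] records how the maps were chosen. *)
Lemma coreflection_exists :
  (forall A, exists (B : T) (e : Hom B A), P B /\ R e) ->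
  (forall B A (e : Hom B A), R e -> colocal P e) ->
  exists (G : Functor T T) (eps : forall A, Hom (G A) A),
    natural (F := G) (G := fid T) eps /\ forall A, P (G A) /\ R (eps A).
Proof.
  intros Hex Hco.
  assert (Hex' : forall A, exists x : {B : T & Hom B A}, P (projT1 x) /\ R (projT2 x)).
  { intro A; destruct (Hex A) as (B & e & H); exists (existT _ B e); exact H. }
  pose (c := fun A => constructive_indefinite_description _ (Hex' A)).
  pose (G := fun A => projT1 (proj1_sig (c A))).
  pose (eps := fun A => projT2 (proj1_sig (c A)) : Hom (G A) A).
  assert (HG : forall A, P (G A) /\ R (eps A)) by (intro A; exact (proj2_sig (c A))).
  assert (co : forall A U (u u' : Hom U (G A)), P U -> eps A ∘ u ≈ eps A ∘ u' -> u ≈ u').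
  { intros A U u u' HU; exact (proj2 (Hco _ _ _ (proj2 (HG A)) U HU) u u'). }
  assert (Hm : forall A B (f : Hom A B), exists g : Hom (G A) (G B), eps B ∘ g ≈ f ∘ eps A).
  { intros A B f; exact (proj1 (Hco _ _ _ (proj2 (HG B)) _ (proj1 (HG A))) _). }
  pose (Gm := fun A B f => proj1_sig (constructive_indefinite_description _ (Hm A B f))).
  assert (HGm : forall A B (f : Hom A B), eps B ∘ Gm A B f ≈ f ∘ eps A).
  { intros A B f; exact (proj2_sig (constructive_indefinite_description _ (Hm A B f))). }
  unshelve eexists (@Build_Functor T T G Gm _ _ _).
  - intros A B f g H; apply co; [apply HG|rewrite !HGm, H; reflexivity].
  - intro A; apply co; [apply HG|rewrite HGm, comp_idl, comp_idr; reflexivity].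
  - intros A B D g f; apply co; [apply HG|].
    rewrite HGm, comp_assoc, HGm, <- !comp_assoc, HGm; reflexivity.
  - exists eps; split; [exact HGm|exact HG].
Qed.

Lemma reflection_exists :
  (forall A, exists (B : T) (e : Hom A B), P B /\ R e) ->
  (forall A B (e : Hom A B), R e -> local P e) ->
  exists (G : Functor T T) (eta : forall A, Hom A (G A)),
    natural (F := fid T) (G := G) eta /\ forall A, P (G A) /\ R (eta A).
Proof.
  intros Hex Hlo.
  assert (Hex' : forall A, exists x : {B : T & Hom A B}, P (projT1 x) /\ R (projT2 x)).
  { intro A; destruct (Hex A) as (B & e & H); exists (existT _ B e); exact H. }
  pose (c := fun A => constructive_indefinite_description _ (Hex' A)).
  pose (G := fun A => projT1 (proj1_sig (c A))).
  pose (eta := fun A => projT2 (proj1_sig (c A)) : Hom A (G A)).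
  assert (HG : forall A, P (G A) /\ R (eta A)) by (intro A; exact (proj2_sig (c A))).
  assert (lo : forall A U (u u' : Hom (G A) U), P U -> u ∘ eta A ≈ u' ∘ eta A -> u ≈ u').
  { intros A U u u' HU; exact (proj2 (Hlo _ _ _ (proj2 (HG A)) U HU) u u'). }
  assert (Hm : forall A B (f : Hom A B), exists g : Hom (G A) (G B), g ∘ eta A ≈ eta B ∘ f).
  { intros A B f; exact (proj1 (Hlo _ _ _ (proj2 (HG A)) _ (proj1 (HG B))) _). }
  pose (Gm := fun A B f => proj1_sig (constructive_indefinite_description _ (Hm A B f))).
  assert (HGm : forall A B (f : Hom A B), Gm A B f ∘ eta A ≈ eta B ∘ f).
  { intros A B f; exact (proj2_sig (constructive_indefinite_description _ (Hm A B f))). }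
  unshelve eexists (@Build_Functor T T G Gm _ _ _).
  - intros A B f g H; apply lo; [apply HG|rewrite !HGm, H; reflexivity].
  - intro A; apply lo; [apply HG|rewrite HGm, comp_idl, comp_idr; reflexivity].
  - intros A B D g f; apply lo; [apply HG|].
    rewrite HGm, <- comp_assoc, HGm, !comp_assoc, HGm; reflexivity.
  - exists eta; split; [intros A B f; symmetry; exact (HGm A B f)|exact HG].
Qed.

End ReflectiveSubcategories.

(** * The localization *)

Section LocalizationFunctors.
Variables (E : ExactCategory) (Y : E -> Prop) (D : Category).

(** Morphisms of the localization are composites of maps of [E] and of inverses of such. *)
Lemma loc_natural (F G : Functor (loc Y) D) (t : forall A : loc Y, Hom (F A) (G A)) :
  (forall (A B : E) (f : Hom A B),
      t B ∘ fmap F (fmap (gamma Y) f) ≈ fmap G (fmap (gamma Y) f) ∘ t A) ->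
  natural t.
Proof.
  intros H A B f; revert A B f.
  enough (K : forall A B (f : loc_hom Y A B),
             t B ∘ @fmap _ _ F A B f ≈ @fmap _ _ G A B f ∘ t A) by exact K.
  induction f as [A B f|A B f w|A B K g IHg f IHf].
  - exact (H A B f).
  - apply (iso_cancel_r (fmap_is_iso F (weq_gamma_iso w))).
    rewrite <- !comp_assoc, H.
    assert (HF : @fmap _ _ F B A (loc_inv w) ∘ fmap F (fmap (gamma Y) f) ≈ idm _).
    { rewrite <- fmap_comp, <- fmap_id; apply fmap_heq, (le_inv_l w). }
    assert (HG : @fmap _ _ G B A (loc_inv w) ∘ fmap G (fmap (gamma Y) f) ≈ idm _).
    { rewrite <- fmap_comp, <- fmap_id; apply fmap_heq, (le_inv_l w). }
    rewrite HF, comp_idr, comp_assoc, HG, comp_idl; reflexivity.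
  - change (loc_comp g f) with (@comp (loc Y) A B K g f).
    rewrite !fmap_comp, comp_assoc, IHg, <- !comp_assoc, IHf; reflexivity.
Qed.

Variable F : Functor E D.
Hypothesis F_iso : forall A B (f : Hom A B), weq Y f -> is_iso (fmap F f).

Fixpoint loc_lift_map A B (f : loc_hom Y A B) : Hom (F A) (F B) :=
  match f with
  | @loc_map _ _ A B f => fmap F f
  | @loc_inv _ _ A B f w => inverse (F_iso w)
  | @loc_comp _ _ A B D g f => loc_lift_map g ∘ loc_lift_map f
  end.

(** The universal property of the Gabriel-Zisman localization. *)
Definition loc_lift : Functor (loc Y) D.
Proof.
  refine (@Build_Functor (loc Y) D F loc_lift_map _ _ _).
  - intros A B f g H; induction H; cbn [loc_lift_map].
    + reflexivity.
    + symmetry; assumption.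
    + etransitivity; eassumption.
    + apply comp_heq; assumption.
    + apply comp_assoc.
    + rewrite fmap_id; apply comp_idl.
    + rewrite fmap_id; apply comp_idr.
    + apply fmap_heq; assumption.
    + apply fmap_comp.
    + rewrite fmap_id; apply inverse_l.
    + rewrite fmap_id; apply inverse_r.
  - intro A; apply fmap_id.
  - intros A B K g f; reflexivity.
Defined.

End LocalizationFunctors.

Definition stable_projection (E : ExactCategory) : Functor E (stable E).
Proof.
  refine (@Build_Functor E (stable E) (fun A => A) (fun A B f => f) _ _ _).
  - intros A B f g; apply heq_stable.
  - intro A; apply heq_stable; reflexivity.
  - intros A B D g f; apply heq_stable; reflexivity.
Defined.

(** * The recollement of a torsion triple *)

Section SequencesAndTorsionPairs.
Variables (E : ExactCategory) (hF : frobenius E) (S : suspension E) (U V : E -> Prop).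
Hypotheses (TU : thick (T := stable_tri S) U) (TV : thick (T := stable_tri S) V).
Hypothesis HUV : torsion_pair (T := stable_tri S) U V.

Let HT := stable_triangulated S hF.
Let hom0 : forall A B : E, U A -> V B -> hom_zero (C := stable E) A B.
Proof. intros A B; exact (tp_hom HUV (A := A) (B := B)). Qed.

Lemma colocal_of_cokernel (A B D : E) (i : Hom A B) (p : Hom B D) :
  ses i p -> V D -> colocal (T := stable E) U i.
Proof.
  intros Hs HD; destruct (ses_in_triangle S Hs) as [h Ht].
  exact (colocal_of_cone HT TU hom0 Ht HD).
Qed.

Lemma colocal_of_kernel (A B D : E) (i : Hom A B) (p : Hom B D) :
  ses i p -> V A -> colocal (T := stable E) U p.
Proof.
  intros Hs HA; destruct (ses_in_triangle S Hs) as [h Ht].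
  exact (colocal_of_cone HT TU hom0 (tri_rot HT Ht) (thick_shift TV HA)).
Qed.

Lemma local_of_cokernel (A B D : E) (i : Hom A B) (p : Hom B D) :
  ses i p -> U D -> local (T := stable E) V i.
Proof.
  intros Hs HD; destruct (ses_in_triangle S Hs) as [h Ht].
  exact (local_of_cone HT TV hom0 Ht HD).
Qed.

Lemma local_of_kernel (A B D : E) (i : Hom A B) (p : Hom B D) :
  ses i p -> U A -> local (T := stable E) V p.
Proof.
  intros Hs HA; destruct (ses_in_triangle S Hs) as [h Ht].
  exact (local_of_cone HT TV hom0 (tri_rot HT Ht) (thick_shift TU HA)).
Qed.

(** Both factors of a weak equivalence lie in triangles with an object of [V] as cone: the
    cokernel of the first, the suspended kernel of the second. *)
Lemma colocal_of_weq (A B : E) (f : Hom A B) : weq V f -> colocal (T := stable E) U f.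
Proof.
  intros (M & K & L & i & c & k & p & Hi & HK & Hp & HL & Hf) W HW.
  apply (hom_bij_cov_heq (T := stable E) (f := @comp (stable E) _ _ _ p i)).
  - apply heq_stable; symmetry; exact Hf.
  - apply hom_bij_cov_comp.
    + exact (colocal_of_kernel Hp HL HW).
    + exact (colocal_of_cokernel Hi HK HW).
Qed.

Lemma local_of_weq (A B : E) (f : Hom A B) : weq U f -> local (T := stable E) V f.
Proof.
  intros (M & K & L & i & c & k & p & Hi & HK & Hp & HL & Hf) W HW.
  apply (hom_bij_contra_heq (T := stable E) (f := @comp (stable E) _ _ _ p i)).
  - apply heq_stable; symmetry; exact Hf.
  - apply hom_bij_contra_comp.
    + exact (local_of_kernel Hp HL HW).
    + exact (local_of_cokernel Hi HK HW).
Qed.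

End SequencesAndTorsionPairs.

Section WeakEquivalences.
Variables (E : ExactCategory) (Y : E -> Prop).
Hypothesis hY : forall P, projinj P -> Y P.

Lemma weq_of_kernel (A B D : E) (i : Hom A B) (p : Hom B D) : ses i p -> Y A -> weq Y p.
Proof.
  intros Hs HA; destruct (ses_id_zero B) as (O & c & HO & Hc).
  exists B, O, A, (idm B), c, i, p; repeat split; try assumption.
  - apply hY, zero_projinj, HO.
  - rewrite comp_idr; reflexivity.
Qed.

Lemma weq_of_cokernel (A B D : E) (i : Hom A B) (p : Hom B D) : ses i p -> Y D -> weq Y i.
Proof.
  intros Hs HD; destruct (id_adm_epi B) as (K & k & Hk).
  exists B, D, K, i, p, k, (idm B); repeat split; try assumption.
  - apply hY, zero_projinj, zero_object_of_id, (ses_mono Hk).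
    rewrite comp_idr, comp_zero_r, <- (comp_idl k); exact (ses_zero Hk).
  - rewrite comp_idl; reflexivity.
Qed.

End WeakEquivalences.

Section TorsionTriple.
Variables (E : ExactCategory) (hF : frobenius E) (S : suspension E) (X Y Z : E -> Prop).
Hypothesis HXYZ : torsion_triple (T := stable_tri S) X Y Z.
Variable hY : forall P, projinj P -> Y P.

Let HT := stable_triangulated S hF.
Let TX := tt_thick_l HXYZ.
Let TY := tt_thick_m HXYZ.
Let TZ := tt_thick_r HXYZ.
Let HXY := tt_left HXYZ.
Let HYZ := tt_right HXYZ.

Let St := stable E.
Let Q : Functor St (loc Y) := quotient hY.
Let Sh : Functor St St := stable_shift S.

(** What remains of the functors induced by C(X,Y) and E(Y,Z) up to natural isomorphism:
    coreflections onto [X] and reflections onto [Z] along maps inverted in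
    the localization. *)
Record coreflects (F : Functor (loc Y) St) (eps : forall A : St, Hom (F (Q A)) A) : Prop := {
  co_natural : natural (F := F ∘F Q) (G := fid St) eps;
  co_in : forall A : St, X (F (Q A));
  co_colocal : forall A : St, colocal (T := St) X (eps A);
  co_iso : forall A : St, is_iso (fmap Q (eps A))
}.

Record reflects (F : Functor (loc Y) St) (eta : forall A : St, Hom A (F (Q A))) : Prop := {
  re_natural : natural (F := fid St) (G := F ∘F Q) eta;
  re_in : forall A : St, Z (F (Q A));
  re_local : forall A : St, local (T := St) Z (eta A);
  re_iso : forall A : St, is_iso (fmap Q (eta A))
}.

Lemma is_C_coreflects F : is_C Q F X Y -> exists eps, coreflects (F := F) eps.
Proof.
  intros (eps & N & H); exists eps; split; [exact N| | |].
  - intro A; apply (H A).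
  - intro A; destruct (H A) as (_ & B & i & HB & Hs).
    exact (colocal_of_kernel hF TX TY HXY Hs HB).
  - intro A; destruct (H A) as (_ & B & i & HB & Hs).
    exact (weq_gamma_iso (weq_of_kernel hY Hs HB)).
Qed.

Lemma is_E_reflects F : is_E Q F Y Z -> exists eta, reflects (F := F) eta.
Proof.
  intros (eta & N & H); exists eta; split; [exact N| | |].
  - intro A; apply (H A).
  - intro A; destruct (H A) as (_ & B & p & HB & Hs).
    exact (local_of_cokernel hF TZ HYZ Hs HB).
  - intro A; destruct (H A) as (_ & B & p & HB & Hs).
    exact (weq_gamma_iso (weq_of_cokernel hY Hs HB)).
Qed.


Section LeftAdjoint.
Variables (F : Functor (loc Y) St) (eps : forall A : St, Hom (F (Q A)) A).
Hypothesis HF : coreflects eps.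

(** Naturality in the stable category extends to the localization, which turns the
    coreflection maps into a natural isomorphism from [Q F] to the identity; its inverse
    is the unit of the adjunction. *)
Lemma counit_natural : natural (F := Q ∘F F) (G := fid (loc Y)) (fun A => fmap Q (eps A)).
Proof.
  apply loc_natural; intros A B f.
  change (fmap Q (eps B) ∘ fmap Q (fmap (F ∘F Q) (f : @Hom St A B)) ≈
          fmap Q (f : @Hom St A B) ∘ fmap Q (eps A)).
  rewrite <- !fmap_comp; apply fmap_heq, (co_natural HF).
Qed.

Lemma coreflection_iso A : X A -> is_iso (eps A).
Proof. intro HA; exact (colocal_is_iso (co_colocal HF A) (co_in HF A) HA). Qed.

Lemma coreflects_adjoint : adjoint F Q /\ fully_faithful F.
Proof.
  apply (adjoint_of_iso_unit (L := F) (R := Q) (eta := fun A => inverse (co_iso HF A)) (eps := eps)).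
  - exact (natural_inverse (F := Q ∘F F) (G := fid (loc Y)) (t := fun A : loc Y => fmap Q (eps A))
             (co_iso HF) counit_natural).
  - exact (co_natural HF).
  - intro A; apply inverse_is_iso.
  - intro A; apply coreflection_iso, (co_in HF).
  - intro A; apply inverse_r.
Qed.

Lemma coreflects_essential_image B : essential_image F B <-> X B.
Proof.
  split.
  - intros (A & HA); exact (thick_iso TX HA (co_in HF A)).
  - intro HB; exists B, (eps B); exact (coreflection_iso HB).
Qed.

(** A colocal map becomes invertible after coreflection, and the coreflection maps are
    themselves inverted in the localization. *)
Lemma coreflects_colocal_iso A B (f : @Hom St A B) :
  colocal (T := St) X f -> is_iso (fmap Q f).
Proof.
  intro Hf; pose proof (co_natural HF f) as N.
  assert (Hi : is_iso (fmap (F ∘F Q) f)).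
  { apply (colocal_is_iso (T := St) (P := X)); [|apply (co_in HF)|apply (co_in HF)].
    intros U HU; apply (hom_bij_cov_cancel (co_colocal HF B HU)).
    apply (hom_bij_cov_heq (f := f ∘ eps A)); [symmetry; exact N|].
    apply hom_bij_cov_comp; [exact (Hf U HU)|exact (co_colocal HF A HU)]. }
  apply (is_iso_cancel_r (co_iso HF A)).
  apply (is_iso_heq (f := fmap Q (eps B) ∘ fmap Q (fmap (F ∘F Q) f))).
  - rewrite <- !fmap_comp; apply fmap_heq; exact N.
  - apply is_iso_comp; [apply (co_iso HF)|apply fmap_is_iso, Hi].
Qed.

End LeftAdjoint.

Section RightAdjoint.
Variables (F : Functor (loc Y) St) (eta : forall A : St, Hom A (F (Q A))).
Hypothesis HF : reflects eta.

Lemma unit_natural : natural (F := fid (loc Y)) (G := Q ∘F F) (fun A => fmap Q (eta A)).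
Proof.
  apply loc_natural; intros A B f.
  change (fmap Q (eta B) ∘ fmap Q (f : @Hom St A B) ≈
          fmap Q (fmap (F ∘F Q) (f : @Hom St A B)) ∘ fmap Q (eta A)).
  rewrite <- !fmap_comp; apply fmap_heq, (re_natural HF).
Qed.

Lemma reflection_iso A : Z A -> is_iso (eta A).
Proof. intro HA; exact (local_is_iso (re_local HF A) HA (re_in HF A)). Qed.

Lemma reflects_adjoint : adjoint Q F /\ fully_faithful F.
Proof.
  apply (adjoint_of_iso_counit (L := Q) (R := F) (eta := eta) (eps := fun A => inverse (re_iso HF A))).
  - exact (re_natural HF).
  - exact (natural_inverse (F := fid (loc Y)) (G := Q ∘F F) (t := fun A : loc Y => fmap Q (eta A))
             (re_iso HF) unit_natural).
  - intro A; apply inverse_is_iso.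
  - intro A; apply reflection_iso, (re_in HF).
  - intro A; apply inverse_l.
Qed.

Lemma reflects_essential_image B : essential_image F B <-> Z B.
Proof.
  split.
  - intros (A & HA); exact (thick_iso TZ HA (re_in HF A)).
  - intro HB; exists B; apply isomorphic_sym; exists (eta B); exact (reflection_iso HB).
Qed.

End RightAdjoint.

(** * Existence of the functors *)

Lemma C_exists (U V : E -> Prop) :
  thick (T := stable_tri S) U -> thick (T := stable_tri S) V ->
  torsion_pair (T := stable_tri S) U V ->
  exists (G : Functor St St) (eps : forall A, Hom (G A) A),
    natural (F := G) (G := fid St) eps /\
    forall A : E, U (G A) /\ exists (B : E) (i : @Hom E B (G A)), V B /\ ses (e := E) i (eps A).
Proof.
  intros TU TV HUV; destruct (localizing_of_torsion hF TU TV HUV) as [[_ Hc] _].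
  apply (coreflection_exists (T := St) (P := U)
    (R := fun M D p => exists (B : E) (i : @Hom E B M), V B /\ ses (e := E) i p)).
  - intro D; destruct (Hc D) as [(B & M & i & p & Hs & HB & HM) _].
    exists M, p; split; [exact HM|exists B, i; split; assumption].
  - intros M D p (B & i & HB & Hs); exact (colocal_of_kernel hF TU TV HUV Hs HB).
Qed.

Lemma E_exists (U V : E -> Prop) :
  thick (T := stable_tri S) U -> thick (T := stable_tri S) V ->
  torsion_pair (T := stable_tri S) U V ->
  exists (G : Functor St St) (eta : forall A, Hom A (G A)),
    natural (F := fid St) (G := G) eta /\
    forall A : E, V (G A) /\ exists (B : E) (p : @Hom E (G A) B), U B /\ ses (e := E) (eta A) p.
Proof.
  intros TU TV HUV; destruct (localizing_of_torsion hF TU TV HUV) as [[_ Hc] _].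
  apply (reflection_exists (T := St) (P := V)
    (R := fun D M i => exists (B : E) (p : @Hom E M B), U B /\ ses (e := E) i p)).
  - intro D; destruct (Hc D) as [_ (M & B & i & p & Hs & HM & HB)].
    exists M, i; split; [exact HM|exists B, p; split; assumption].
  - intros D M i (B & p & HB & Hs); exact (local_of_cokernel hF TV HUV Hs HB).
Qed.

(** The coreflection inverts weak equivalences, since these are colocal, so it descends to the
    localization by the universal property. *)
Lemma loc_C_exists : exists F : Functor (loc Y) St, is_C Q F X Y.
Proof.
  destruct (C_exists TX TY HXY) as (G & eps & N & H).
  unshelve eexists (loc_lift (F := G ∘F stable_projection E) (Y := Y) _).
  - intros A B f Hw; cbn.
    assert (Hf : colocal (T := St) X f) by exact (colocal_of_weq hF TX TY HXY Hw).
    assert (co : forall D, colocal (T := St) X (eps D)).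
    { intro D; destruct (H D) as (_ & B0 & i & HB & Hs).
      exact (colocal_of_kernel hF TX TY HXY Hs HB). }
    apply (colocal_is_iso (T := St) (P := X)); [|apply H|apply H].
    intros U HU; apply (hom_bij_cov_cancel (co B U HU)).
    apply (hom_bij_cov_heq (T := St) (f := @comp St _ _ _ f (eps A))).
    + symmetry; exact (N A B f).
    + apply hom_bij_cov_comp; [exact (Hf U HU)|exact (co A U HU)].
  - exists eps; split; [exact N|exact H].
Qed.

Lemma loc_E_exists : exists F : Functor (loc Y) St, is_E Q F Y Z.
Proof.
  destruct (E_exists TY TZ HYZ) as (G & eta & N & H).
  unshelve eexists (loc_lift (F := G ∘F stable_projection E) (Y := Y) _).
  - intros A B f Hw; cbn.
    assert (Hf : local (T := St) Z f) by exact (local_of_weq hF TY TZ HYZ Hw).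
    assert (lo : forall D, local (T := St) Z (eta D)).
    { intro D; destruct (H D) as (_ & B0 & p & HB & Hs).
      exact (local_of_cokernel hF TZ HYZ Hs HB). }
    apply (local_is_iso (T := St) (P := Z)); [|apply H|apply H].
    intros U HU; apply (hom_bij_contra_cancel (lo A U HU)).
    apply (hom_bij_contra_heq (T := St) (f := @comp St _ _ _ (eta B) f)).
    + exact (N A B f).
    + apply hom_bij_contra_comp; [exact (lo B U HU)|exact (Hf U HU)].
  - exists eta; split; [exact N|exact H].
Qed.

Lemma triple_adjoints_exist : exists d : adjoint_functors Y, triple_adjoints X Z hY d.
Proof.
  destruct (E_exists TX TY HXY) as (G1 & eta & N1 & H1).
  destruct (C_exists TY TZ HYZ) as (G2 & eps & N2 & H2).
  destruct loc_C_exists as [F1 HF1]; destruct loc_E_exists as [F2 HF2].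
  exists (Build_Adjoints
            (corestrict (D := St) (P := Y) (F := G1) (fun A => proj1 (H1 A)))
            (corestrict (D := St) (P := Y) (F := G2) (fun A => proj1 (H2 A))) F1 F2).
  split; [exists eta; split; assumption|split; [exists eps; split; assumption|split; assumption]].
Qed.

(** Colocality is stable under suspension, so the suspension of a weak equivalence is inverted
    in the localization. *)
Lemma loc_shift_exists : inhabited (loc_shift S hY).
Proof.
  destruct loc_C_exists as [F HF]; destruct (is_C_coreflects HF) as [eps Heps].
  assert (Hi : forall (A B : E) (f : @Hom E A B), weq Y f ->
             is_iso (fmap (Q ∘F Sh ∘F stable_projection E) f)).
  { intros A B f Hw; apply (coreflects_colocal_iso Heps), (colocal_shift HT TX).
    exact (colocal_of_weq hF TX TY HXY Hw). }
  constructor; exists (loc_lift Hi).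
  unshelve eexists (fun A : St => @idm (loc Y) (Q (Sh A))).
  - intros A B f; cbn -[loc Q Sh]; etransitivity; [apply comp_idl|symmetry; apply comp_idr].
  - intro A; apply is_iso_id.
Qed.

(** * Exactness *)

Lemma stable_triangle_heq (A B D : St) (f f' : @Hom St A B) (g g' : @Hom St B D)
    (h h' : @Hom St D (Sh A)) :
  f ≈ f' -> g ≈ g' -> h ≈ h' ->
  stable_triangle (S := S) f g h -> stable_triangle (S := S) f' g' h'.
Proof.
  intros Hf Hg Hh Ht.
  apply (tri_iso HT (a := idm A) (b := idm B) (d := idm D)
           (is_iso_id _) (is_iso_id _) (is_iso_id _)) with (4 := Ht).
  - etransitivity; [apply comp_idl|etransitivity; [symmetry; exact Hf|symmetry; apply comp_idr]].
  - etransitivity; [apply comp_idl|etransitivity; [symmetry; exact Hg|symmetry; apply comp_idr]].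
  - etransitivity; [apply comp_heq; [apply fmap_id|reflexivity]|].
    etransitivity; [apply comp_idl|etransitivity; [symmetry; exact Hh|symmetry; apply comp_idr]].
Qed.

Lemma exact_inclusion :
  additive_functor (incl (C := St) Y) ->
  exact_functor (T := sub_tri TY) (T' := stable_tri S) (incl (C := St) Y).
Proof.
  intro H; split; [exact H|].
  unshelve eexists (@Build_NatIso (sub_tri TY) (stable_tri S)
    (incl (C := St) Y ∘F shift (sub_tri TY)) (shift (stable_tri S) ∘F incl (C := St) Y)
    (fun A => @idm St (Sh (proj1_sig A))) _ _).
  - intros A B f; etransitivity; [apply (comp_idl (c := St))|symmetry; apply (comp_idr (c := St))].
  - intro A; apply (is_iso_id (C := St)).
  - intros A B D f g h Ht.
    apply (stable_triangle_heq (reflexivity _) (reflexivity _)) with (2 := Ht).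
    symmetry; apply (comp_idl (c := St)).
Qed.

Variable L : loc_shift S hY.

Let AY := loc_tri L.

(** Used, like the pasting lemmas below, for composite functors on the localization: stated
    with arbitrary objects it applies up to conversion, whereas rewriting would have
    to see through the composites. *)
Lemma comp_inverse_cancel (C : Category) (A B D : C) (u : Hom A B) (e : Hom A A)
    (Hu : is_iso u) (h : Hom D B) :
  e ≈ idm A -> u ∘ e ∘ (inverse Hu ∘ h) ≈ h ∘ idm D.
Proof.
  intro He; rewrite He, !comp_idr, comp_assoc, inverse_r; apply comp_idl.
Qed.

Lemma quotient_shift : exists phi : NatIso (Q ∘F Sh) (ls_shift L ∘F Q),
  forall (A B D : St) (f : Hom A B) (g : Hom B D) (h : Hom D (Sh A)),
  stable_triangle (S := S) f g h ->
  loc_triangle (L := L) (fmap Q f) (fmap Q g) (phi A ∘ fmap Q h).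
Proof.
  exists (Build_NatIso (natural_inverse (ni_iso (ls_iso L)) (@ni_natural _ _ _ _ (ls_iso L)))
            (fun A => inverse_is_iso (ni_iso (ls_iso L) A))).
  intros A B D f g h Ht.
  exists A, B, D, f, g, h, (@idm (loc Y) A), (@idm (loc Y) B), (@idm (loc Y) D).
  split; [exact Ht|]; repeat (split; [apply is_iso_id|]); split; [|split].
  - etransitivity; [apply (comp_idl (c := loc Y))|symmetry; apply (comp_idr (c := loc Y))].
  - etransitivity; [apply (comp_idl (c := loc Y))|symmetry; apply (comp_idr (c := loc Y))].
  - exact (comp_inverse_cancel (ni_iso (ls_iso L) A) (fmap Q h) (fmap_id (ls_shift L) (Q A))).
Qed.

Lemma exact_quotient :
  additive_functor Q -> exact_functor (T := stable_tri S) (T' := AY) Q.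
Proof. intro H; split; [exact H|exact quotient_shift]. Qed.

Lemma exact_restricted_quotient (P : E -> Prop) (TP : thick (T := stable_tri S) P) :
  additive_functor (Q ∘F incl (C := St) P) ->
  exact_functor (T := sub_tri TP) (T' := AY) (Q ∘F incl (C := St) P).
Proof.
  intro H; split; [exact H|]; destruct quotient_shift as [phi Hphi].
  unshelve eexists (@Build_NatIso (sub_tri TP) AY
    ((Q ∘F incl (C := St) P) ∘F shift (sub_tri TP)) (shift AY ∘F (Q ∘F incl (C := St) P))
    (fun A => phi (proj1_sig A)) _ _).
  - intros A B f; exact (@ni_natural _ _ _ _ phi (proj1_sig A) (proj1_sig B) f).
  - intro A; exact (ni_iso phi (proj1_sig A)).
  - intros A B D f g h Ht; exact (Hphi _ _ _ f g h Ht).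
Qed.

Section Pasting.
Variables (C D : Category) (F : Functor C D).

Lemma fmap_paste (M N M' N' : C) (x y : D) (s : Hom M N) (k : Hom M' N') (m : Hom M M')
    (n : Hom N N') (p : Hom (F M') x) (q : Hom (F N') y) (u : Hom x y) :
  n ∘ s ≈ k ∘ m -> q ∘ fmap F k ≈ u ∘ p ->
  q ∘ fmap F n ∘ fmap F s ≈ u ∘ (p ∘ fmap F m).
Proof.
  intros H1 H2; rewrite <- comp_assoc, <- fmap_comp, H1, fmap_comp, !comp_assoc, H2; reflexivity.
Qed.

Lemma fmap_paste_comp (M N M' N' K : C) (x y : D) (s : Hom M N) (n : Hom N N') (h : Hom K M)
    (k : Hom M' N') (d : Hom K M') (q : Hom (F N') y) (t : Hom (F M) x) (u : Hom x y) :
  q ∘ fmap F n ∘ fmap F s ≈ u ∘ t -> n ∘ s ∘ h ≈ k ∘ d ->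
  u ∘ (t ∘ fmap F h) ≈ q ∘ fmap F k ∘ fmap F d.
Proof.
  intros H1 H2; rewrite comp_assoc, <- H1, <- !comp_assoc, <- !fmap_comp, comp_assoc, H2.
  reflexivity.
Qed.

End Pasting.

(** Functors on the localization are exact as soon as their composites with the quotient
    functor are: naturality and triangles of the localization come from the
    stable category. *)
Section ExactOnLocalization.
Variables (F : Functor (loc Y) St) (P : E -> Prop) (TP : thick (T := stable_tri S) P).
Variable psi : NatIso (F ∘F Q ∘F Sh) (Sh ∘F (F ∘F Q)).
Hypothesis psi_triangle : forall (A B D : St) (f : Hom A B) (g : Hom B D) (h : Hom D (Sh A)),
  stable_triangle (S := S) f g h ->
  stable_triangle (S := S) (fmap (F ∘F Q) f) (fmap (F ∘F Q) g) (psi A ∘ fmap (F ∘F Q) h).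

Lemma exact_on_localization (hp : forall B : loc Y, P (F B)) :
  additive_functor (corestrict (D := St) (P := P) (F := F) hp) ->
  exact_functor (T := AY) (T' := sub_tri TP) (corestrict (D := St) (P := P) (F := F) hp).
Proof.
  intro H; split; [exact H|].
  pose (t := fun A : loc Y => @comp St _ _ _ (psi A) (fmap F (ls_iso L A))).
  assert (Nt : natural (F := F ∘F ls_shift L) (G := Sh ∘F F) t).
  { apply loc_natural; intros A B f; unfold t.
    exact (fmap_paste (@ni_natural _ _ _ _ (ls_iso L) A B f) (@ni_natural _ _ _ _ psi A B f)). }
  unshelve eexists (@Build_NatIso AY (sub_tri TP)
    (corestrict (D := St) (P := P) (F := F) hp ∘F shift AY)
    (shift (sub_tri TP) ∘F corestrict (D := St) (P := P) (F := F) hp) t _ _).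
  - exact Nt.
  - intro A; apply fullsub_is_iso, is_iso_comp; [exact (ni_iso psi A)|].
    exact (fmap_is_iso F (ni_iso (ls_iso L) A)).
  - enough (K : forall (A B D : loc Y) (A1 B1 D1 : St) (f : Hom A B) (g : Hom B D)
      (h : Hom D (ls_shift L A)) (f1 : Hom A1 B1) (g1 : Hom B1 D1) (h1 : Hom D1 (Sh A1))
      (a : Hom A (Q A1)) (b : Hom B (Q B1)) (d : Hom D (Q D1)),
      stable_triangle (S := S) f1 g1 h1 -> is_iso a -> is_iso b -> is_iso d ->
      b ∘ f ≈ fmap Q f1 ∘ a -> d ∘ g ≈ fmap Q g1 ∘ b ->
      ls_iso L A1 ∘ fmap (ls_shift L) a ∘ h ≈ fmap Q h1 ∘ d ->
      stable_triangle (S := S) (fmap F f) (fmap F g) (t A ∘ fmap F h)).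
    { intros A B D f g h (A1 & B1 & D1 & f1 & g1 & h1 & a & b & d & Ht & Ia & Ib & Id & E1 & E2 & E3).
      exact (K A B D A1 B1 D1 f g h f1 g1 h1 a b d Ht Ia Ib Id E1 E2 E3). }
    intros A B D A1 B1 D1 f g h f1 g1 h1 a b d Ht Ia Ib Id E1 E2 E3.
    assert (N : t (Q A1) ∘ fmap F (fmap (ls_shift L) a) ≈ fmap Sh (fmap F a) ∘ t A)
      by exact (Nt A (Q A1) a).
    apply (tri_iso HT (a := fmap F a) (b := fmap F b) (d := fmap F d)
             (fmap_is_iso F Ia) (fmap_is_iso F Ib) (fmap_is_iso F Id))
      with (4 := psi_triangle Ht).
    + enough (K : fmap F b ∘ fmap F f ≈ fmap F (fmap Q f1) ∘ fmap F a) by exact K.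
      rewrite <- !fmap_comp, E1; reflexivity.
    + enough (K : fmap F d ∘ fmap F g ≈ fmap F (fmap Q g1) ∘ fmap F b) by exact K.
      rewrite <- !fmap_comp, E2; reflexivity.
    + enough (K : fmap Sh (fmap F a) ∘ (t A ∘ fmap F h) ≈ psi A1 ∘ fmap F (fmap Q h1) ∘ fmap F d)
        by exact K.
      exact (fmap_paste_comp N E3).
Qed.

Lemma exact_between_subcategories (P0 : E -> Prop) (TP0 : thick (T := stable_tri S) P0)
    (hp : forall B : fullsub (C := St) P0, P ((F ∘F Q ∘F incl (C := St) P0) B)) :
  additive_functor (corestrict (D := St) (P := P) (F := F ∘F Q ∘F incl (C := St) P0) hp) ->
  exact_functor (T := sub_tri TP0) (T' := sub_tri TP)
    (corestrict (D := St) (P := P) (F := F ∘F Q ∘F incl (C := St) P0) hp).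
Proof.
  intro H; split; [exact H|].
  unshelve eexists (@Build_NatIso (sub_tri TP0) (sub_tri TP)
    (corestrict (D := St) (P := P) (F := F ∘F Q ∘F incl (C := St) P0) hp ∘F shift (sub_tri TP0))
    (shift (sub_tri TP) ∘F corestrict (D := St) (P := P) (F := F ∘F Q ∘F incl (C := St) P0) hp)
    (fun A => psi (proj1_sig A)) _ _).
  - intros A B f; exact (@ni_natural _ _ _ _ psi (proj1_sig A) (proj1_sig B) f).
  - intro A; apply fullsub_is_iso, (ni_iso psi).
  - intros A B D f g h Ht; exact (psi_triangle Ht).
Qed.

End ExactOnLocalization.

Section LeftAdjointExact.
Variables (F : Functor (loc Y) St) (eps : forall A : St, Hom (F (Q A)) A).
Hypothesis HF : coreflects eps.

Lemma coreflects_triangle : exists psi : NatIso (F ∘F Q ∘F Sh) (Sh ∘F (F ∘F Q)),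
  forall (A B D : St) (f : Hom A B) (g : Hom B D) (h : Hom D (Sh A)),
  stable_triangle (S := S) f g h ->
  stable_triangle (S := S) (fmap (F ∘F Q) f) (fmap (F ∘F Q) g) (psi A ∘ fmap (F ∘F Q) h).
Proof.
  destruct (coreflection_shift HT TX (co_natural HF) (co_in HF) (co_colocal HF)) as [psi Hpsi].
  exists psi.
  exact (coreflection_triangle HT TX (co_natural HF) (co_in HF) (co_colocal HF) Hpsi).
Qed.

Lemma coreflects_quasi_inverse (hl : forall B : loc Y, X (F B)) :
  quasi_inverse (corestrict (D := St) (P := X) (F := F) hl) (Q ∘F incl (C := St) X).
Proof.
  split; constructor.
  - unshelve refine (@Build_NatIso (loc Y) (loc Y)
      ((Q ∘F incl (C := St) X) ∘F corestrict (D := St) (P := X) (F := F) hl) (fid _)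
      (fun A => fmap Q (eps A)) _ _).
    + exact (counit_natural HF).
    + exact (co_iso HF).
  - unshelve refine (@Build_NatIso (fullsub (C := St) X) (fullsub (C := St) X)
      (corestrict (D := St) (P := X) (F := F) hl ∘F (Q ∘F incl (C := St) X)) (fid _)
      (fun B => eps (proj1_sig B)) _ _).
    + intros A B f; exact (co_natural HF f).
    + intro B; apply fullsub_is_iso; exact (coreflection_iso HF (proj2_sig B)).
Qed.

Lemma coreflects_equivalence (hl : forall B : loc Y, X (F B)) :
  triangulated_equivalence (T := AY) (T' := sub_tri TX)
    (corestrict (D := St) (P := X) (F := F) hl) (Q ∘F incl (C := St) X).
Proof.
  pose proof (coreflects_quasi_inverse hl) as H; destruct coreflects_triangle as [psi Hpsi].
  split; [|split; [|exact H]].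
  - exact (exact_on_localization TX Hpsi (quasi_inverse_additive H)).
  - exact (exact_restricted_quotient TX (quasi_inverse_additive (quasi_inverse_sym H))).
Qed.

End LeftAdjointExact.

Section RightAdjointExact.
Variables (F : Functor (loc Y) St) (eta : forall A : St, Hom A (F (Q A))).
Hypothesis HF : reflects eta.

Lemma reflects_triangle : exists psi : NatIso (F ∘F Q ∘F Sh) (Sh ∘F (F ∘F Q)),
  forall (A B D : St) (f : Hom A B) (g : Hom B D) (h : Hom D (Sh A)),
  stable_triangle (S := S) f g h ->
  stable_triangle (S := S) (fmap (F ∘F Q) f) (fmap (F ∘F Q) g) (psi A ∘ fmap (F ∘F Q) h).
Proof.
  destruct (reflection_shift HT TZ (re_natural HF) (re_in HF) (re_local HF)) as [psi Hpsi].
  exists psi.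
  exact (reflection_triangle HT TZ (re_natural HF) (re_in HF) (re_local HF) Hpsi).
Qed.

Lemma reflects_quasi_inverse (hr : forall B : loc Y, Z (F B)) :
  quasi_inverse (corestrict (D := St) (P := Z) (F := F) hr) (Q ∘F incl (C := St) Z).
Proof.
  split; apply nat_isomorphic_sym; constructor.
  - unshelve refine (@Build_NatIso (loc Y) (loc Y) (fid _)
      ((Q ∘F incl (C := St) Z) ∘F corestrict (D := St) (P := Z) (F := F) hr)
      (fun A => fmap Q (eta A)) _ _).
    + exact (unit_natural HF).
    + exact (re_iso HF).
  - unshelve refine (@Build_NatIso (fullsub (C := St) Z) (fullsub (C := St) Z) (fid _)
      (corestrict (D := St) (P := Z) (F := F) hr ∘F (Q ∘F incl (C := St) Z))
      (fun B => eta (proj1_sig B)) _ _).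
    + intros A B f; exact (re_natural HF f).
    + intro B; apply fullsub_is_iso; exact (reflection_iso HF (proj2_sig B)).
Qed.

Lemma reflects_equivalence (hr : forall B : loc Y, Z (F B)) :
  triangulated_equivalence (T := AY) (T' := sub_tri TZ)
    (corestrict (D := St) (P := Z) (F := F) hr) (Q ∘F incl (C := St) Z).
Proof.
  pose proof (reflects_quasi_inverse hr) as H; destruct reflects_triangle as [psi Hpsi].
  split; [|split; [|exact H]].
  - exact (exact_on_localization TZ Hpsi (quasi_inverse_additive H)).
  - exact (exact_restricted_quotient TZ (quasi_inverse_additive (quasi_inverse_sym H))).
Qed.

End RightAdjointExact.

(** Both [X] and [Z] are equivalent to the localization.  On [Z] the composite is compared to the
    identity by the coreflection map, whose image under [G Q] is invertible, followed by the
    inverse of the reflection map; symmetrically on [X]. *)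
Lemma left_right_equivalence (F G : Functor (loc Y) St)
    (eps : forall A : St, Hom (F (Q A)) A) (eta : forall A : St, Hom A (G (Q A)))
    (HF : coreflects eps) (HG : reflects eta)
    (hl : forall B : fullsub (C := St) Z, X ((F ∘F Q ∘F incl (C := St) Z) B))
    (hr : forall B : fullsub (C := St) X, Z ((G ∘F Q ∘F incl (C := St) X) B)) :
  triangulated_equivalence (T := sub_tri TZ) (T' := sub_tri TX)
    (corestrict (D := St) (P := X) (F := F ∘F Q ∘F incl (C := St) Z) hl)
    (corestrict (D := St) (P := Z) (F := G ∘F Q ∘F incl (C := St) X) hr).
Proof.
  pose (lam := corestrict (D := St) (P := X) (F := F ∘F Q ∘F incl (C := St) Z) hl).
  pose (rho := corestrict (D := St) (P := Z) (F := G ∘F Q ∘F incl (C := St) X) hr).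
  assert (H : quasi_inverse lam rho).
  { split.
    - constructor.
      assert (Hi : forall B, Z B -> is_iso (eta B)) by (intro; exact (reflection_iso HG (A := _))).
      unshelve refine (@Build_NatIso (fullsub (C := St) Z) (fullsub (C := St) Z) (rho ∘F lam) (fid _)
        (fun B => @comp St _ _ _ (inverse (Hi _ (proj2_sig B))) (fmap G (fmap Q (eps (proj1_sig B)))))
        _ _).
      + enough (K : forall (A B : St) (HA : Z A) (HB : Z B) (f : Hom A B),
          inverse (Hi B HB) ∘ fmap G (fmap Q (eps B)) ∘ fmap G (fmap Q (fmap F (fmap Q f))) ≈
          f ∘ (inverse (Hi A HA) ∘ fmap G (fmap Q (eps A))))
          by (intros [A HA] [B HB] f; exact (K A B HA HB f)).
        intros A B HA HB f; apply (iso_cancel_l (Hi B HB)).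
        pose proof (co_natural HF f) as N1; pose proof (re_natural HG f) as N2.
        change (eps B ∘ fmap F (fmap Q f) ≈ f ∘ eps A) in N1.
        change (eta B ∘ f ≈ fmap G (fmap Q f) ∘ eta A) in N2.
        rewrite <- (comp_assoc (inverse (Hi B HB))), <- !fmap_comp, N1, !fmap_comp.
        rewrite (comp_assoc (eta B) f), N2, <- (comp_assoc _ (eta A)), !(comp_assoc (eta _)).
        rewrite !inverse_r, !comp_idl; reflexivity.
      + intros [B HB]; apply fullsub_is_iso, is_iso_comp; [apply inverse_is_iso|].
        apply fmap_is_iso, (co_iso HF).
    - constructor.
      unshelve refine (@Build_NatIso (fullsub (C := St) X) (fullsub (C := St) X) (lam ∘F rho) (fid _)
        (fun B => @comp St _ _ _ (eps (proj1_sig B)) (fmap F (inverse (re_iso HG (proj1_sig B)))))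
        _ _).
      + enough (K : forall (A B : St) (f : Hom A B),
          eps B ∘ fmap F (inverse (re_iso HG B)) ∘ fmap F (fmap Q (fmap G (fmap Q f))) ≈
          f ∘ (eps A ∘ fmap F (inverse (re_iso HG A))))
          by (intros [A HA] [B HB] f; exact (K A B f)).
        intros A B f.
        pose proof (co_natural HF f) as N1.
        pose proof (natural_inverse (F := fid (loc Y)) (G := Q ∘F G)
          (t := fun A : loc Y => fmap Q (eta A)) (re_iso HG) (unit_natural HG) (fmap Q f)) as N2.
        change (eps B ∘ fmap F (fmap Q f) ≈ f ∘ eps A) in N1.
        change (inverse (re_iso HG B) ∘ fmap Q (fmap G (fmap Q f)) ≈
                fmap Q f ∘ inverse (re_iso HG A)) in N2.
        rewrite <- (comp_assoc (eps B)), <- fmap_comp, N2, fmap_comp, !comp_assoc, N1.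
        reflexivity.
      + intros [B HB]; apply fullsub_is_iso, is_iso_comp.
        * exact (coreflection_iso HF HB).
        * apply fmap_is_iso, inverse_is_iso. }
  destruct (coreflects_triangle HF) as [psi Hpsi]; destruct (reflects_triangle HG) as [psi' Hpsi'].
  split; [|split; [|exact H]].
  - exact (exact_between_subcategories TX Hpsi TZ (quasi_inverse_additive H)).
  - exact (exact_between_subcategories TZ Hpsi' TX (quasi_inverse_additive (quasi_inverse_sym H))).
Qed.

(** * The recollement *)

Lemma recollement_of_adjoints (d : adjoint_functors Y) :
  is_E (fid _) (incl (C := St) Y ∘F inc_l d) X Y ->
  is_C (fid _) (incl (C := St) Y ∘F inc_r d) Y Z ->
  (exists eps, coreflects (F := quo_l d) eps) -> (exists eta, reflects (F := quo_r d) eta) ->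
  recollement (T' := sub_tri TY) (T := stable_tri S) (T'' := AY) (incl (C := St) Y) Q d.
Proof.
  intros (e & Ne & He) (c & Nc & Hc) [eps HF] [eta HG].
  assert (AL : adjoint (inc_l d) (incl (C := St) Y)).
  { apply (adjoint_of_reflection (eta := e) Ne); intro A; destruct (He A) as (_ & B & p & HB & Hs).
    exact (local_of_cokernel hF TY HXY Hs HB). }
  assert (AR : adjoint (incl (C := St) Y) (inc_r d)).
  { apply (adjoint_of_coreflection (eps := c) Nc); intro A; destruct (Hc A) as (_ & B & i & HB & Hs).
    exact (colocal_of_kernel hF TY TZ HYZ Hs HB). }
  destruct (coreflects_adjoint HF) as [QL FL]; destruct (reflects_adjoint HG) as [QR FR].
  pose proof (right_adjoint_additive QL) as Qadd.
  split; try assumption.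
  - exact (exact_inclusion (right_adjoint_additive AL)).
  - exact (exact_quotient Qadd).
  - apply fully_faithful_incl.
  - intro A; split.
    (* Objects of [Y] are killed: the map from [A] to a zero object has kernel [A]. *)
    + intros ([B HB] & HBA).
      assert (HA : Y A) by exact (thick_iso TY HBA HB).
      destruct (ses_id_zero (A : E)) as (O & c0 & HO & Hc0).
      assert (Hz : is_zero (C := St) O) by apply projinj_stable_zero, zero_projinj, HO.
      apply (is_zero_iso (C := loc Y) (A := Q O)).
      * apply isomorphic_sym; exists (fmap Q (c0 : @Hom St A O)).
        exact (weq_gamma_iso (weq_of_kernel hY Hc0 HA)).
      * split; [exact (left_adjoint_initial QR (proj1 Hz))|exact (proj1 Qadd O (proj2 Hz))].
    (* If [Q A] vanishes then so does its coreflection; then every map from [X] to [A], lifting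
       to the coreflection, vanishes, and [A] lies in the right orthogonal of [X]. *)
    + intros [HI _].
      assert (Hz : is_zero (C := St) (quo_l d (Q A))).
      { apply (zero_object_of_id (T := stable_additive E)).
        destruct (left_adjoint_initial QL HI (quo_l d (Q A))) as [x Hx].
        etransitivity; [apply Hx|symmetry; apply Hx]. }
      assert (HA : Y A).
      { apply (torsion_pair_right HT TY HXY); intros U HU u u'.
        destruct (proj1 (co_colocal HF A HU) u) as [v Hv].
        destruct (proj1 (co_colocal HF A HU) u') as [v' Hv'].
        assert (Hvv : v ≈ v').
        { destruct (proj2 Hz U) as [x Hx]; etransitivity; [apply Hx|symmetry; apply Hx]. }
        etransitivity; [symmetry; exact Hv|etransitivity; [|exact Hv']].
        apply comp_heq; [reflexivity|exact Hvv]. }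
      exists (exist _ A HA), (idm A); apply is_iso_id.
Qed.

(** * The functors of the injective and projective recollement theorems *)

Let all_objects (_ : E) : Prop := True.

(** An admissible monomorphism with projective-injective cokernel has a stably zero cone:
    this is colocality for the torsion pair of all objects and zero objects. *)
Lemma iso_of_projinj_cokernel (A B D : E) (i : Hom A B) (p : Hom B D) :
  ses i p -> projinj D -> is_iso (C := St) i.
Proof.
  intros Hs HD; apply (colocal_is_iso (T := St) (P := all_objects)); [|exact I|exact I].
  exact (colocal_of_cokernel hF (thick_all S) (torsion_pair_all_projinj hF S) Hs HD).
Qed.

Lemma iso_of_projinj_kernel (A B D : E) (i : Hom A B) (p : Hom B D) :
  ses i p -> projinj A -> is_iso (C := St) p.
Proof.
  intros Hs HA; apply (colocal_is_iso (T := St) (P := all_objects)); [|exact I|exact I].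
  exact (colocal_of_kernel hF (thick_all S) (thick_projective_injective hF S)
           (torsion_pair_all_projinj hF S) Hs HA).
Qed.

(** The functor E(M_1) is isomorphic to the identity, so that C(M_2) o E(M_1) is a
    coreflection onto [X]. *)
Lemma injective_coreflects F :
  (exists E1 C2 : Functor St St,
      is_E (fid _) E1 (@projinj E) all_objects /\ is_C (fid _) C2 X Y /\
      nat_isomorphic (F ∘F Q) (C2 ∘F E1)) ->
  exists eps, coreflects (F := F) eps.
Proof.
  intros (E1 & C2 & (e & Ne & He) & (c & Nc & Hc) & [[n Nn In]]).
  assert (Ie : forall A : St, is_iso (e A)).
  { intro A; destruct (He A) as (_ & B & p & HB & Hs); exact (iso_of_projinj_cokernel Hs HB). }
  exists (fun A : St => inverse (Ie A) ∘ (c (E1 A) ∘ n A)); split.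
  - intros A B f.
    assert (Ni : natural (F := E1) (G := fid St) (fun A => inverse (Ie A))).
    { apply (natural_inverse (F := fid St) (G := E1) (t := e)); exact Ne. }
    assert (Nc' : natural (F := C2 ∘F E1) (G := E1) (fun A => c (E1 A))).
    { intros M N k; exact (Nc (E1 M) (E1 N) (fmap E1 k)). }
    exact (natural_comp (natural_comp Nn Nc') Ni f).
  - intro A; apply (thick_iso TX (A := C2 (E1 A))); [|apply (Hc (E1 A))].
    apply isomorphic_sym; exists (n A); apply In.
  - intros A U HU; apply hom_bij_cov_comp; [apply hom_bij_cov_iso, inverse_is_iso|].
    apply hom_bij_cov_comp; [|apply hom_bij_cov_iso, In].
    destruct (Hc (E1 A)) as (_ & B & i & HB & Hs).
    exact (colocal_of_kernel hF TX TY HXY Hs HB HU).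
  - intro A; destruct (Hc (E1 A)) as (_ & B & i & HB & Hs).
    apply fmap_comp_is_iso; [apply fmap_is_iso, inverse_is_iso|apply fmap_comp_is_iso].
    + exact (weq_gamma_iso (weq_of_kernel hY Hs HB)).
    + apply fmap_is_iso, In.
Qed.

Lemma projective_reflects F :
  (exists C1 E2 : Functor St St,
      is_C (fid _) C1 all_objects (@projinj E) /\ is_E (fid _) E2 Y Z /\
      nat_isomorphic (F ∘F Q) (E2 ∘F C1)) ->
  exists eta, reflects (F := F) eta.
Proof.
  intros (C1 & E2 & (c & Nc & Hc) & (e & Ne & He) & Hn).
  destruct (nat_isomorphic_sym Hn) as [[n Nn In]].
  assert (Ic : forall A : St, is_iso (c A)).
  { intro A; destruct (Hc A) as (_ & B & i & HB & Hs); exact (iso_of_projinj_kernel Hs HB). }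
  exists (fun A : St => n A ∘ (e (C1 A) ∘ inverse (Ic A))); split.
  - intros A B f.
    assert (Ni : natural (F := fid St) (G := C1) (fun A => inverse (Ic A))).
    { apply (natural_inverse (F := C1) (G := fid St) (t := c)); exact Nc. }
    assert (Ne' : natural (F := C1) (G := E2 ∘F C1) (fun A => e (C1 A))).
    { intros M N k; exact (Ne (C1 M) (C1 N) (fmap C1 k)). }
    exact (natural_comp (natural_comp Ni Ne') Nn f).
  - intro A; apply (thick_iso TZ (A := E2 (C1 A))); [|apply (He (C1 A))].
    exists (n A); apply In.
  - intros A U HU; apply hom_bij_contra_comp; [apply hom_bij_contra_iso, In|].
    apply hom_bij_contra_comp; [|apply hom_bij_contra_iso, inverse_is_iso].
    destruct (He (C1 A)) as (_ & B & p & HB & Hs).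
    exact (local_of_cokernel hF TZ HYZ Hs HB HU).
  - intro A; destruct (He (C1 A)) as (_ & B & p & HB & Hs).
    apply fmap_comp_is_iso; [apply fmap_is_iso, In|apply fmap_comp_is_iso].
    + exact (weq_gamma_iso (weq_of_cokernel hY Hs HB)).
    + apply fmap_is_iso, inverse_is_iso.
Qed.

Lemma identity_is_E : is_E (fid St) (fid St) (@projinj E) all_objects.
Proof.
  exists (fun A => idm A); split.
  - intros A B f; etransitivity; [apply comp_idl|symmetry; apply comp_idr].
  - intro A; split; [exact I|]; destruct (ses_id_zero A) as (D & p & HD & Hs).
    exists D, p; split; [apply zero_projinj, HD|exact Hs].
Qed.

Lemma identity_is_C : is_C (fid St) (fid St) all_objects (@projinj E).
Proof.
  exists (fun A => idm A); split.
  - intros A B f; etransitivity; [apply comp_idl|symmetry; apply comp_idr].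
  - intro A; split; [exact I|]; destruct (id_adm_epi (A : E)) as (K & k & Hs).
    exists K, k; split; [|exact Hs].
    apply zero_projinj, zero_object_of_id, (ses_mono Hs).
    rewrite comp_idr, comp_zero_r, <- (comp_idl k); exact (ses_zero Hs).
Qed.

Lemma triple_injective (d : adjoint_functors Y) :
  triple_adjoints X Z hY d -> injective_adjoints X Z hY d.
Proof.
  intros (H1 & H2 & H3 & H4); split; [exact H1|split; [exact H2|split; [|exact H4]]].
  exists (fid St), (quo_l d ∘F Q); split; [exact identity_is_E|split].
  - destruct H3 as (eps & N & H); exists eps; split; [exact N|exact H].
  - constructor; unshelve eexists (fun A : St => @idm St (quo_l d (Q A))).
    + intros A B f; etransitivity; [apply (comp_idl (c := St))|symmetry; apply (comp_idr (c := St))].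
    + intro A; apply is_iso_id.
Qed.

Lemma triple_projective (d : adjoint_functors Y) :
  triple_adjoints X Z hY d -> projective_adjoints X Z hY d.
Proof.
  intros (H1 & H2 & H3 & H4); split; [exact H1|split; [exact H2|split; [exact H3|]]].
  exists (fid St), (quo_r d ∘F Q); split; [exact identity_is_C|split].
  - destruct H4 as (eta & N & H); exists eta; split; [exact N|exact H].
  - constructor; unshelve eexists (fun A : St => @idm St (quo_r d (Q A))).
    + intros A B f; etransitivity; [apply (comp_idl (c := St))|symmetry; apply (comp_idr (c := St))].
    + intro A; apply is_iso_id.
Qed.

Let recollement_functors (d : adjoint_functors Y) : Prop :=
  recollement (T' := sub_tri TY) (T := stable_tri S) (T'' := AY) (incl (C := St) Y) Q d.

Lemma triple_recollement (d : adjoint_functors Y) :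
  triple_adjoints X Z hY d -> recollement_functors d.
Proof.
  intros (H1 & H2 & H3 & H4).
  exact (recollement_of_adjoints H1 H2 (is_C_coreflects H3) (is_E_reflects H4)).
Qed.

Lemma injective_recollement (d : adjoint_functors Y) :
  injective_adjoints X Z hY d -> recollement_functors d.
Proof.
  intros (H1 & H2 & H3 & H4).
  exact (recollement_of_adjoints H1 H2 (injective_coreflects H3) (is_E_reflects H4)).
Qed.

Lemma projective_recollement (d : adjoint_functors Y) :
  projective_adjoints X Z hY d -> recollement_functors d.
Proof.
  intros (H1 & H2 & H3 & H4).
  exact (recollement_of_adjoints H1 H2 (is_C_coreflects H3) (projective_reflects H4)).
Qed.

Lemma recollements_same_adjoints (d d' : adjoint_functors Y) :
  recollement_functors d -> recollement_functors d' -> same_adjoints d d'.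
Proof.
  intros H H'; split; [|split; [|split]].
  - exact (left_adjoint_unique (rec_inc_l H) (rec_inc_l H')).
  - exact (right_adjoint_unique (rec_inc_r H) (rec_inc_r H')).
  - exact (left_adjoint_unique (rec_quo_l H) (rec_quo_l H')).
  - exact (right_adjoint_unique (rec_quo_r H) (rec_quo_r H')).
Qed.
End TorsionTriple.

Theorem corollary4p5
  (A : ExactCategory) (hF : frobenius A) (hWIC : weakly_idempotent_complete A)
  (S : suspension A) (X Y Z : A -> Prop) :
  (localizing_cotorsion_triple X Y Z <-> torsion_triple (T := stable_tri S) X Y Z)
  /\
  forall h : torsion_triple (T := stable_tri S) X Y Z,
  let hY := thick_projinj (tt_thick_m h) in
  let subX := sub_tri (tt_thick_l h) in
  let subY := sub_tri (tt_thick_m h) in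
  let subZ := sub_tri (tt_thick_r h) in
  let W := @projinj A in
  let all := fun _ : A => True in
  let I : Functor subY (stable_tri S) := incl (C := stable A) Y in
  let Q := quotient hY in
  inhabited (loc_shift S hY) /\
  forall L : loc_shift S hY,
  let AY := loc_tri L in
  let is_recollement (d : adjoint_functors Y) :=
    recollement (T' := subY) (T := stable_tri S) (T'' := AY) I Q d in
  triangle_equivalent subX AY /\ triangle_equivalent AY subZ /\
  (* (1) *)
  (injective_recollement_hypotheses W all X Y Y Z /\
   (exists d : adjoint_functors Y, triple_adjoints X Z hY d) /\
   forall d : adjoint_functors Y, triple_adjoints X Z hY d ->
     is_recollement d /\
     injective_adjoints X Z hY d /\
     (forall d', injective_adjoints X Z hY d' ->
        is_recollement d' /\ same_adjoints d d') /\
     (forall B : stable A, essential_image (quo_l d) B <-> X B) /\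
     (forall B : stable A, essential_image (quo_r d) B <-> Z B) /\
     exists (hl : forall B : AY, X (quo_l d B)) (hr : forall B : AY, Z (quo_r d B)),
       triangulated_equivalence (T := subZ) (T' := subX)
         (corestrict (D := stable A) (P := X)
            (F := quo_l d ∘F Q ∘F incl (C := stable A) Z) (fun B => hl _))
         (corestrict (D := stable A) (P := Z)
            (F := quo_r d ∘F Q ∘F incl (C := stable A) X) (fun B => hr _)))
  /\
  (* (2) *)
  (projective_recollement_hypotheses all W Y Z X Y /\
   forall d : adjoint_functors Y, triple_adjoints X Z hY d ->
     projective_adjoints X Z hY d /\
     forall d', projective_adjoints X Z hY d' ->
       is_recollement d' /\ same_adjoints d d').
Proof.
  split; [exact (localizing_triple_iff_torsion_triple hF S X Y Z)|].
  intros h hY subX subY subZ W all I Q.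
  split; [exact (loc_shift_exists hF h hY)|]; intros L AY is_recollement.
  destruct (recollement_hypotheses hF h) as [Hinj Hproj].
  assert (Hrec := fun d => triple_recollement hF h (hY := hY) L (d := d)).
  destruct (triple_adjoints_exist hF h hY) as [d0 Hd0].
  assert (Hd0' := Hd0); destruct Hd0' as (_ & _ & HC & HE).
  destruct (is_C_coreflects hF h HC) as [eps0 Heps0].
  destruct (is_E_reflects hF h HE) as [eta0 Heta0].
  split.
  { exists (Q ∘F incl (C := stable A) X),
      (corestrict (D := stable A) (P := X) (F := quo_l d0) (co_in Heps0)).
    destruct (coreflects_equivalence hF h L Heps0 (co_in Heps0)) as (H1 & H2 & H3).
    split; [exact H2|split; [exact H1|exact (quasi_inverse_sym H3)]]. }
  split.
  { exists (corestrict (D := stable A) (P := Z) (F := quo_r d0) (re_in Heta0)),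
      (Q ∘F incl (C := stable A) Z).
    exact (reflects_equivalence hF h L Heta0 (re_in Heta0)). }
  split.
  - split; [exact Hinj|split; [exists d0; exact Hd0|]].
    intros d Hd; split; [exact (Hrec d Hd)|split; [exact (triple_injective Hd)|]].
    split.
    { intros d' Hd'; pose proof (injective_recollement hF h L Hd') as Hr.
      split; [exact Hr|exact (recollements_same_adjoints (Hrec d Hd) Hr)]. }
    destruct Hd as (_ & _ & HCd & HEd).
    destruct (is_C_coreflects hF h HCd) as [eps Heps].
    destruct (is_E_reflects hF h HEd) as [eta Heta].
    split; [exact (coreflects_essential_image h Heps)|].
    split; [exact (reflects_essential_image h Heta)|].
    exists (co_in Heps), (re_in Heta).
    exact (left_right_equivalence hF h Heps Heta _ _).
  - split; [exact Hproj|]; intros d Hd; split; [exact (triple_projective Hd)|].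
    intros d' Hd'; pose proof (projective_recollement hF h L Hd') as Hr.
    split; [exact Hr|exact (recollements_same_adjoints (Hrec d Hd) Hr)].
Qed.
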